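(* Let $d$ be a positive integer, $A\in \mathbb{R}^{d\times d}$ and $b\in \mathbb{N}\setminus\{1\}$. Then the following are equivalent: (i) For every $x,y\in \mathbb{R}^d$ the sequence $(x^\top A^n y)$ is either $b$-Benford or terminating; (ii) The set $\sigma(A)$ is $b$-nonresonant.
   Context: $\mathbb{N}=\{1,2,3,\ldots\}$; sequences are indexed by $n\in\mathbb{N}$. $\sigma(A)\subset\mathbb{C}$ is the set of (complex) eigenvalues of $A$. Significand and Benford sequences: for an integer $b\ge 2$ and real $x\neq 0$, $S_b(x)$ is the unique real number in $[1,b)$ with $|x|=S_b(x)b^k$ for some integer $k$; $S_b(0):=0$. A real sequence $(x_n)$ is $b$-Benford if $\lim_{N\to\infty}\frac{\#\{n\le N: S_b(x_n)\le s\}}{N}=\log_b s$ for all $s\in[1,b)$. Terminating: $(x^\top A^n y)$ is terminating if $x^\top A^n y=0$ for all $n\ge d$. Nonresonance: for $z\in\mathbb{C}\setminus\{0\}$, $\arg z\in(-\pi,\pi]$ is the number with $z=|z|e^{i\arg z}$. Let $\mathbb{S}=\{z\in\mathbb{C}:|z|=1\}$. For $\mathcal{Z}\subset\mathbb{C}$, $\mathrm{span}_{\mathbb{Q}}\mathcal{Z}$ denotes the smallest $\mathbb{Q}$-linear subspace of $\mathbb{C}$ containing $\mathcal{Z}$. A non-empty set $\mathcal{Z}\subset r\mathbb{S}$ with $r>0$ is $b$-nonresonant if the set $\Delta_{\mathcal{Z}}:=\{1+\frac{\arg z-\arg w}{2\pi}: z,w\in\mathcal{Z}\}\subset\mathbb{R}$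 satisfies both $\Delta_{\mathcal{Z}}\cap\mathbb{Q}=\{1\}$ and $\log_b r\notin\mathrm{span}_{\mathbb{Q}}\Delta_{\mathcal{Z}}$. An arbitrary set $\mathcal{Z}\subset\mathbb{C}$ is $b$-nonresonant if for every $r>0$ the set $\mathcal{Z}\cap r\mathbb{S}$ is either $b$-nonresonant or empty; otherwise it is $b$-resonant. *)

(* Defs.v *)
From HB Require Import structures.
From mathcomp Require Export all_boot all_order all_algebra.
From mathcomp Require Export all_classical all_reals all_analysis.
From mathcomp Require Export complex.

Set Implicit Arguments.
Unset Strict Implicit.
Unset Printing Implicit Defensive.

Import Order.TTheory GRing.Theory Num.Theory numFieldNormedType.Exports.

Local Open Scope classical_set_scope.
Local Open Scope ring_scope.
Local Open Scope complex_scope.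

Definition logb (R : realType) (b : nat) (x : R) : R := ln x / ln b%:R.

(* Unique existence for [1 < b] and [x != 0] is [significandP] and
   [significand_uniq] below. *)
Definition is_significand (R : realType) (b : nat) (x s : R) : Prop :=
  1 <= s < b%:R /\ exists k : int, `|x| = s * b%:R ^ k.

Definition significand (R : realType) (b : nat) (x : R) : R :=
  if x == 0 then 0 else get [set s | is_significand b x s].

(* Sequences are indexed by the positive integers: the value [x 0] is never
   used. *)
Definition benford (R : realType) (b : nat) (x : nat -> R) : Prop :=
  forall s : R, 1 <= s < b%:R ->
    (fun N : nat =>
       (count (fun n => significand b (x n) <= s) (iota 1 N))%:R / N%:R : R)
      @ \oo --> logb b s.

Definition terminating (R : realType) (d : nat) (x : nat -> R) : Prop :=
  forall n : nat, (d <= n)%N -> x n = 0.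

(* [cos t +i* sin t] is exp(it); unique existence for [z != 0] is [argP] and
   [arg_uniq] below. *)
Definition is_arg (R : realType) (z : R[i]) (t : R) : Prop :=
  - pi < t <= pi /\ z = `|z| * (cos t +i* sin t).

Definition arg (R : realType) (z : R[i]) : R := get [set t | is_arg z t].

Definition Qsubspace (R : realType) (V : set R[i]) : Prop :=
  [/\ V 0,
      forall u v, V u -> V v -> V (u + v)
    & forall (q : rat) v, V v -> V (ratr q * v)].

Definition spanQ (R : realType) (Z : set R[i]) : set R[i] :=
  smallest (@Qsubspace R) Z.

Definition circle (R : realType) (r : R) : set R[i] := [set z | `|z| = r%:C].

Definition Delta (R : realType) (Z : set R[i]) : set R :=
  [set x | exists z w, [/\ Z z, Z w & x = 1 + (arg z - arg w) / (2 * pi)]].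

Definition circle_nonresonant (R : realType) (b : nat) (r : R)
    (Z : set R[i]) : Prop :=
  Delta Z `&` range (ratr : rat -> R) = [set 1] /\
  ~ spanQ [set x%:C | x in Delta Z] (logb b r)%:C.

Definition nonresonant (R : realType) (b : nat) (Z : set R[i]) : Prop :=
  forall r : R, 0 < r ->
    Z `&` circle r = set0 \/ circle_nonresonant b r (Z `&` circle r).

Definition spectrum (R : realType) (d : nat) (A : 'M[R]_d) : set R[i] :=
  [set z | eigenvalue (map_mx (real_complex R) A) z].

Section wellposed.
Variable R : realType.

Lemma significand_uniq (b : nat) (x s t : R) : (1 < b)%N ->
  is_significand b x s -> is_significand b x t -> s = t.
Proof.
move=> b1; have b1R : 1 < b%:R :> R by rewrite ltr1n.
have b0 : 0 < b%:R :> R by apply: lt_trans b1R.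
have main (u v : R) (k l : int) : 1 <= u < b%:R -> 1 <= v < b%:R ->
    u * b%:R ^ k = v * b%:R ^ l -> (l <= k).
  move=> /andP[u1 ub] /andP[v1 vb] e.
  rewrite leNgt; apply/negP => kl.
  have : v * b%:R ^ l < b%:R ^ (k + 1).
    by rewrite -e addrC expfzDr ?gt_eqF// expr1z ltr_pM2r// exprz_gt0.
  apply/negP; rewrite -leNgt.
  apply: (@le_trans _ _ (b%:R ^ l)).
    by rewrite ler_eXz2l// lezD1.
  by rewrite ler_peMl// ltW// exprz_gt0.
move=> [s1 [k ek]] [t1 [l el]].
have e : s * b%:R ^ k = t * b%:R ^ l by rewrite -ek.
have kl : k = l.
  by apply/eqP; rewrite eq_le (main _ _ _ _ s1 t1 e) (main _ _ _ _ t1 s1 (esym e)).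
move: e; rewrite kl; apply: mulIf.
by rewrite gt_eqF// exprz_gt0.
Qed.

Lemma significandP (b : nat) (x : R) : (1 < b)%N -> x != 0 ->
  is_significand b x (significand b x).
Proof.
move=> b1 x0; have b1R : 1 < b%:R :> R by rewrite ltr1n.
have b0 : 0 < b%:R :> R by apply: lt_trans b1R.
rewrite /significand (negbTE x0).
suff [s hs] : exists s, is_significand b x s by exact: (getI (P := is_significand b x) hs).
have lb : 0 < ln (b%:R : R) by rewrite ln_gt0.
have nx : 0 < `|x| by rewrite normr_gt0.
have pe (k : int) : b%:R ^ k = expR (k%:~R * ln b%:R) :> R.
  case: k => n; first by rewrite -exprnP -[X in X ^+ n](lnK b0) -expRM_natl.
  rewrite NegzE -exprnN -[X in X ^- _](lnK b0) -expRM_natl -expRN.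
  by rewrite mulrNz mulNr.
pose k := Num.floor (logb b `|x|).
have bk0 : 0 < (b%:R : R) ^ k by rewrite exprz_gt0.
exists (`|x| / b%:R ^ k); split; last first.
  by exists k; rewrite divfK// gt_eqF.
have lx : ln `|x| = logb b `|x| * ln b%:R by rewrite /logb divfK// gt_eqF.
have bk1 : b%:R * b%:R ^ k = b%:R ^ (1 + k) :> R.
  by rewrite expfzDr ?gt_eqF// expr1z.
rewrite ler_pdivlMr// mul1r ltr_pdivrMr// bk1 !pe -{1 2}(lnK nx) lx.
rewrite ler_expR ltr_expR ler_pM2r// ltr_pM2r// floor_le /= addrC.
exact: floorD1_gt.
Qed.

Lemma arg_uniq (z : R[i]) (s t : R) : z != 0 ->
  is_arg z s -> is_arg z t -> s = t.
Proof.
move=> z0 [/andP[s1 s2] es] [/andP[t1 t2] et].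
have nz : `|z| != 0 by rewrite normr_eq0.
have : cos s +i* sin s = cos t +i* sin t.
  by apply: (mulfI nz); rewrite -es -et.
case=> ec esn.
have neg (u : R) : - pi < u -> u < 0 -> sin u < 0.
  move=> u1 u2; rewrite -[u]opprK sinN oppr_lt0 sin_gt0_pi//.
  by rewrite oppr_gt0 u2 /= ltrNl.
have pos (u : R) : 0 <= u -> u <= pi -> 0 <= sin u.
  by move=> u1 u2; rewrite sin_ge0_pi// u1.
have [s0|s0] := leP 0 s; have [t0|t0] := leP 0 t.
- by apply: cos_inj => //; rewrite in_itv /= ?s0 ?t0.
- by have := neg t t1 t0; rewrite -esn ltNge pos.
- by have := neg s s1 s0; rewrite esn ltNge pos.
- apply: oppr_inj; apply: cos_inj; rewrite ?cosN// in_itv /=.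
    by rewrite oppr_ge0 ltW//= lerNl ltW.
  by rewrite oppr_ge0 ltW//= lerNl ltW.
Qed.

Lemma argP (z : R[i]) : z != 0 -> is_arg z (arg z).
Proof.
move=> z0; suff [t ht] : exists t, is_arg z t.
  exact: (getI (P := is_arg z) ht).
case: z z0 => x y z0.
pose r := Num.sqrt (x ^+ 2 + y ^+ 2).
have nE : `|x +i* y| = r%:C by [].
have r0 : 0 < r.
  rewrite lt_neqAle sqrtr_ge0 andbT eq_sym; apply: contra z0 => /eqP r0.
  by rewrite -normr_eq0 nE r0.
have r2 : x ^+ 2 + y ^+ 2 = r ^+ 2.
  by rewrite sqr_sqrtr// addr_ge0 ?sqr_ge0.
pose c := x / r.
have y2 : 1 - c ^+ 2 = (y / r) ^+ 2.
  rewrite /c !expr_div_n -[1](@divff _ (r ^+ 2)) ?expf_neq0 ?gt_eqF//.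
  by rewrite -mulrBl -r2 addrAC subrr add0r.
have c1 : -1 <= c <= 1.
  by rewrite -ler_norml -(@expr_le1 _ 2)// real_normK ?num_real// -subr_ge0 y2 sqr_ge0.
have cc : cos (acos c) = c by rewrite acosK// in_itv.
have ss : sin (acos c) = `|y| / r.
  by rewrite sin_acos// y2 sqrtr_sqr normrM (gtr0_norm (x := r^-1)) ?invr_gt0.
have fin (t : R) : cos t = x / r -> sin t = y / r ->
    x +i* y = `|x +i* y| * (cos t +i* sin t).
  move=> -> ->; rewrite nE; apply/eqP; rewrite eq_complex /=.
  have rK (u : R) : r * (u / r) = u by rewrite mulrC divfK// gt_eqF.
  by rewrite !rK !mul0r subr0 addr0 !eqxx.
have [y0|y0] := leP 0 y.
  exists (acos c); split; last by apply: fin; rewrite ?ss ?ger0_norm.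
  by rewrite acos_lepi// andbT (lt_le_trans _ (acos_ge0 c1))// oppr_lt0 pi_gt0.
exists (- acos c); split; last first.
  by apply: fin; rewrite ?cosN ?sinN ?ss// ltr0_norm// mulNr opprK.
rewrite ltrN2 (@le_trans _ _ 0) ?andbT ?pi_ge0 ?oppr_le0 ?acos_ge0//.
rewrite lt_neqAle acos_lepi// andbT; apply/eqP => e.
by move: ss; rewrite e sinpi => /esym/eqP; rewrite mulf_eq0 normr_eq0 invr_eq0 lt_eqF ?gt_eqF.
Qed.

End wellposed.

(* Main.v *)
(* Write z = r u with |u| = 1 for the eigenvalues z of modulus r, and e(t) for
   exp(2 pi i t).

   (ii) => (i).  Unless it terminates, |x^T A^n y| = C(n,k) r^n |f(n) + o(1)|
   where f(n) is a sum of c_j u_j^n with c_j <> 0 and no quotient u_i / u_j a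
   root of unity; hence f is small only on a set of small density.  The u_j
   belong to the group H of all e(t) with t in the span of Delta, of which
   no nontrivial power of zeta = e(log_b r) is an element.  So there are p with all
   u_j^p close to 1 and zeta^p close to any prescribed point: otherwise the
   means of large powers of |1 + sum u_j^n + conj(w) zeta^n| would depend on w.
   Shifting n by such a p rotates log_b |x_n| mod 1 by a prescribed angle, and
   counting in Q rotated copies shows that an arc of length l receives an upper
   density at most l.

   (i) => (ii).  If z <> w have the same modulus and z^h = w^h, some
   Re (c (z^n - w^n)) vanishes on the multiples of h without terminating.
   If log_b r is in the span of Delta, some chi = e(h log_b r) is a product of M
   numbers u or 1/u, where M can be taken even.  Put L_n = Re (sum u^n) and
   psi(v) = |v|^(2 pi i s) with s = h / ln b.  The sequences
   r^n (t L_n + Re (xi u_1^n)) being Benford or terminating, chi^n psi(t L_n +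
   Re (xi u_1^n)) has mean zero for all t and xi.  Averaging xi over the unit disc
   with the weight sqrt(1 - |xi|^2) makes this independent of u_1^n and replaces psi
   by a function of t L_n that is smooth near 0, with nonzero even Taylor
   coefficients.  Comparing the terms t^M gives mean(chi^n L_n^M) = 0; but
   this mean is 2^-M times the number of words of length M with product 1/chi. *)
From HB Require Import structures.
Require Import Defs.
From mathcomp Require Import measurable_realfun.
From mathcomp Require Import ring lra zify.
Set Implicit Arguments.
Unset Strict Implicit.
Unset Printing Implicit Defensive.
Import Order.TTheory GRing.Theory Num.Theory numFieldNormedType.Exports.
Local Open Scope ring_scope.
Local Open Scope complex_scope.
Local Notation Re := (@complex.Re _).
Local Notation Im := (@complex.Im _).

(** * Complex exponentials and Cesaro means *)

(** The bases u_j may satisfy relations among themselves, so the classical theorem on rationally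
    independent angles does not apply directly; a moment argument uses only the separation of zeta
    from the group H. Densities are estimated only from above: an arc and its complement have
    lengths adding up to 1, which forces equality.

    The obstacle in the converse is that psi oscillates without limit at 0, so means of chi^n psi(t
    L_n + Re (xi u_1^n)) need not be smooth in t. The weight sqrt(1 - |xi|^2) is chosen because its
    integral along the chord at distance y from 0 is a constant times the polynomial 1 - y^2. The
    average of psi thus has an elementary antiderivative and explicit Taylor coefficients, built
    from factors n + w with n an integer and w imaginary and nonzero; so the even ones cannot
    vanish. The odd ones do vanish, psi being even, and this is why M has to be even; doubling h
    doubles the word. No cancellation can occur in the final count: every word contributes 0 or 1,
    and the given one contributes 1. *)

Section complex_modulus.
Variable R : realType.
Implicit Types (z w : R[i]) (x : R).

(** The norm of [R[i]] takes its values in [R[i]]; [nm] is the real number behind it, so that real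
    arithmetic applies to estimates. *)
Definition nm z : R := ComplexField.Normc.normc z.

Lemma normcE_nm z : `|z| = (nm z)%:C. Proof. by []. Qed.

Lemma nm_ge0 z : 0 <= nm z.
Proof. by rewrite -(@lecR R) -normcE_nm normr_ge0. Qed.

Lemma nm0 : nm 0 = 0. Proof. exact: ComplexField.Normc.normc0. Qed.

Lemma nm1 : nm 1 = 1. Proof. exact: ComplexField.Normc.normc1. Qed.

Lemma nmM z w : nm (z * w) = nm z * nm w.
Proof. exact: ComplexField.Normc.normcM. Qed.

Lemma nmV z : nm z^-1 = (nm z)^-1.
Proof. exact: ComplexField.Normc.normcV. Qed.

Lemma nmD z w : nm (z + w) <= nm z + nm w.
Proof. by rewrite -(@lecR R) raddfD/= -!normcE_nm ler_normD. Qed.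

Lemma nmN z : nm (- z) = nm z.
Proof. by apply/eqP; rewrite -(inj_eq (@complexI R)) -!normcE_nm normrN. Qed.

Lemma nmB z w : nm (z - w) <= nm z + nm w.
Proof. by rewrite -[nm w]nmN nmD. Qed.

Lemma nm_eq0 z : (nm z == 0) = (z == 0).
Proof. by rewrite -(inj_eq (@complexI R)) -normcE_nm normr_eq0. Qed.

Lemma nm_gt0 z : (0 < nm z) = (z != 0).
Proof. by rewrite lt0r nm_eq0 nm_ge0 andbT. Qed.

Lemma nm_distC z w : nm (z - w) = nm (w - z).
Proof. by rewrite -nmN opprB. Qed.

Lemma nm_sub_le z w : nm z - nm w <= nm (z - w).
Proof. by rewrite lerBlDr; apply: le_trans (nmD _ _); rewrite subrK. Qed.

Lemma nm_dist_le z w : `|nm z - nm w| <= nm (z - w).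
Proof. by rewrite ler_norml nm_sub_le andbT lerNl opprB nm_distC nm_sub_le. Qed.

Lemma nmX z n : nm (z ^+ n) = nm z ^+ n.
Proof. by elim: n => [|n IH]; rewrite ?expr0 ?nm1// !exprS nmM IH. Qed.

Lemma nmR x : nm x%:C = `|x|.
Proof. by rewrite /nm /= expr0n /= addr0 sqrtr_sqr. Qed.

Lemma nm_nat n : nm n%:R = n%:R.
Proof. by rewrite -(rmorph_nat (real_complex R)) nmR ger0_norm. Qed.

Lemma nm_sum (I : Type) (r : seq I) (P : pred I) (F : I -> R[i]) :
  nm (\sum_(i <- r | P i) F i) <= \sum_(i <- r | P i) nm (F i).
Proof.
elim/big_rec2: _ => [|i x y _ h]; first by rewrite nm0.
by apply: le_trans (nmD _ _) _; rewrite lerD2l.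
Qed.

Lemma nm2 z : nm z ^+ 2 = Re z ^+ 2 + Im z ^+ 2.
Proof.
by case: z => a b /=; rewrite /nm /= sqr_sqrtr// addr_ge0// sqr_ge0.
Qed.

Definition cj z : R[i] := let: a +i* b := z in a -i* b.

Lemma cjD z w : cj (z + w) = cj z + cj w.
Proof. by case: z => a b; case: w => c d; rewrite /cj /= opprD. Qed.

Lemma cjM z w : cj (z * w) = cj z * cj w.
Proof.
case: z => a b; case: w => c d; rewrite /cj /=.
by apply/eqP; rewrite eq_complex /=; apply/andP; split; apply/eqP; ring.
Qed.

Lemma cjR x : cj x%:C = x%:C.
Proof. by rewrite /cj /= oppr0. Qed.

Lemma cj1 : cj 1 = 1. Proof. exact: cjR 1. Qed.

Lemma cjX z n : cj (z ^+ n) = cj z ^+ n.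
Proof.
by elim: n => [|n IH]; rewrite ?expr0 ?exprS ?cjM ?IH// cj1.
Qed.

Lemma cj_sum (I : Type) (r : seq I) (P : pred I) (F : I -> R[i]) :
  cj (\sum_(i <- r | P i) F i) = \sum_(i <- r | P i) cj (F i).
Proof. by elim/big_rec2: _ => [|i x y _ <-]; rewrite ?cjD// (cjR 0). Qed.

Lemma nm_conj z : nm (cj z) = nm z.
Proof. by case: z => a b; rewrite /nm /= sqrrN. Qed.

Lemma mul_conj z : z * cj z = (nm z ^+ 2)%:C.
Proof.
rewrite nm2; case: z => a b /=.
by apply/eqP; rewrite eq_complex /=; apply/andP; split; apply/eqP; ring.
Qed.

Lemma conj_unit z : nm z = 1 -> cj z = z^-1.
Proof.
move=> z1; have z0 : z != 0 by rewrite -nm_eq0 z1 oner_eq0.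
by apply: (mulfI z0); rewrite mul_conj z1 expr1n divff.
Qed.

Lemma norm_Re_le z : `|Re z| <= nm z.
Proof.
rewrite -(@ler_pXn2r _ 2) ?nnegrE ?nm_ge0// nm2 real_normK ?num_real//.
by rewrite lerDl sqr_ge0.
Qed.

Lemma nm_le_ReIm z : nm z <= `|Re z| + `|Im z|.
Proof.
rewrite -(@ler_pXn2r _ 2) ?nnegrE ?nm_ge0 ?addr_ge0// nm2.
rewrite sqrrD !real_normK ?num_real// addrAC lerDl mulrn_wge0//.
Qed.

Lemma ReD z w : Re (z + w) = Re z + Re w. Proof. by case: z; case: w. Qed.
Lemma ImD z w : Im (z + w) = Im z + Im w. Proof. by case: z; case: w. Qed.
Lemma ReM z w : Re (z * w) = Re z * Re w - Im z * Im w.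
Proof. by case: z; case: w. Qed.
Lemma ReB z w : Re (z - w) = Re z - Re w. Proof. by case: z; case: w. Qed.
Lemma ImB z w : Im (z - w) = Im z - Im w. Proof. by case: z; case: w. Qed.
Lemma Re_sum (I : Type) (r : seq I) (P : pred I) (F : I -> R[i]) :
  Re (\sum_(i <- r | P i) F i) = \sum_(i <- r | P i) Re (F i).
Proof. by elim/big_rec2: _ => // i x y _ <-; rewrite ReD. Qed.
Lemma ReZ x z : Re (x%:C * z) = x * Re z.
Proof. by rewrite ReM /= mul0r subr0. Qed.
End complex_modulus.

Section circle.
Variable R : realType.
Implicit Types (t s : R) (z w : R[i]).

Definition ee t : R[i] := cos (2 * pi * t) +i* sin (2 * pi * t).

Lemma eeD t s : ee (t + s) = ee t * ee s.
Proof.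
rewrite /ee mulrDr cosD sinD; apply/eqP; rewrite eq_complex /=.
by apply/andP; split; apply/eqP; ring.
Qed.

Lemma ee0 : ee 0 = 1.
Proof. by rewrite /ee mulr0 cos0 sin0. Qed.

Lemma nm_ee t : nm (ee t) = 1.
Proof.
by apply: (@pexpIrn _ 2); rewrite ?nnegrE ?nm_ge0// nm2 /= cos2Dsin2 expr1n.
Qed.

Lemma ee_neq0 t : ee t != 0.
Proof. by rewrite -nm_eq0 nm_ee oner_eq0. Qed.

Lemma eeN t : ee (- t) = (ee t)^-1.
Proof.
by apply: (mulfI (ee_neq0 t)); rewrite -eeD subrr ee0 divff ?ee_neq0.
Qed.

Lemma eeB t s : ee (t - s) = ee t / ee s.
Proof. by rewrite eeD eeN. Qed.

Lemma ee1 : ee 1 = 1.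
Proof. by rewrite /ee mulr1 mulrC mulr_natr cos2pi sin2pi. Qed.

Lemma eeMn t n : ee (n%:R * t) = ee t ^+ n.
Proof.
elim: n => [|n IH]; first by rewrite mul0r ee0 expr0.
by rewrite -[n.+1]addn1 natrD mulrDl mul1r eeD IH exprD expr1.
Qed.

Lemma ee_nat n : ee n%:R = 1.
Proof. by rewrite -[n%:R]mulr1 eeMn ee1 expr1n. Qed.

Lemma ee_int (k : int) : ee k%:~R = 1.
Proof. by case: k => n; rewrite ?NegzE ?mulrNz ?eeN ee_nat ?invr1. Qed.

(** The real part suffices: with k the integer nearest to t, |ee t - 1| is at least 1 - cos(2 pi |t
    - k|), and the cosine decreases on [0, pi]. The cut at 1/2 keeps the angles in that interval. *)
Lemma ee_near (eta : R) : 0 < eta -> exists2 delta : R, 0 < delta &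
  forall t, nm (ee t - 1) < delta -> exists k : int, `|t - k%:~R| < eta.
Proof.
move=> eta0; pose et := Num.min eta (2^-1).
have et0 : 0 < et by rewrite lt_min eta0 invr_gt0 ltr0n.
have et2 : et <= 2^-1 by rewrite ge_min lexx orbT.
have pi0 := pi_gt0 R.
have itv (u : R) : 0 <= u <= 2^-1 -> 2 * pi * u \in `[0, pi].
  move=> /andP[u0 u2]; rewrite in_itv /=; apply/andP; split.
    by rewrite mulr_ge0// mulr_ge0// ltW.
  have -> : 2 * pi * u = (2 * u) * pi by ring.
  by rewrite -[leRHS]mul1r ler_wpM2r ?(ltW pi0)//; lra.
have c1 : cos (2 * pi * et) < 1.
  have i0 : (0 : R) \in `[0, pi] by rewrite in_itv /= lexx ltW.
  have ie : 2 * pi * et \in `[0, pi] by apply: itv; rewrite (ltW et0).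
  by rewrite -[X in _ < X]cos0 (ltr_cos i0 ie) mulr_gt0// mulr_gt0.
exists (1 - cos (2 * pi * et)); first by rewrite subr_gt0.
move=> t ht.
pose k := Num.floor (t + 2^-1); exists k.
have k1 : k%:~R <= t + 2^-1 by exact: floor_le.
have k2 : t + 2^-1 < k%:~R + 1.
  by rewrite -[1]/(1%:~R) -intrD; exact: floorD1_gt.
pose v := `|t - k%:~R|.
have v2 : v <= 2^-1 by rewrite ler_norml; lra.
suff vet : v < et by apply: lt_le_trans vet _; rewrite ge_min lexx.
rewrite ltNge; apply/negP => etv; move: ht; apply/negP; rewrite -leNgt.
have -> : ee t = ee (t - k%:~R) by rewrite eeB ee_int divr1.
apply: le_trans (norm_Re_le _); rewrite /= distrC.
have -> : cos (2 * pi * (t - k%:~R)) = cos (2 * pi * v).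
  rewrite /v; case: ger0P => _ //.
  by rewrite mulrN cosN.
apply: le_trans (ler_norm _); rewrite lerB//.
rewrite leNgt ltr_cos ?itv ?et2 ?(ltW et0) ?normr_ge0 ?v2//.
by rewrite -leNgt ler_pM2l// mulr_gt0.
Qed.

Lemma ee_eq1 t : ee t = 1 -> exists k : int, t = k%:~R.
Proof.
move=> e1; pose d := t - (Num.floor t)%:~R.
have d0 : 0 <= d by rewrite subr_ge0 floor_le.
have d1 : d < 1.
  by rewrite ltrBlDl -[1]/(1%:~R) -intrD; exact: floorD1_gt.
exists (Num.floor t); apply/eqP; rewrite -subr_eq0 -/d.
apply/negP => /negP dn; have dp : 0 < d by rewrite lt_def dn.
(* An integer within this distance of the fractional part d would lie strictly between 0 and 1. *)
pose et := Num.min d (1 - d) / 2.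
have et0 : 0 < et by rewrite divr_gt0// lt_min dp subr_gt0.
have [delta delta0 hd] := ee_near et0.
have [|k hk] := hd d; first by rewrite /d eeB ee_int divr1 e1 subrr nm0.
have ed : et <= d / 2 by rewrite ler_pM2r ?invr_gt0// ge_min lexx.
have ed1 : et <= (1 - d) / 2 by rewrite ler_pM2r ?invr_gt0// ge_min lexx orbT.
move: hk; rewrite ltr_norml => /andP[h1 h2].
have k0 : (0 : R) < k%:~R by lra.
have k1 : (k%:~R : R) < 1%:~R by rewrite /=; lra.
by move: k0 k1; rewrite ltr0z ltr_int; case: (k) => // -[].
Qed.


Lemma ee_cont (eta : R) : 0 < eta -> exists2 delta : R, 0 < delta &
  forall t, `|t| < delta -> nm (ee t - 1) < eta.
Proof.
move=> eta0.
have h (f : R -> R) (c : R) : {for 0, continuous f} -> f 0 = c ->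
    exists2 d : R, 0 < d & forall t, `|t| < d -> `|f t - c| < eta / 2.
  move=> cf f0.
  have e2 : 0 < eta / 2 by rewrite divr_gt0.
  move/cvgrPdist_lt: cf => /(_ _ e2); rewrite f0 => /nbhs_ballP[d /= d0 hd].
  exists d => // t td; rewrite distrC; apply: hd.
  by rewrite /ball /= sub0r normrN.
have cc : continuous (fun t : R => 2 * pi * t).
  by move=> x; apply: cvgM; [exact: cvg_cst|exact: cvg_id].
have [d1 d10 h1] := h (fun t => cos (2 * pi * t)) 1
  (continuous_comp (cc 0) (@continuous_cos R _)) ltac:(by rewrite /= mulr0 cos0).
have [d2 d20 h2] := h (fun t => sin (2 * pi * t)) 0
  (continuous_comp (cc 0) (@continuous_sin R _)) ltac:(by rewrite /= mulr0 sin0).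
exists (Num.min d1 d2); first by rewrite lt_min d10.
move=> t; rewrite lt_min => /andP[t1 t2].
apply: le_lt_trans (nm_le_ReIm _) _; rewrite ReB ImB /=.
by rewrite [ltRHS]splitr ltrD ?h1 ?h2.
Qed.

Lemma unit_ee z : nm z = 1 -> z = ee (arg z / (2 * pi)).
Proof.
move=> z1; have z0 : z != 0 by rewrite -nm_eq0 z1 oner_eq0.
have [_ ez] := argP z0; rewrite {1}ez normcE_nm z1 mul1r /ee.
by have -> // : 2 * pi * (arg z / (2 * pi)) = arg z; rewrite mulrC divfK// mulf_neq0// gt_eqF// pi_gt0.
Qed.

Lemma polar_ee z : z != 0 -> z = (nm z)%:C * ee (arg z / (2 * pi)).
Proof.
move=> z0; have [_ ez] := argP z0; rewrite {1}ez normcE_nm /ee.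
by have -> // : 2 * pi * (arg z / (2 * pi)) = arg z; rewrite mulrC divfK// mulf_neq0// gt_eqF// pi_gt0.
Qed.

End circle.

Section cesaro.
Variable R : realType.
Implicit Types (u v : nat -> R[i]) (l : R[i]).

(** The convergence of Cesaro means to l, multiplied out by N: no division and no topology on the
    complex numbers is involved. *)
Definition cmean u l := forall eps : R, 0 < eps -> exists N0, forall N,
  (N0 <= N)%N -> nm (\sum_(n < N) u n - l * N%:R) <= eps * N%:R.

Lemma cmean_ext u v l : u =1 v -> cmean u l -> cmean v l.
Proof.
move=> uv hu e e0; have [N0 h] := hu e e0; exists N0 => N NN.
by rewrite (eq_bigr (fun n : 'I_N => u n)) ?h// => i _; rewrite uv.
Qed.

Lemma cmean_cst c : cmean (fun=> c) c.
Proof.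
move=> e e0; exists 0%N => N _.
by rewrite sumr_const card_ord mulr_natr subrr nm0 mulr_ge0// ltW.
Qed.

Lemma cmeanD u v l m : cmean u l -> cmean v m ->
  cmean (fun n => u n + v n) (l + m).
Proof.
move=> hu hv e e0; have e2 : 0 < e / 2 by rewrite divr_gt0.
have [N1 h1] := hu _ e2; have [N2 h2] := hv _ e2.
exists (maxn N1 N2) => N; rewrite geq_max => /andP[n1 n2].
rewrite big_split /= mulrDl opprD addrACA; apply: le_trans (nmD _ _) _.
by apply: le_trans (lerD (h1 _ n1) (h2 _ n2)) _; rewrite -mulrDl -splitr.
Qed.

Lemma cmeanZ c u l : cmean u l -> cmean (fun n => c * u n) (c * l).
Proof.
move=> hu e e0.
have cp : 0 < nm c + 1 by rewrite ltr_wpDl ?nm_ge0.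
have [N0 h] := hu (e / (nm c + 1)) (divr_gt0 e0 cp).
exists N0 => N NN; rewrite -mulr_sumr -mulrA -mulrBr nmM.
apply: le_trans (ler_wpM2l (nm_ge0 _) (h _ NN)) _.
rewrite mulrA ler_wpM2r// mulrCA ger_pMr// ler_pdivrMr// mul1r lerDl//.
Qed.

Lemma cmean_sum (I : Type) (r : seq I) (F : I -> nat -> R[i]) (L : I -> R[i]) :
  (forall i, cmean (F i) (L i)) ->
  cmean (fun n => \sum_(i <- r) F i n) (\sum_(i <- r) L i).
Proof.
move=> h; elim: r => [|i r IH].
  by rewrite big_nil; apply: cmean_ext (cmean_cst 0) => n; rewrite big_nil.
rewrite big_cons; apply: cmean_ext (cmeanD (h i) IH) => n.
by rewrite big_cons.
Qed.

Lemma cmean_sum0 (I : Type) (r : seq I) (F : I -> nat -> R[i]) :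
  (forall i, cmean (F i) 0) -> cmean (fun n => \sum_(i <- r) F i n) 0.
Proof. by move=> /(cmean_sum r); rewrite big1_eq. Qed.

(** For w different from 1 the partial sums are bounded by 2 / |w - 1|. *)
Lemma cmean_geo (w : R[i]) : nm w = 1 -> cmean (fun n => w ^+ n) (w == 1)%:R.
Proof.
move=> w1; case: eqVneq => [->|wn].
  by apply: cmean_ext (cmean_cst 1) => n; rewrite expr1n.
have d0 : 0 < nm (w - 1) by rewrite nm_gt0 subr_eq0.
move=> e e0; pose B := 2 / nm (w - 1).
exists (Num.bound (B / e)) => N NN.
rewrite mul0r subr0; apply: (@le_trans _ _ B).
  rewrite /B ler_pdivlMr// -nmM mulrC -subrX1.
  by apply: le_trans (nmB _ _) _; rewrite nmX w1 expr1n nm1.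
have hb : B / e < (Num.bound (B / e))%:R.
  by apply: archi_boundP; apply: divr_ge0; [apply: divr_ge0|]; rewrite ?ltW.
by rewrite mulrC -ler_pdivrMr// ltW// (lt_le_trans hb)// ler_nat.
Qed.

End cesaro.

(** * Trigonometric polynomials and returns to the identity *)

Lemma exists_expr_lt (R : realType) (x e : R) : 0 <= x < 1 -> 0 < e ->
  exists n : nat, x ^+ n < e.
Proof.
move=> /andP[x0 x1] e0.
have /cvgrPdist_lt /(_ e e0) [N _ h] := @cvg_expr R x (ltac:(by rewrite ger0_norm)).
by exists N; have := h N (leqnn N); rewrite sub0r normrN ger0_norm// exprn_ge0.
Qed.

Lemma bound_leM (R : realType) (c e : R) (N : nat) : 0 <= c -> 0 < e ->
  (Num.bound (c / e) <= N)%N -> c <= e * N%:R.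
Proof.
move=> c0 e0 h; rewrite mulrC -ler_pdivrMr// ltW//.
have hb : c / e < (Num.bound (c / e))%:R.
  by apply: archi_boundP; apply: divr_ge0 => //; exact: ltW.
by apply: lt_le_trans hb _; rewrite ler_nat.
Qed.

Section trigonometric_polynomials.
Variables (R : realType) (H : R[i] -> Prop).
Hypotheses (H1 : H 1) (HM : forall z w, H z -> H w -> H (z * w))
  (HV : forall z, H z -> H z^-1) (Hu : forall z, H z -> nm z = 1).

(** Bases may be repeated in the list, so that products and powers need no normal form. *)
Definition trig (f : nat -> R[i]) := exists l : seq (R[i] * R[i]),
  (forall p, p \in l -> H p.2) /\ forall n, f n = \sum_(p <- l) p.1 * p.2 ^+ n.

Lemma trig_ext f g : f =1 g -> trig f -> trig g.
Proof. by move=> fg [l [hl h]]; exists l; split=> // n; rewrite -fg. Qed.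

Lemma trig_geo c w : H w -> trig (fun n => c * w ^+ n).
Proof.
move=> hw; exists [:: (c, w)]; split=> [p|n]; last by rewrite big_seq1.
by rewrite inE => /eqP ->.
Qed.

Lemma trig_cst c : trig (fun=> c).
Proof. by apply: trig_ext (trig_geo c H1) => n; rewrite expr1n mulr1. Qed.

Lemma trigD f g : trig f -> trig g -> trig (fun n => f n + g n).
Proof.
move=> [l [hl h]] [k [hk h']]; exists (l ++ k); split=> [p|n].
  by rewrite mem_cat => /orP[/hl|/hk].
by rewrite big_cat /= h h'.
Qed.

Lemma trigM f g : trig f -> trig g -> trig (fun n => f n * g n).
Proof.
move=> [l [hl h]] [k [hk h']].
exists [seq (p.1 * q.1, p.2 * q.2) | p <- l, q <- k]; split=> [p|n].
  by move=> /allpairsP[[a b] [/hl ha /hk hb ->]]; exact: HM.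
rewrite big_allpairs_dep h h' mulr_suml; apply: eq_bigr => p _.
rewrite mulr_sumr; apply: eq_bigr => q _ /=.
by rewrite exprMn; ring.
Qed.

Lemma trig_sum (I : Type) (r : seq I) (F : I -> nat -> R[i]) :
  (forall i, trig (F i)) -> trig (fun n => \sum_(i <- r) F i n).
Proof.
move=> h; elim: r => [|i r IH].
  by apply: trig_ext (trig_cst 0) => n; rewrite big_nil.
by apply: trig_ext (trigD (h i) IH) => n; rewrite big_cons.
Qed.

Lemma trigX f k : trig f -> trig (fun n => f n ^+ k).
Proof.
move=> hf; elim: k => [|k IH]; first exact: trig_cst.
by apply: trig_ext (trigM hf IH) => n; rewrite exprS.
Qed.

Lemma trig_conj f : trig f -> trig (fun n => cj (f n)).
Proof.
move=> [l [hl h]]; exists [seq (cj p.1, p.2^-1) | p <- l]; split=> [p|n].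
  by move=> /mapP[q /hl hq ->]; exact: HV.
rewrite h big_map cj_sum big_seq [RHS]big_seq; apply: eq_bigr => p pl /=.
by rewrite cjM cjX (conj_unit (Hu (hl _ pl))).
Qed.

(** As H is a group, z w differs from 1 for every w in H, so each term is a geometric sequence of
    mean zero. *)
Lemma cmean_trig_twist f (z : R[i]) : nm z = 1 -> ~ H z -> trig f ->
  cmean (fun n => z ^+ n * f n) 0.
Proof.
move=> z1 hz [l [hl h]].
have h0 n : z ^+ n * f n = \sum_(p <- l) (z ^+ n * (p.1 * p.2 ^+ n)).
  by rewrite h mulr_sumr.
(* [cmean_sum0] asks for every index, so the terms outside [l] are set to 0. *)
apply: (@cmean_ext _ (fun n => \sum_(p <- l) (if p \in l then z ^+ n * (p.1 * p.2 ^+ n) else 0))).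
  by move=> n; rewrite h0 big_seq [RHS]big_seq; apply: eq_bigr => p ->.
apply: cmean_sum0 => p; have [pl|_] := boolP (p \in l); last exact: cmean_cst.
have w1 : nm (z * p.2) = 1 by rewrite nmM z1 mul1r (Hu (hl _ pl)).
have := cmeanZ p.1 (cmean_geo w1).
have -> : (z * p.2 == 1) = false.
  apply/negP => /eqP e; apply: hz.
  have p0 : p.2 != 0 by rewrite -nm_eq0 (Hu (hl _ pl)) oner_eq0.
  have -> : z = (p.2)^-1 by apply: (mulIf p0); rewrite e mulVf.
  by apply: HV; exact: hl.
by rewrite mulr0; apply: cmean_ext => n; rewrite exprMn; ring.
Qed.

Variable zeta : R[i].
Hypotheses (z1 : nm zeta = 1)
  (hz : forall i j : nat, H (zeta ^+ i / zeta ^+ j) -> i = j).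

(* Expanding the K-th powers binomially, the terms in which zeta and its
   conjugate do not cancel have mean zero, and in the other terms omega
   cancels as well. *)
Lemma cmean_power_invariant (B : nat -> R[i]) (om : R[i]) (K : nat) :
  trig B -> nm om = 1 ->
  cmean (fun n => (nm (B n + om * zeta ^+ n) ^+ (2 * K) -
                   nm (B n + zeta ^+ n) ^+ (2 * K))%:C) 0.
Proof.
move=> hB om1.
have z0 : zeta != 0 by rewrite -nm_eq0 z1 oner_eq0.
have expand (o : R[i]) n : nm o = 1 -> (nm (B n + o * zeta ^+ n) ^+ (2 * K))%:C =
    \sum_(i < K.+1) \sum_(j < K.+1) (o ^+ i * cj o ^+ j) *
      ((zeta ^+ i / zeta ^+ j) ^+ n * ('C(K, i)%:R * 'C(K, j)%:R *
        (B n ^+ (K - i) * cj (B n) ^+ (K - j)))).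
  move=> o1; rewrite exprM rmorphXn /= -mul_conj exprMn exprDn.
  rewrite cjD cjM cjX (conj_unit z1) exprDn mulr_suml; apply: eq_bigr => i _.
  rewrite mulr_sumr; apply: eq_bigr => j _.
  rewrite -[_ *+ 'C(K, i)]mulr_natr -[_ *+ 'C(K, j)]mulr_natr !exprMn !exprVn -!exprM (mulnC n i) (mulnC n j).
  set x1 := B n ^+ _; set x2 := cj (B n) ^+ _; set x3 := o ^+ i.
  set x4 := cj o ^+ j; set x5 := zeta ^+ _; set x6 := (zeta ^+ _)^-1.
  set x7 := _%:R; set x8 := _%:R; move: x1 x2 x3 x4 x5 x6 x7 x8.
  by clear => x1 x2 x3 x4 x5 x6 x7 x8; ring.
apply: (@cmean_ext _ (fun n => \sum_(i < K.+1) \sum_(j < K.+1)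
    (om ^+ i * cj om ^+ j - 1) * ((zeta ^+ i / zeta ^+ j) ^+ n * ('C(K, i)%:R * 'C(K, j)%:R *
        (B n ^+ (K - i) * cj (B n) ^+ (K - j)))))).
  move=> n; rewrite rmorphB /= expand//.
  have -> : B n + zeta ^+ n = B n + 1 * zeta ^+ n by rewrite mul1r.
  rewrite (expand 1) ?nm1// -sumrB; apply: eq_bigr => i _.
  rewrite -sumrB; apply: eq_bigr => j _.
  by rewrite cj1 !expr1n mulr1 mulrBl.
apply: cmean_sum0 => i; apply: cmean_sum0 => j.
have [eij|nij] := eqVneq (i : nat) j.
  have -> : om ^+ i * cj om ^+ j - 1 = 0.
    by rewrite eij -exprMn mul_conj om1 !expr1n subrr.
  by apply: cmean_ext (cmean_cst 0) => n; rewrite mul0r.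
rewrite -(mulr0 (om ^+ i * cj om ^+ j - 1)).
apply: cmeanZ; apply: cmean_trig_twist.
- by rewrite nmM nmV !nmX z1 !expr1n invr1 mulr1.
- by move=> /hz /eqP; rewrite (negbTE nij).
- apply: trigM; first exact: trig_cst.
  by apply: trigM; apply: trigX => //; exact: trig_conj.
Qed.

End trigonometric_polynomials.

Section returns.
Variable R : realType.

Lemma pigeonhole_seq (T : eqType) (Q : nat) (c : T -> 'I_Q.+1) (s : seq T) :
  exists k, (size s <= Q.+1 * count (fun x => c x == k) s)%N.
Proof.
apply/existsP; rewrite -[X in is_true X]negbK negb_exists; apply/negP => /forallP h.
have e : (size s = \sum_(k < Q.+1) count (fun x => c x == k) s)%N.
  elim: s {h} => [|x s IH]; first by rewrite big1.
  rewrite /= big_split /= -IH (bigD1 (c x)) //= eqxx big1 ?addn0 ?add1n//.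
  by move=> k; rewrite eq_sym => /negbTE ->.
have : (Q.+1 * size s <= Q.+1 * size s - Q.+1)%N.
  rewrite {1}e big_distrr /= -[X in (_ <= _ - X)%N]muln1 -mulnBr.
  apply: (@leq_trans (\sum_(k < Q.+1) (size s - 1))).
    apply: leq_sum => k _; move: (h k); rewrite -ltnNge.
    by case: (size s) => // n; rewrite ltnS subn1.
  by rewrite sum_nat_const card_ord.
have : (0 < size s)%N by move: (h ord0); rewrite -ltnNge; apply: leq_ltn_trans.
nia.
Qed.

(** Dirichlet's box argument, one angle after the other: each splits [0, 1) into Q + 1 cells, and
    passing to the fullest cell keeps at least a fraction 1 / (Q + 1) of the indices. What matters
    is that [C] does not depend on the sequence. *)
Lemma close_subseq (delta : R) (ths : seq R) : 0 < delta ->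
  exists2 C : nat, (0 < C)%N & forall s : seq nat, exists s',
    [/\ subseq s' s, (size s <= C * size s')%N &
      forall n n' t, n \in s' -> n' \in s' -> t \in ths ->
        nm (ee (n%:R * t - n'%:R * t) - 1) < delta].
Proof.
move=> d0; elim: ths => [|t ths [C C0 IH]].
  by exists 1%N => // s; exists s; split=> //; rewrite mul1n.
have [e e0 he] := ee_cont d0.
pose Q := Num.bound e^-1.
have hQ : e^-1 < Q%:R by apply: archi_boundP; rewrite invr_ge0 ltW.
have Q0 : 0 < (Q.+1%:R : R) by [].
pose fr (n : nat) : R := n%:R * t - (Num.floor (n%:R * t))%:~R.
have fr0 n : 0 <= fr n by rewrite subr_ge0 floor_le.
have fr1 n : fr n < 1.
  by rewrite ltrBlDl -[1]/(1%:~R) -intrD; exact: floorD1_gt.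
pose cell n : 'I_Q.+1 := inord (Num.truncn (Q.+1%:R * fr n)).
have cellP n : (cell n)%:R <= Q.+1%:R * fr n < (cell n)%:R + 1.
  have nn : 0 <= Q.+1%:R * fr n by rewrite mulr_ge0// ltW.
  rewrite /cell inordK; last first.
    rewrite -(@ltr_nat R); apply: (@le_lt_trans _ _ (Q.+1%:R * fr n)).
      by rewrite truncn_le.
    by rewrite -[ltRHS]mulr1 ltr_pM2l.
  by rewrite natr1 truncn_itv.
exists (Q.+1 * C)%N; first by rewrite muln_gt0.
move=> s; have [k hk] := pigeonhole_seq cell s.
have [s' [s's ss hs]] := IH [seq x <- s | cell x == k].
exists s'; split.
- exact: subseq_trans s's (filter_subseq _ _).
- apply: leq_trans hk _; rewrite -mulnA leq_mul2l /=.
  by move: ss; rewrite size_filter.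
move=> n n' v ns n's; rewrite inE => /orP[/eqP ->|]; last exact: hs.
have cn m : m \in s' -> cell m = k.
  by move=> /(mem_subseq s's); rewrite mem_filter => /andP[/eqP].
have -> : ee (n%:R * t - n'%:R * t) = ee (fr n - fr n').
  by rewrite /fr !eeB !ee_int !divr1.
apply: he; move: (cellP n) (cellP n'); rewrite !cn// => h1 h2.
have : `|Q.+1%:R * (fr n - fr n')| < 1 by rewrite ltr_norml; lra.
rewrite normrM (ger0_norm (ltW Q0)) mulrC -ltr_pdivlMr// => h.
apply: lt_trans h _; rewrite div1r invf_plt ?posrE//.
by apply: lt_trans hQ _; rewrite ltr_nat.
Qed.

Definition close1 (delta : R) (us : seq R[i]) (n : nat) :=
  all (fun u => nm (u ^+ n - 1) < delta) us.

(** On a subsequence where all powers stay close to one another, subtracting the least index turns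
    every index into a return time. Returns therefore have density at least 1 / C. *)
Lemma returns_dense (delta : R) (us : seq R[i]) : 0 < delta ->
  (forall u, u \in us -> nm u = 1) ->
  exists2 C : nat, (0 < C)%N & forall N : nat,
    (N <= C * count (close1 delta us) (iota 0 N))%N.
Proof.
move=> d0 hu; pose ths := [seq arg u / (2 * pi) | u <- us].
have [C C0 hC] := close_subseq ths d0.
exists C => // N; have [s [sN hs cs]] := hC (iota 0 N).
move: hs; rewrite size_iota => hs; apply: leq_trans hs _.
rewrite leq_mul2l; apply/orP; right.
case: s sN cs => // n0 s sN cs.
have /= srt : sorted ltn (n0 :: s) := subseq_sorted ltn_trans sN (iota_ltn_sorted 0 N).
have n0s x : x \in n0 :: s -> (n0 <= x)%N.
  rewrite inE => /orP[/eqP -> //|xs].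
  by apply/ltnW; exact: (allP (order_path_min ltn_trans srt)).
rewrite -size_filter.
apply: (@leq_trans (size (map (subn^~ n0) (n0 :: s)))); first by rewrite size_map.
apply: uniq_leq_size.
  rewrite map_inj_in_uniq; first exact: subseq_uniq sN (iota_uniq _ _).
  by move=> x y /n0s hx /n0s hy e; rewrite -(subnK hx) e subnK.
move=> p /mapP[x xs ->]; rewrite mem_filter; apply/andP; split; last first.
  have := mem_subseq sN xs; rewrite !mem_iota !add0n /=.
  by apply: leq_ltn_trans; rewrite leq_subr.
apply/allP => u uus.
have := cs x n0 (arg u / (2 * pi)) xs (mem_head _ _) (map_f _ uus).
by rewrite -mulrBl -natrB ?n0s// eeMn -unit_ee// hu.
Qed.

End returns.

(** * Simultaneous approximation *)

Section kronecker.
Variable R : realType.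
Implicit Types (us : seq R[i]).

(** By the parallelogram law |1 + v|^2 = 4 - |v - 1|^2, and (2 - eta^2 / 4)^2 >= 4 - eta^2. *)
Lemma nm_add1_far (eta : R) (v : R[i]) : nm v = 1 -> 0 < eta <= 1 ->
  eta <= nm (v - 1) -> nm (1 + v) <= 2 - eta ^+ 2 / 4.
Proof.
move=> v1 /andP[e0 e1] h.
have v2 := nm2 v; rewrite v1 expr1n in v2.
have e2 : eta ^+ 2 <= nm (v - 1) ^+ 2.
  by rewrite ler_pXn2r ?nnegrE ?nm_ge0// ltW.
rewrite -(@ler_pXn2r _ 2)// ?nnegrE ?nm_ge0//; last by nra.
move: e2; rewrite !nm2 ReB ImB ReD ImD /= => e2; nra.
Qed.

Lemma nm_sum_le (s : seq R[i]) : (forall v, v \in s -> nm v = 1) ->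
  nm (\sum_(v <- s) v) <= (size s)%:R.
Proof.
move=> h; apply: le_trans (nm_sum _ _ _) _.
rewrite big_seq (eq_bigr (fun=> 1)) => [|v vs]; last exact: h.
by rewrite -big_seq big_const_seq count_predT iter_addr_0.
Qed.

Lemma nm_sum_far (eta : R) (s : seq R[i]) : (forall v, v \in s -> nm v = 1) ->
  0 < eta <= 1 -> has (fun v => eta <= nm (v - 1)) s ->
  nm (1 + \sum_(v <- s) v) <= (size s)%:R + 1 - eta ^+ 2 / 4.
Proof.
move=> h e01 /hasP[v vs hv].
rewrite (perm_big _ (perm_to_rem vs)) big_cons addrA.
apply: le_trans (nmD _ _) _.
have := nm_add1_far (h _ vs) e01 hv.
have : nm (\sum_(j <- rem v s) j) <= (size (rem v s))%:R.
  by apply: nm_sum_le => w /mem_rem /h.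
rewrite size_rem//; have : (0 < size s)%N by case: (s) vs.
by case: (size s) => // n _ /=; rewrite -natr1; lra.
Qed.

Lemma nm_sum_close (delta : R) (s : seq R[i]) :
  all (fun v => nm (v - 1) < delta) s ->
  (size s)%:R + 1 - (size s)%:R * delta <= nm (1 + \sum_(v <- s) v).
Proof.
move=> h; apply: le_trans (norm_Re_le _); apply: le_trans (ler_norm _).
rewrite ReD /= [X in X - _]addrC -addrA lerD2l.
elim: s h => [|v s IH] /=; first by rewrite big_nil mul0r subrr.
move=> /andP[hv /IH {}IH]; rewrite big_cons ReD -natr1.
have : `|Re (v - 1)| < delta by apply: le_lt_trans (norm_Re_le _) hv.
rewrite ReB /= ltr_norml => /andP[h1 h2]; lra.
Qed.

Lemma sum_if_count (a : pred nat) (N : nat) (x : R) :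
  \sum_(n < N) (if a n then x else 0) = (count a (iota 0 N))%:R * x.
Proof.
elim: N => [|N IH]; first by rewrite big_ord0 mul0r.
have -> : iota 0 N.+1 = iota 0 N ++ [:: N] by rewrite -addn1 iotaD.
rewrite big_ord_recr IH count_cat /= addn0 natrD mulrDl.
by case: (a N); rewrite ?mul1r ?mul0r.
Qed.

Variable H : R[i] -> Prop.
Hypotheses (H1 : H 1) (HM : forall z w, H z -> H w -> H (z * w))
  (HV : forall z, H z -> H z^-1) (Hu : forall z, H z -> nm z = 1).
Variable zeta : R[i].
Hypotheses (z1 : nm zeta = 1)
  (hz : forall i j : nat, H (zeta ^+ i / zeta ^+ j) -> i = j).

(** If no such p existed, |B p + conj(om) zeta^p| would stay below the full length m + 1 by a fixed
    amount for all p > 0, whereas |B p + zeta^p| comes closer to m + 1 than that at the returns of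
    [zeta :: us]. For a large exponent 2K the two power means differ, against
    [cmean_power_invariant]. *)
Theorem kronecker us (om : R[i]) (eta : R) : (forall u, u \in us -> H u) ->
  nm om = 1 -> 0 < eta ->
  exists p, [/\ (0 < p)%N, close1 eta us p & nm (zeta ^+ p - om) < eta].
Proof.
move=> hus om1.
wlog : eta / eta <= 1 => [hw eta0|eta1 eta0].
  have [||p [p0 h1 h2]] := hw (Num.min eta 1).
  - by rewrite ge_min lexx orbT.
  - by rewrite lt_min eta0 ltr01.
  - exists p; split => //.
      by apply: sub_all h1 => u; rewrite lt_min => /andP[].
    by move: h2; rewrite lt_min => /andP[].
apply: contrapT => hno.
have far p : (0 < p)%N -> ~~ (close1 eta us p && (nm (zeta ^+ p - om) < eta)).
  by move=> p0; apply/negP => /andP[a b]; apply: hno; exists p.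
pose B n : R[i] := 1 + \sum_(u <- us) u ^+ n.
have tB : trig H B.
  apply: trigD => //; first exact: trig_cst.
  pose g (u : R[i]) n := if u \in us then u ^+ n else 0.
  apply: (@trig_ext _ _ (fun n => \sum_(u <- us) g u n)).
    by move=> n; rewrite big_seq [RHS]big_seq; apply: eq_bigr => u uu; rewrite /g uu.
  apply: trig_sum => // u; rewrite /g; have [uu|_] := boolP (u \in us).
    by apply: trig_ext (trig_geo 1 (hus _ uu)) => n; rewrite mul1r.
  exact: trig_cst.
have cj1' : nm (cj om) = 1 by rewrite nm_conj.
have us1 u : u \in us -> nm u = 1 by move=> /hus /Hu.
pose m := (size us).+1.
pose sq (o : R[i]) n := (o * zeta ^+ n) :: [seq u ^+ n | u <- us].
have sqE o n : B n + o * zeta ^+ n = 1 + \sum_(v <- sq o n) v.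
  by rewrite /sq big_cons big_map /B -!addrA; congr (_ + _); rewrite addrC.
have sq1 o n : nm o = 1 -> forall v, v \in sq o n -> nm v = 1.
  move=> o1 v; rewrite inE => /orP[/eqP ->|/mapP[u /us1 hu ->]].
    by rewrite nmM o1 nmX z1 expr1n mulr1.
  by rewrite nmX hu expr1n.
have sqs o n : size (sq o n) = m by rewrite /= size_map.
(* The loss in [nm_sum_far] due to one vector at distance eta from 1. The levels l1 and l2 lie kap
   and kap / 2 below the full length. *)
pose kap := eta ^+ 2 / 4.
have kap0 : 0 < kap by rewrite divr_gt0// exprn_gt0.
have kap1 : kap <= 4^-1 by rewrite ler_piMl// expr_le1// ltW.
pose l1 := m%:R + 1 - kap; pose l2 := m%:R + 1 - kap / 2.
have m1 : 1 <= (m%:R : R) by rewrite ler1n.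
have l10 : 0 <= l1 by rewrite /l1; lra.
have l12 : l1 < l2 by rewrite /l1 /l2; lra.
have l20 : 0 < l2 by apply: le_lt_trans l12.
have upper p : (0 < p)%N -> nm (B p + cj om * zeta ^+ p) <= l1.
  move=> p0; rewrite sqE /l1 -(sqs (cj om) p); apply: nm_sum_far.
  - exact: sq1.
  - by rewrite eta0.
  move: (far p p0); rewrite negb_and => /orP[].
    rewrite -has_predC => /hasP[u uu /=]; rewrite -leNgt => hu.
    by apply/orP; right; apply/hasP; exists (u ^+ p) => //; exact: map_f.
  rewrite -leNgt => hu; apply/orP; left.
  rewrite -[X in _ <= X]mul1r -om1 -nmM mulrBr mulrA mul_conj om1 expr1n mulr1 mul1r.
  exact: hu.
(* For m vectors within del of 1, [nm_sum_close] loses m * del = kap / 2. *)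
pose del := kap / (2 * m%:R).
have del0 : 0 < del by rewrite divr_gt0// mulr_gt0//; lra.
have lower p : close1 del (zeta :: us) p -> l2 <= nm (B p + zeta ^+ p).
  move=> hp; rewrite -[zeta ^+ p]mul1r sqE.
  have -> : l2 = (size (sq 1 p))%:R + 1 - (size (sq 1 p))%:R * del.
    by rewrite sqs /l2 /del; field; lra.
  apply: nm_sum_close; move: hp; rewrite /close1 /= mul1r => /andP[-> /=].
  by rewrite all_map.
have [C C0 hC] := @returns_dense _ del (zeta :: us) del0
  ltac:(by move=> u; rewrite inE => /orP[/eqP ->//|]; exact: us1).
have C0' : 0 < (C%:R : R) by rewrite ltr0n.
have [|K0 hK0] := @exists_expr_lt R (l1 / l2) (3 * C%:R)^-1 _ ltac:(by rewrite invr_gt0 mulr_gt0).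
  by rewrite divr_ge0 ?(ltW l20)// ltr_pdivrMr// mul1r.
pose K := K0; pose a := l2 ^+ (2 * K); pose b := l1 ^+ (2 * K).
have a0 : 0 < a by rewrite exprn_gt0.
have hab : b * (3 * C%:R) <= a.
  have r1 : 0 <= l1 / l2 <= 1.
    by rewrite divr_ge0 ?(ltW l20)//= ler_pdivrMr// mul1r ltW.
  have : (l1 / l2) ^+ (2 * K) <= (3 * C%:R)^-1.
    apply: le_trans (ltW hK0); rewrite mul2n -addnn exprD.
    by rewrite ler_piMl ?exprn_ge0 ?exprn_ile1//; case/andP: r1.
  rewrite expr_div_n -/a -/b ler_pdivrMr// => h.
  by rewrite mulrC -ler_pdivlMl ?mulr_gt0// mulrC [a * _]mulrC.
(* The first mean is below 2 eps, namely eps for the bound b and eps for the term n = 0; the second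
   is at least a / C = 3 eps; and the two differ by at most eps. *)
pose eps := a / (3 * C%:R).
have eps0 : 0 < eps by rewrite divr_gt0// mulr_gt0.
have [N0 hN0] := cmean_power_invariant H1 HM HV Hu z1 hz K tB cj1' eps0.
(* Only p > 0 was excluded, so the term n = 0 escapes the bound l1; N is taken so large that it
   weighs less than eps. *)
pose M := nm (B 0 + cj om * zeta ^+ 0) ^+ (2 * K).
pose N := maxn N0 (Num.bound (M / eps)).
have hN : M < N%:R * eps.
  rewrite -ltr_pdivrMr//; apply: lt_le_trans (archi_boundP _) _.
    by rewrite divr_ge0 ?(ltW eps0)// exprn_ge0// nm_ge0.
  by rewrite ler_nat leq_maxr.
have := hN0 N (leq_maxl _ _); rewrite mul0r subr0 -rmorph_sum nmR sumrB => hd.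
have s1 : \sum_(n < N) nm (B n + cj om * zeta ^+ n) ^+ (2 * K) <= M + N%:R * b.
  have : (0 < N)%N.
    rewrite -(@ltr_nat R) -(@ltr_pM2r _ eps)// mul0r; apply: le_lt_trans hN.
    by rewrite exprn_ge0// nm_ge0.
  case: (N) => // N' _; rewrite big_ord_recl lerD//.
  apply: (@le_trans _ _ (\sum_(n < N') b)).
    apply: ler_sum => n _; by apply: lerXn2r; rewrite ?nnegrE ?nm_ge0// upper.
  by rewrite sumr_const card_ord -[b *+ N']mulr_natl ler_wpM2r ?exprn_ge0// ler_nat.
have s2 : N%:R * (a / C%:R) <= \sum_(n < N) nm (B n + zeta ^+ n) ^+ (2 * K).
  apply: (@le_trans _ _ (\sum_(n < N) (if close1 del (zeta :: us) n then a else 0))).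
    rewrite sum_if_count mulrCA mulrC ler_pM2r// ler_pdivrMr//.
    by rewrite -natrM mulnC ler_nat hC.
  apply: ler_sum => n _; case: ifP => [/lower h|_].
    by apply: lerXn2r; rewrite ?nnegrE ?nm_ge0// ltW.
  by rewrite exprn_ge0// nm_ge0.
move: hd; rewrite ler_norml => /andP[hd _].
have hNb : N%:R * b <= N%:R * eps.
  by rewrite ler_wpM2l// /eps ler_pdivlMr// mulr_gt0.
have hNe : N%:R * (a / C%:R) = 3 * (N%:R * eps) by rewrite /eps; field; lra.
have : eps * N%:R = N%:R * eps by rewrite mulrC.
lra.
Qed.

End kronecker.

(** * Sparsity of the small values of exponential sums *)

Section sparse.
Variable R : realType.

Definition sparse (delta : R) (P : pred nat) := exists N0, forall N,
  (N0 <= N)%N -> (count P (iota 0 N))%:R <= delta * N%:R.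

Lemma count_cover (I : Type) (s : seq nat) (a b : pred nat) (hs : seq I)
    (c : I -> pred nat) : (forall n, a n -> b n || has (fun h => c h n) hs) ->
  (count a s <= count b s + \sum_(h <- hs) count (c h) s)%N.
Proof.
move=> abc; elim: s => [|x s IH] /=.
  by rewrite add0n.
rewrite big_split /= addnACA; apply: leq_add => //.
case: (boolP (a x)) => // /abc /orP[->//|hx].
apply: leq_trans (leq_addl _ _).
elim: hs hx {abc IH} => //= h hs IH; rewrite big_cons => /orP[->//|/IH hx].
exact: leq_trans hx (leq_addl _ _).
Qed.

Definition isolated (E : pred nat) K n :=
  E n && ~~ has (fun h => E (n + h)%N) (iota 1 K).

Lemma isolated_window (E : pred nat) K m L : (L <= K.+1)%N ->
  (count (isolated E K) (iota m L) <= 1)%N.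
Proof.
elim: L m => //= L IH m LK; case: (boolP (isolated E K m)) => [/andP[_ hm]|_].
  rewrite (@eq_in_count _ _ pred0) ?count_pred0// => x; rewrite mem_iota => /andP[x1 x2].
  apply/negP => /andP[Ex _]; move/negP: hm; apply; apply/hasP.
  exists (x - m)%N; first by rewrite mem_iota; lia.
  by have -> : (m + (x - m) = x)%N by lia.
by rewrite add0n IH//; apply: ltnW.
Qed.

Lemma isolated_count (E : pred nat) K N :
  (count (isolated E K) (iota 0 N) <= N %/ K.+1 + 1)%N.
Proof.
have h q m : (count (isolated E K) (iota m (q * K.+1)) <= q)%N.
  elim: q m => // q IH m; rewrite mulSn iotaD count_cat -[q.+1]add1n.
  by apply: leq_add; [exact: isolated_window|exact: IH].
apply: leq_trans (h _ 0%N).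
have NK : (N <= (N %/ K.+1 + 1) * K.+1)%N.
  by rewrite mulnDl mul1n {1}(divn_eq N K.+1) leq_add2l ltnW// ltn_mod.
by rewrite -(subnKC NK) iotaD count_cat leq_addr.
Qed.

Definition expsum (l : seq (R[i] * R[i])) n := \sum_(p <- l) p.1 * p.2 ^+ n.

Lemma expsum_cons p l n : expsum (p :: l) n = p.1 * p.2 ^+ n + expsum l n.
Proof. exact: big_cons. Qed.

(** No quotient of two bases is a root of unity. The comparison of head with tail follows the
    induction that eliminates the head. *)
Fixpoint nondegenerate (l : seq (R[i] * R[i])) : Prop :=
  if l is p :: l' then
    (forall q h, q \in l' -> (0 < h)%N -> p.2 ^+ h != q.2 ^+ h) /\ nondegenerate l'
  else True.

Lemma nondegenerate_map (f : R[i] * R[i] -> R[i]) (l : seq (R[i] * R[i])) :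
  nondegenerate l -> nondegenerate [seq (f p, p.2) | p <- l].
Proof.
elim: l => //= p l IH [h1 h2]; split; last exact: IH.
by move=> q h /mapP[q' ql ->] /= h0; apply: h1.
Qed.

(* f(n+h) - w^h f(n) eliminates the base w, and it is small whenever n and
   n + h are both places where f is small; such pairs with h bounded exist
   near all but sparsely many small values. *)
Lemma small_values_sparse (l : seq (R[i] * R[i])) : l != [::] ->
  (forall p, p \in l -> p.1 != 0 /\ nm p.2 = 1) -> nondegenerate l ->
  forall delta : R, 0 < delta ->
  exists2 eps : R, 0 < eps & sparse delta (fun n => nm (expsum l n) < eps).
Proof.
move: {2}(size l) (erefl (size l)) => m; elim: m l => [|m IH] [|[c w] l] //= [sl] _ hl [hw hl'] delta d0.
have [c0 w1] := hl _ (mem_head _ _); rewrite /= in c0 w1.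
case: l sl hl hw hl' => [|q l] sl hl hw hl'.
  exists (nm c); first by rewrite nm_gt0.
  exists 0%N => N _; rewrite (@eq_count _ _ pred0) ?count_pred0 ?mulr_ge0 ?(ltW d0)//.
  by move=> n /=; rewrite /expsum big_seq1 /= nmM nmX w1 expr1n mulr1 ltxx.
set l' := q :: l in sl hl hw hl'.
pose K := Num.bound (4 / delta).
have hK : 4 / delta < K.+1%:R.
  apply: lt_trans (_ : K%:R < _); last by rewrite ltr_nat.
  by apply: archi_boundP; rewrite divr_ge0// ltW.
clearbody K.
pose lh h := [seq (p.1 * (p.2 ^+ h - w ^+ h), p.2) | p <- l'].
have lhE h n : expsum (lh h) n =
    expsum ((c, w) :: l') (n + h) - w ^+ h * expsum ((c, w) :: l') n.
  have -> : expsum (lh h) n = expsum l' (n + h) - w ^+ h * expsum l' n.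
    rewrite /expsum /lh big_map mulr_sumr -sumrB; apply: eq_bigr => p _ /=.
    by rewrite exprD; ring.
  by rewrite (expsum_cons (c, w) l' (n + h)) (expsum_cons (c, w) l' n) /= exprD; ring.
(* One quarter of [delta] is meant for the isolated indices, one is shared by the K shifts, and one
   absorbs the additional 1 in [isolated_count]. *)
have d'0 : 0 < delta / (4 * K.+1%:R) by rewrite divr_gt0// mulr_gt0.
have [e [e0 [N0 hN0]]] : exists e, 0 < e /\ exists N0, forall N h, (N0 <= N)%N ->
    h \in iota 1 K -> (count (fun n => nm (expsum (lh h) n) < e) (iota 0 N))%:R
      <= delta / (4 * K.+1%:R) * N%:R.
  have : forall h, h \in iota 1 K -> (0 < h)%N by move=> h; rewrite mem_iota => /andP[].
  elim: (iota 1 K) => [|h hs IHh] hpos; first by exists 1; split=> //; exists 0%N.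
  have [|e1 [e10 [N1 h1]]] := IHh.
    by move=> h' hh'; apply: hpos; rewrite inE hh' orbT.
  have h0 : (0 < h)%N by apply: hpos; rewrite mem_head.
  have [||||e2 e20 [N2 h2]] := IH (lh h) _ _ _ _ _ d'0.
  - by rewrite size_map.
  - by [].
  - move=> p /mapP[p' pl ->] /=; have [|p0 ->] := hl p'; first by rewrite inE pl orbT.
    split=> //; rewrite mulf_neq0// subr_eq0 eq_sym; exact: (hw p' h).
  - exact: (nondegenerate_map (fun p => p.1 * (p.2 ^+ h - w ^+ h)) hl').
  exists (Num.min e1 e2); split; first by rewrite lt_min e10.
  exists (maxn N1 N2) => N h'; rewrite geq_max => /andP[n1 n2].
  rewrite inE => /orP[/eqP ->|hh'].
    apply: le_trans (h2 _ n2); rewrite ler_nat; apply: sub_count => n /=.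
    by rewrite lt_min => /andP[].
  apply: le_trans (h1 _ _ n1 hh'); rewrite ler_nat; apply: sub_count => n /=.
  by rewrite lt_min => /andP[].
(* Since w^h has modulus 1, two values below e / 2 make the combination [lh h] smaller than e. *)
exists (e / 2); first by rewrite divr_gt0.
set E := fun n => _.
exists (maxn N0 (Num.bound (4 / delta))) => N; rewrite geq_max => /andP[n0 n1].
have hN : 1 <= delta / 4 * N%:R.
  rewrite -[delta / 4]invf_div mulrC ler_pdivlMr ?divr_gt0// mul1r ltW//.
  apply: lt_le_trans (archi_boundP _) _; first by rewrite divr_ge0// ltW.
  by rewrite ler_nat.
have cov := @count_cover _ (iota 0 N) E (isolated E K) (iota 1 K)
  (fun h n => nm (expsum (lh h) n) < e).
have {cov}/cov : forall n, E n -> isolated E K n ||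
    has (fun h => nm (expsum (lh h) n) < e) (iota 1 K).
  move=> n En; rewrite /isolated En /=.
  case: (boolP (has (fun h => E (n + h)%N) (iota 1 K))) => //= /hasP[h hh Enh].
  apply/hasP; exists h => //; rewrite lhE [e]splitr.
  apply: le_lt_trans (nmB _ _) _; rewrite nmM nmX w1 expr1n mul1r.
  exact: ltrD.
rewrite -(ler_nat R) => /le_trans; apply; rewrite natrD natr_sum.
have h1 : (count (isolated E K) (iota 0 N))%:R <= delta / 4 * N%:R + 1.
  have := isolated_count E K N; rewrite -(ler_nat R) natrD => /le_trans; apply.
  rewrite lerD2r; apply: (@le_trans _ _ (N%:R / K.+1%:R)).
    by rewrite ler_pdivlMr// -natrM ler_nat leq_divM.
  rewrite mulrC ler_wpM2r// -[delta / 4]invf_div lef_pV2 ?posrE ?divr_gt0//.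
  exact: ltW.
have h2 : \sum_(h <- iota 1 K) (count (fun n => nm (expsum (lh h) n) < e) (iota 0 N))%:R
    <= delta / 4 * N%:R.
  apply: (@le_trans _ _ (\sum_(h <- iota 1 K) (delta / (4 * K.+1%:R) * N%:R))).
    by rewrite big_seq [leRHS]big_seq; apply: ler_sum => h hh; apply: hN0.
  rewrite big_const_seq count_predT size_iota iter_addr_0 -[_ *+ K]mulr_natl.
  have -> : K%:R * (delta / (4 * K.+1%:R) * N%:R) = (K%:R / K.+1%:R) * (delta / 4 * N%:R).
    by field; rewrite gt_eqF.
  rewrite ler_piMl// ?(le_trans _ hN)// ler_pdivrMr// mul1r ler_nat//.
lra.
Qed.

End sparse.

(** * Arcs modulo 1 and the Benford property of dominated sequences *)

Section arcs.
Variable R : realType.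

(** The arc from [al] to [be] modulo 1. Closed arcs are enough, as they are only ever bounded from
    above, and real endpoints let them be widened and rotated freely. *)
Definition hits (al be y : R) := `[< exists k : int, al <= y - k%:~R <= be >].

Lemma hitsP al be y : reflect (exists k : int, al <= y - k%:~R <= be) (hits al be y).
Proof. exact: asboolP. Qed.

(* i is determined by the integer i + Q k, which lies in an interval of
   length Q (be - al). *)
Lemma count_hits (al be y : R) (Q : nat) : (0 < Q)%N -> al <= be ->
  (count (fun i => hits al be (y - i%:R / Q%:R)) (iota 0 Q))%:R
    <= Q%:R * (be - al) + 1.
Proof.
move=> Q0 ab; pose M := Num.ceil (Q%:R * (y - be)).
have Q0' : 0 < (Q%:R : R) by rewrite ltr0n.
have len0 : 0 <= Q%:R * (be - al) by rewrite mulr_ge0 ?(ltW Q0')// subr_ge0.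
have M1 : Q%:R * (y - be) <= M%:~R by exact: ceil_ge.
have [g hg] : {g : nat -> nat & forall i, hits al be (y - i%:R / Q%:R) ->
    (g i <= Num.truncn (Q%:R * (be - al)))%N /\
    exists k : int, (i : int) + (Q : int) * k - M = (g i : int)}.
  apply: (@choice _ _ (fun i j => hits al be (y - i%:R / Q%:R) ->
    (j <= Num.truncn (Q%:R * (be - al)))%N /\
    exists k : int, (i : int) + (Q : int) * k - M = (j : int))) => i.
  case: (boolP (hits al be (y - i%:R / Q%:R))) => [/hitsP[k /andP[k1 k2]]|_]; last by exists 0%N.
  pose m : int := (i : int) + (Q : int) * k.
  have mE : (m%:~R : R) = i%:R + Q%:R * k%:~R by rewrite /m intrD intrM.
  have e : Q%:R * (y - i%:R / Q%:R - k%:~R) = Q%:R * y - m%:~R.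
    by rewrite mE; field; rewrite gt_eqF.
  have m1 : Q%:R * (y - be) <= m%:~R.
    by have := ler_wpM2l (ltW Q0') k2; rewrite e mulrBr; lra.
  have m2 : m%:~R <= Q%:R * (y - al).
    by have := ler_wpM2l (ltW Q0') k1; rewrite e mulrBr; lra.
  have Mm : (M <= m)%R by rewrite -ceil_le_int in m1.
  exists `|m - M|%N => _.
  have mM : (`|m - M|%N : int) = m - M by rewrite gez0_abs// subr_ge0.
  split; last by exists k; rewrite mM.
  rewrite truncn_ge_nat// -[X in X <= _]/((`|m - M|%N : int)%:~R) mM intrB.
  by rewrite !mulrBr in M1 m2 *; lra.
apply: (@le_trans _ _ (Num.truncn (Q%:R * (be - al))).+1%:R); last first.
  by rewrite -natr1 lerD2r truncn_le.
rewrite ler_nat -size_filter -(size_map g) -(size_iota 0 (Num.truncn _).+1).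
apply: uniq_leq_size.
  rewrite map_inj_in_uniq ?filter_uniq ?iota_uniq// => i j.
  rewrite !mem_filter !mem_iota !add0n => /andP[/hg[_ [k hk]] iQ] /andP[/hg[_ [l hl]] jQ] e.
  move: hk hl; rewrite e => <- /eqP; rewrite (inj_eq (addIr _)) => /eqP h.
  have kl : k = l by nia.
  by move: h; rewrite kl => /addIr [].
move=> j /(@mapP nat nat) [i im ->]; move: im; rewrite mem_filter => /andP[/hg[h _] _].
by rewrite mem_iota.
Qed.

Lemma ln_near1 (e : R) : 0 < e -> exists2 th : R, 0 < th <= 2^-1 &
  forall a, `|a - 1| <= th -> `|ln a| <= e.
Proof.
move=> e0.
have /cvgrPdist_le /(_ e e0) := @continuous_ln R 1 ltr01.
rewrite ln1 => /nbhs_ballP[d /= d0 hd].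
exists (Num.min (d / 2) 2^-1).
  by rewrite lt_min divr_gt0// invr_gt0 ltr0n ge_min lexx orbT.
move=> a; rewrite le_min => /andP[h _]; rewrite -normrN -[- ln a]sub0r; apply: hd.
by rewrite /ball /= distrC; apply: le_lt_trans h _; rewrite ltr_pdivrMr// ltr_pMr// ltr1n.
Qed.

End arcs.

Section dominated_sequences.
Variables (R : realType) (b : nat).
Hypothesis b1 : (1 < b)%N.

Lemma lnb_gt0 : 0 < ln (b%:R : R).
Proof. by rewrite ln_gt0// ltr1n. Qed.

Lemma logbM (x y : R) : 0 < x -> 0 < y -> logb b (x * y) = logb b x + logb b y.
Proof. by move=> x0 y0; rewrite /logb lnM ?posrE// mulrDl. Qed.

Lemma logbV (x : R) : 0 < x -> logb b x^-1 = - logb b x.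
Proof. by move=> x0; rewrite /logb lnV ?posrE// mulNr. Qed.

Lemma logbXn (x : R) n : 0 < x -> logb b (x ^+ n) = n%:R * logb b x.
Proof. by move=> x0; rewrite /logb lnXn// -[ln x *+ n]mulr_natl mulrA. Qed.

Lemma logbXz (k : int) : logb b (b%:R ^ k) = k%:~R :> R.
Proof.
have b0 : 0 < (b%:R : R) by rewrite ltr0n; apply: ltnW.
have lbb : logb b (b%:R : R) = 1 by rewrite /logb divff// gt_eqF// lnb_gt0.
case: k => n; first by rewrite -exprnP logbXn// lbb mulr1.
by rewrite NegzE -exprnN logbV ?exprn_gt0// logbXn// lbb mulr1 mulrNz.
Qed.

Lemma ler_logb (x y : R) : 0 < x -> 0 < y -> (logb b x <= logb b y) = (x <= y).
Proof. by move=> x0 y0; rewrite /logb ler_pM2r ?invr_gt0 ?lnb_gt0// ler_ln ?posrE. Qed.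

Lemma logb_significand (x : R) : x != 0 -> exists k : int,
  logb b `|x| = logb b (significand b x) + k%:~R /\
  1 <= significand b x < b%:R.
Proof.
move=> x0; have [s1 [k ek]] := significandP b1 x0; exists k; split=> //.
rewrite {1}ek logbM ?logbXz//; last by rewrite exprz_gt0// ltr0n ltnW.
by case/andP: s1 => s1 _; apply: lt_le_trans s1.
Qed.

Variables (r : R) (l : seq (R[i] * R[i])) (H : R[i] -> Prop).
Hypotheses (r0 : 0 < r) (l0 : l != [::])
  (hl : forall p, p \in l -> p.1 != 0 /\ H p.2) (ndl : nondegenerate l).
Hypotheses (H1 : H 1) (HM : forall z w, H z -> H w -> H (z * w))
  (HV : forall z, H z -> H z^-1) (Hu : forall z, H z -> nm z = 1)
  (hz : forall i j : nat, H (ee (logb b r) ^+ i / ee (logb b r) ^+ j) -> i = j).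
Variables (rho : nat -> R) (eps : nat -> R[i]) (x : nat -> R) (n0 : nat).
Hypotheses (rho0 : forall n, (n0 <= n)%N -> 0 < rho n)
  (rho1 : forall p (e : R), 0 < e -> exists N0, forall n, (N0 <= n)%N ->
     `|rho (n + p)%N / rho n - 1| <= e)
  (eps0 : forall e : R, 0 < e -> exists N0, forall n, (N0 <= n)%N -> nm (eps n) <= e)
  (xE : forall n, (n0 <= n)%N -> `|x n| = rho n * (r ^+ n * nm (expsum l n + eps n))).

Lemma logb_xE n : (n0 <= n)%N -> x n != 0 ->
  [/\ 0 < nm (expsum l n + eps n) &
   logb b `|x n| = logb b (rho n) + (n%:R * logb b r + logb b (nm (expsum l n + eps n)))].
Proof.
move=> nn xn.
have F0 : 0 < nm (expsum l n + eps n).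
  rewrite lt0r nm_ge0 andbT; apply/eqP => e; move: xn.
  by rewrite -normr_eq0 xE// e !mulr0 eqxx.
by split=> //; rewrite xE// logbM ?rho0 ?mulr_gt0 ?exprn_gt0// logbM ?exprn_gt0// logbXn.
Qed.

(** Where |f(n)| >= d the quotients of the bounded factor and of [rho] at n + p and n are both close
    to 1, so that only r^p remains. The tolerance [eta] must not depend on p, which is chosen
    afterwards. *)
Lemma shift_close (d e : R) : 0 < d -> 0 < e ->
  exists2 eta : R, 0 < eta & forall p, close1 eta (map snd l) p ->
  exists N0, forall n, (N0 <= n)%N -> d <= nm (expsum l n) ->
  [/\ x n != 0, x (n + p)%N != 0 &
    `|logb b `|x (n + p)%N| - logb b `|x n| - p%:R * logb b r| <= e].
Proof.
move=> d0 e0.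
have lb0 := lnb_gt0.
have e2 : 0 < e * ln (b%:R : R) / 2 by rewrite divr_gt0// mulr_gt0.
have [th /andP[th0 th1] hth] := ln_near1 e2.
pose S := \sum_(p <- l) nm p.1.
have S0 : 0 <= S by apply: sumr_ge0 => p _; exact: nm_ge0.
(* Three errors of at most th d / 6 arise: the shift of f and the remainders at n and n + p. Their
   sum th (d / 2) is at most th |F n|. *)
pose eta := th * d / 6 / (S + 1).
have S1 : 0 < S + 1 by rewrite ltr_wpDl.
have td : 0 < th * d / 6 by rewrite divr_gt0// mulr_gt0.
exists eta => [|p hp]; first by rewrite divr_gt0.
have [N1 hN1] := rho1 p th0.
have [N2 hN2] := eps0 td.
exists (maxn n0 (maxn N1 N2)) => n; rewrite !geq_max => /and3P[nn0 n1 n2] fd.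
have nnp := leq_trans nn0 (leq_addr p n).
pose F m := expsum l m + eps m.
have en : nm (eps n) <= th * d / 6 by exact: hN2.
have enp : nm (eps (n + p)) <= th * d / 6 by apply: hN2; exact: leq_trans n2 (leq_addr _ _).
have df : nm (expsum l (n + p) - expsum l n) <= th * d / 6.
  rewrite /expsum -sumrB; apply: le_trans (nm_sum _ _ _) _.
  apply: (@le_trans _ _ (\sum_(q <- l) nm q.1 * eta)).
    rewrite big_seq [leRHS]big_seq; apply: ler_sum => q ql.
    rewrite exprD -mulrBr -[X in _ - X]mulr1 -mulrBr !nmM nmX.
    have [_ /Hu ->] := hl ql; rewrite expr1n mul1r ler_wpM2l ?nm_ge0//.
    by apply/ltW/(allP hp)/map_f.
  rewrite -mulr_suml -/S /eta mulrCA ger_pMr// ler_pdivrMr// mul1r lerDl//.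
have thd : th * d <= d / 2 by nra.
have Fn : d / 2 <= nm (F n).
  have := nm_sub_le (expsum l n) (- eps n); rewrite nmN opprK -/(F n); lra.
have Fn0 : 0 < nm (F n) by apply: lt_le_trans Fn; rewrite divr_gt0.
have dF : `|nm (F (n + p)) - nm (F n)| <= th * d / 2.
  apply: le_trans (nm_dist_le _ _) _.
  have -> : F (n + p)%N - F n = (expsum l (n + p) - expsum l n) + (eps (n + p)%N - eps n).
    by rewrite /F; ring.
  apply: le_trans (nmD _ _) _; have := nmB (eps (n + p)%N) (eps n); lra.
have ratF : `|nm (F (n + p)) / nm (F n) - 1| <= th.
  have -> : nm (F (n + p)) / nm (F n) - 1 = (nm (F (n + p)) - nm (F n)) / nm (F n).
    by field; rewrite gt_eqF.
  rewrite normrM normfV (gtr0_norm Fn0) ler_pdivrMr//; nra.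
have Fp0 : 0 < nm (F (n + p)).
  by move: dF; rewrite ler_norml; nra.
have x0 m : (n0 <= m)%N -> 0 < nm (F m) -> x m != 0.
  by move=> mm Fm; rewrite -normr_eq0 xE// gt_eqF// !mulr_gt0 ?rho0 ?exprn_gt0.
have xn := x0 _ nn0 Fn0; have xnp := x0 _ nnp Fp0.
split=> //.
have [_ ->] := logb_xE nn0 xn; have [_ ->] := logb_xE nnp xnp.
have -> : logb b (rho (n + p)) + ((n + p)%:R * logb b r + logb b (nm (expsum l (n + p) + eps (n + p)%N)))
    - (logb b (rho n) + (n%:R * logb b r + logb b (nm (expsum l n + eps n)))) - p%:R * logb b r =
    logb b (rho (n + p)%N / rho n) + logb b (nm (F (n + p)) / nm (F n)).
  rewrite logbM ?rho0 ?invr_gt0 ?rho0// logbV ?rho0// [in RHS]logbM ?invr_gt0// logbV//.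
  by rewrite /F natrD; ring.
apply: le_trans (ler_normD _ _) _; rewrite [leRHS]splitr.
have small a : `|a - 1| <= th -> `|logb b a| <= e / 2.
  move=> /hth h; rewrite /logb normrM normfV (gtr0_norm lb0) ler_pdivrMr//.
  by rewrite mulrAC.
apply: lerD; apply: small => //; exact: hN1.
Qed.

Let L n := logb b `|x n|.

(** For each i < Q a shift p_i rotates by about i / Q, so almost every hit of the arc is carried to
    a hit of its i-th rotated copy. As a point lies in about Q (be - al) of the Q copies, counting
    pairs and dividing by Q gives the bound. Zeros are left out because their logarithm is a default
    value. *)
Lemma upper_density (al be e : R) : al <= be -> 0 < e ->
  exists N0, forall N, (N0 <= N)%N ->
  (count (fun n => (x n != 0) && hits al be (L n)) (iota 0 N))%:R
    <= (be - al + e) * N%:R.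
Proof.
(* The excess 5 / Q over the length consists of 1 from [count_hits] and 4 from widening the arc by 2
   / Q on both sides; it has to be at most e / 2. *)
move=> ab e0; pose Q := (Num.bound (10 / e)).+1.
have Q0 : 0 < (Q%:R : R) by [].
have hQ : 5 / Q%:R <= e / 2.
  rewrite ler_pdivrMr// -ler_pdivrMl ?divr_gt0// invf_div.
  have -> : 2 / e * 5 = 10 / e by field; rewrite gt_eqF.
  apply/ltW; apply: lt_trans (_ : (Num.bound (10 / e))%:R < _); last by rewrite ltr_nat.
  by apply: archi_boundP; rewrite divr_ge0// ltW.
have Q1 : (0 < Q)%N by [].
clearbody Q.
have q0 : 0 < Q%:R^-1 :> R by rewrite invr_gt0.
have [|d d0 [NE hE]] := small_values_sparse l0 _ ndl (divr_gt0 e0 (ltr0n R 4)).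
  by move=> p pl; have [? /Hu ?] := hl pl.
have [eta eta0 heta] := shift_close d0 q0.
have [dl dl0 hdl] := ee_near q0.
(* One 1 / Q is the error of [shift_close], the other that of the rotation obtained from
   [kronecker]. *)
pose g (i m : nat) := hits (al - 2 / Q%:R) (be + 2 / Q%:R) (L m - i%:R / Q%:R).
pose sm n := nm (expsum l n) < d.
pose a n := (x n != 0) && hits al be (L n).
have step (i : nat) : exists pN : nat * nat, forall n, (pN.2 <= n)%N ->
    d <= nm (expsum l n) -> a n -> g i (n + pN.1)%N.
  have md : 0 < Num.min eta dl by rewrite lt_min eta0.
  have [|p [_ p1 p2]] := kronecker H1 HM HV Hu (nm_ee _) hz (us := map snd l) _
    (nm_ee (i%:R / Q%:R)) md.
    by move=> u /mapP[p pl ->]; have [] := hl pl.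
  have [|N0 hN0] := heta p.
    by apply: sub_all p1 => u; rewrite lt_min => /andP[].
  exists (p, N0) => n nn fd /andP[_ /hitsP[k /andP[k1 k2]]].
  have [_ _ sh] := hN0 n nn fd.
  have [|k' hk'] := hdl (p%:R * logb b r - i%:R / Q%:R).
    rewrite eeB eeMn.
    have -> : ee (logb b r) ^+ p / ee (i%:R / Q%:R) - 1 =
        (ee (logb b r) ^+ p - ee (i%:R / Q%:R)) / ee (i%:R / Q%:R).
      by rewrite mulrBl divff// ee_neq0.
    by rewrite nmM nmV nm_ee invr1 mulr1; apply: lt_le_trans p2 _; rewrite ge_min lexx orbT.
  apply/hitsP; exists (k + k'); rewrite intrD.
  have -> : 2 / Q%:R = Q%:R^-1 + Q%:R^-1 :> R by rewrite mulr_natl mulr2n.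
  move: sh hk'; rewrite -/(L _) -/(L _) ler_norml ltr_norml.
  by move=> /andP[s1 s2] /andP[s3 s4] /=; lra.
have [pN hpN] := choice step.
pose C0 := (\sum_(i <- iota 0 Q) ((pN i).2 + (pN i).1))%N.
have [N1 hN1] : exists N1 : nat, forall N, (N1 <= N)%N -> C0%:R / Q%:R <= e / 4 * N%:R.
  exists (Num.bound (C0%:R / Q%:R / (e / 4) : R)) => N NN.
  by apply: bound_leM NN; [exact: divr_ge0|exact: divr_gt0].
exists (maxn NE N1) => N; rewrite geq_max => /andP[nE n1].
have one i : (count a (iota 0 N) <= count sm (iota 0 N)
    + ((pN i).2 + (pN i).1) + count (g i) (iota 0 N))%N.
  have cov := @count_cover _ (iota 0 N) a sm [:: true; false]
    (fun t n => if t then (n < (pN i).2)%N else g i (n + (pN i).1)%N).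
  apply: leq_trans (cov _) _.
    move=> n an /=; rewrite orbF; rewrite /sm; case: ltP => //= fd.
    by case: (leqP (pN i).2 n) => //= nn; apply: hpN.
  rewrite !big_cons big_nil addn0 -!addnA leq_add2l; apply: leq_add.
    have h M K : (count (fun n => (n < K)%N) (iota 0 M) <= K)%N.
      rewrite -size_filter -[X in (_ <= X)%N](size_iota 0); apply: uniq_leq_size.
        by rewrite filter_uniq// iota_uniq.
      by move=> n; rewrite mem_filter !mem_iota => /andP[].
    exact: h.
  have -> : count (fun n => g i (n + (pN i).1)%N) (iota 0 N) = count (g i) (iota (pN i).1 N).
    by rewrite -[(pN i).1 in RHS]addn0 iotaDl count_map; apply: eq_count => n /=; rewrite addnC.
  apply: (@leq_trans (count (g i) (iota 0 (N + (pN i).1)))).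
    by rewrite [(N + _)%N]addnC iotaD count_cat add0n leq_addl.
  rewrite iotaD count_cat addnC leq_add2r add0n.
  by apply: leq_trans (count_size _ _) _; rewrite size_iota.
(* Double counting: the sum over the rotations i becomes a sum over the indices m, where [row]
   bounds the number of copies that contain [L m]. *)
have tot : (Q * count a (iota 0 N) <= Q * count sm (iota 0 N)
    + C0 + \sum_(m <- iota 0 N) count (fun i => g i m) (iota 0 Q))%N.
  have -> : (\sum_(m <- iota 0 N) count (fun i => g i m) (iota 0 Q) =
      \sum_(i <- iota 0 Q) count (g i) (iota 0 N))%N.
    under eq_bigr do rewrite -sum1_count big_mkcond.
    rewrite exchange_big; apply: eq_bigr => i _.
    by rewrite -sum1_count [RHS]big_mkcond.
  have cst c : (Q * c = \sum_(i <- iota 0 Q) c)%N.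
    by rewrite big_const_seq count_predT size_iota iter_addn_0 mulnC.
  rewrite !cst /C0 -!big_split; apply: leq_sum => i _; exact: one.
have row m : (count (fun i => g i m) (iota 0 Q))%:R <= Q%:R * (be - al) + 5 :> R.
  apply: le_trans (count_hits _ Q1 _) _.
    by apply: le_trans (_ : be <= _); [lra|rewrite lerDl divr_ge0// ltW].
  have -> : Q%:R * (be + 2 / Q%:R - (al - 2 / Q%:R)) = Q%:R * (be - al) + 4.
    by field; rewrite gt_eqF.
  by lra.
have rows : \sum_(m <- iota 0 N) (count (fun i => g i m) (iota 0 Q))%:R
    <= N%:R * (Q%:R * (be - al) + 5) :> R.
  apply: (@le_trans _ _ (\sum_(m <- iota 0 N) (Q%:R * (be - al) + 5))).
    by apply: ler_sum => m _; exact: row.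
  by rewrite big_const_seq count_predT size_iota iter_addr_0 -[_ *+ N]mulr_natl.
move: tot; rewrite -(ler_nat R) !natrD !natrM natr_sum => tot.
have {}hE := hE _ nE; have {}hN1 := hN1 _ n1.
have C0Q : C0%:R = Q%:R * (C0%:R / Q%:R) :> R by rewrite mulrC divfK// gt_eqF.
have N0 : 0 <= (N%:R : R) by [].
rewrite -(ler_pM2l Q0); apply: le_trans tot _; rewrite C0Q.
have h1 := ler_wpM2l (ltW Q0) hE; have h2 := ler_wpM2l (ltW Q0) hN1.
have h3 : Q%:R * (5 / Q%:R * N%:R) <= Q%:R * (e / 2 * N%:R).
  by apply: ler_wpM2l; [exact: ltW|exact: ler_wpM2r].
have h4 : Q%:R * (5 / Q%:R * N%:R) = 5 * N%:R :> R by field; rewrite gt_eqF.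
have h5 : N%:R * (Q%:R * (be - al) + 5) = Q%:R * ((be - al) * N%:R) + 5 * N%:R.
  by ring.
have -> : Q%:R * ((be - al + e) * N%:R) = Q%:R * ((be - al) * N%:R)
  + (Q%:R * (e / 4 * N%:R) + Q%:R * (e / 4 * N%:R) + Q%:R * (e / 2 * N%:R)).
  by field.
rewrite h5 in rows; rewrite h4 in h3.
move: h1 h2 h3 rows; set A1 := Q%:R * (e / 4 * N%:R); set A2 := Q%:R * (e / 2 * N%:R).
set A3 := Q%:R * (count _ _)%:R; set A4 := Q%:R * (C0%:R / _); set A5 := \sum_(i <- _) _.
set A6 := Q%:R * ((be - al) * N%:R); move: A1 A2 A3 A4 A5 A6 => A1 A2 A3 A4 A5 A6.
by lra.
Qed.

(** Significands at most s lead to the arc [0, log_b s] and larger ones to [log_b s, 1]; the lengths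
    add up to 1, so two upper bounds determine the limit. Zeros have significand 0, fall on the
    first side and are sparse. *)
Lemma benford_of_expsum : benford b x.
Proof.
have lb0 := lnb_gt0.
move=> s /andP[s1 sb]; pose sg := logb b s.
have s0 : 0 < s by apply: lt_le_trans s1.
have sg0 : 0 <= sg by rewrite /sg /logb divr_ge0 ?(ltW lb0)// ln_ge0.
have sg1 : sg <= 1.
  rewrite -[1]/(1%:~R) -(logbXz 1) expr1z ler_logb// ?ltW//.
  exact: lt_trans sb.
have up1 := @upper_density 0 sg _ sg0.
have up2 := @upper_density sg 1 _ sg1.
have zer (e : R) : 0 < e -> exists N0, forall N, (N0 <= N)%N ->
    (count (fun n => x n == 0) (iota 0 N))%:R <= e * N%:R.
  move=> e0; have e2 : 0 < e / 2 by rewrite divr_gt0.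
  have [|d d0 [NE hE]] := small_values_sparse l0 _ ndl e2.
    by move=> p pl; have [? /Hu ?] := hl pl.
  have [N1 hN1] := eps0 (divr_gt0 d0 (ltr0n R 2)).
  pose M := maxn n0 N1.
  exists (maxn NE (Num.bound (M%:R / (e / 2)))) => N; rewrite geq_max => /andP[nE nM].
  have cov := @count_cover _ (iota 0 N) (fun n => x n == 0) (fun n => nm (expsum l n) < d)
    [:: tt] (fun _ n => (n < M)%N).
  have {cov}/cov : forall n, x n == 0 -> (nm (expsum l n) < d) || has (fun=> (n < M)%N) [:: tt].
    move=> n xn /=; rewrite orbF; case: (leqP M n); last by rewrite orbT.
    rewrite geq_max => /andP[nn n1]; rewrite orbF.
    have : nm (expsum l n + eps n) = 0.
      move: xn; rewrite -normr_eq0 xE// !mulf_eq0 gt_eqF ?rho0//= gt_eqF ?exprn_gt0//=.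
      by move/eqP.
    have := nm_sub_le (expsum l n) (- eps n); rewrite nmN opprK => h e3.
    have := hN1 n n1; rewrite e3 in h; lra.
  rewrite -(ler_nat R) big_seq1 natrD => h.
  have {}hE := hE _ nE.
  have hM : (count (fun n => (n < M)%N) (iota 0 N))%:R <= M%:R :> R.
    rewrite ler_nat -size_filter -[X in (_ <= X)%N](size_iota 0); apply: uniq_leq_size.
      by rewrite filter_uniq// iota_uniq.
    by move=> n; rewrite mem_filter !mem_iota => /andP[].
  have : M%:R <= e / 2 * N%:R.
    exact: bound_leM nM.
  have -> : e * N%:R = e / 2 * N%:R + e / 2 * N%:R by field.
  lra.
apply/cvgrPdist_le => e e0.
pose e4 := e / 4; have e40 : 0 < e4 by rewrite divr_gt0.
have [N1 h1] := up1 _ e40; have [N2 h2] := up2 _ e40; have [N3 h3] := zer _ e40.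
pose N4 := Num.bound (2 / e4 : R).
exists (maxn (maxn N1 N2) (maxn N3 N4).+1) => // N /=.
rewrite !geq_max => /andP[/andP[n1 n2]]; rewrite gtn_max => /andP[n3 n4].
have N0 : 0 < (N%:R : R) by rewrite ltr0n; apply: leq_ltn_trans n4.
have hN4 : 2 <= e4 * N%:R.
  by apply: bound_leM (ltnW n4).
pose sle n := significand b (x n) <= s.
set c := count _ _.
have small n : significand b (x n) <= s ->
    (x n == 0) || has (fun=> (x n != 0) && hits 0 sg (L n)) [:: tt].
  case: eqVneq => //= xn ss; rewrite orbF; apply/hitsP.
  have [k [eL /andP[k1 k2]]] := logb_significand xn.
  have S0 : 0 < significand b (x n) by apply: lt_le_trans k1.
  exists k; rewrite /L eL addrK /sg ler_logb// ss andbT.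
  by rewrite /logb divr_ge0 ?(ltW lb0)// ln_ge0.
have large n : ~~ (significand b (x n) <= s) -> (x n != 0) && hits sg 1 (L n).
  rewrite -ltNge => ss; have xn : x n != 0.
    apply: contraL ss => /eqP ->; rewrite /significand eqxx -leNgt; exact: ltW.
  rewrite xn /=; apply/hitsP.
  have [k [eL /andP[k1 k2]]] := logb_significand xn.
  have S0 : 0 < significand b (x n) by apply: lt_le_trans k1.
  exists k; rewrite /L eL addrK /sg ler_logb// (ltW ss) /=.
  by rewrite -[1]/(1%:~R) -(logbXz 1) expr1z ler_logb ?(ltW k2)//; exact: lt_trans k2.
(* [benford] counts over 1..N and the density bounds over 0..N-1; the additional index is absorbed
   by [e4 * N]. *)
have iota1 (a : pred nat) : (count a (iota 1 N) <= count a (iota 0 N.+1))%N.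
  by rewrite /= leq_addl.
have iotaS (a : pred nat) : (count a (iota 0 N.+1) <= count a (iota 0 N) + 1)%N.
  rewrite -addn1 iotaD count_cat leq_add2l /=; by case: (a _).
have c1 : c%:R <= (sg + e) * N%:R.
  have := @count_cover _ (iota 0 N) _ _ _ (fun (_ : unit) n => (x n != 0) && hits 0 sg (L n)) small.
  rewrite big_seq1 -(ler_nat R) natrD.
  have := leq_trans (iota1 sle) (iotaS _).
  rewrite -/c -(ler_nat R) natrD; have := h1 _ n1; have := h3 _ (ltnW n3).
  have -> : (sg + e) * N%:R = (sg - 0 + e4) * N%:R + e4 * N%:R + e4 * N%:R + e4 * N%:R.
    by rewrite /e4; field.
  lra.
have c2 : N%:R - c%:R <= (1 - sg + e) * N%:R.
  have -> : N%:R - c%:R = (count (predC sle) (iota 1 N))%:R :> R.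
    have := count_predC sle (iota 1 N).
    rewrite size_iota -/c => eN; apply/eqP.
    by rewrite subr_eq addrC -natrD eN.
  have := leq_trans (iota1 (predC sle)) (iotaS _).
  have : (count (predC sle) (iota 0 N) <=
      count (fun n => ((x n != 0) && hits sg 1 (L n))%R) (iota 0 N))%N.
    by apply: sub_count => n /= /large.
  rewrite -!(ler_nat R) natrD; have := h2 _ n2.
  have -> : (1 - sg + e) * N%:R = (1 - sg + e4) * N%:R + e4 * N%:R + e4 * N%:R + e4 * N%:R.
    by rewrite /e4; field.
  lra.
rewrite ler_norml; apply/andP; split.
  by rewrite lerNl opprB lerBlDl ler_pdivrMr.
rewrite -/sg -(ler_pM2r N0) mulrBl divfK ?gt_eqF//; lra.
Qed.

End dominated_sequences.

(** * Powers of matrices *)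

Section powers_of_matrices.
Variable K : closedFieldType.

Lemma horner_mx_XsubC d (A : 'M[K]_d.+1) z :
  horner_mx A ('X - z%:P) = A - z%:M.
Proof. by rewrite rmorphB /= horner_mx_X horner_mx_C. Qed.

(** The binomial theorem for z + N with N = A - z, where N^D kills u. *)
Lemma power_on_geigenspace d (A : 'M[K]_d.+1) (z : K) (D n : nat) (u : 'rV_d.+1) :
  u *m (A - z%:M) ^+ D = 0 ->
  u *m A ^+ n = \sum_(j < D) ('C(n, j)%:R * z ^+ (n - j)) *: (u *m (A - z%:M) ^+ j).
Proof.
move=> uD; set N := A - z%:M.
have hA : A = z%:M + N by rewrite addrC subrK.
have NzC : GRing.comm (z%:M) N by rewrite /GRing.comm -!mulmxE mul_scalar_mx mul_mx_scalar.
pose F j := ('C(n, j)%:R * z ^+ (n - j)) *: (u *m N ^+ j).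
have F0 j : (D <= j)%N -> F j = 0.
  move=> /subnKC jD; rewrite /F -jD exprD -mulmxE mulmxA uD mul0mx scaler0.
  by [].
have F1 j : (n < j)%N -> F j = 0.
  by move=> nj; rewrite /F bin_small// mul0r scale0r.
have -> : u *m A ^+ n = \sum_(j < n.+1) F j.
  rewrite {1}hA exprDn_comm// mulmx_sumr; apply: eq_bigr => j _.
  rewrite /F -mulrnAl -rmorphXn /= -[_ *+ 'C(n, j)]mulr_natl.
  have -> : 'C(n, j)%:R * (z ^+ (n - j))%:M = ('C(n, j)%:R * z ^+ (n - j))%:M :> 'M[K]_d.+1.
    by rewrite rmorphM /= rmorph_nat.
  by rewrite -mulmxE mulmxA mul_mx_scalar scalemxAl.
(* Both sums extend to this range: terms with j > n vanish with their binomial coefficient, which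
   makes the truncated exponent n - j harmless, and terms with j >= D vanish on u. *)
transitivity (\sum_(j < D + n.+1) F j).
  by rewrite addnC big_split_ord /= [X in _ + X]big1 ?addr0// => j _; rewrite F1// leq_addr.
by rewrite big_split_ord /= [X in _ + X]big1 ?addr0// => j _; rewrite F0// leq_addr.
Qed.

(** Decomposition into generalized eigenspaces. The exponent d + 1 serves for all eigenvalues, so
    their multiplicities need not be tracked: the minimal polynomial divides the product of these
    powers. *)
Lemma powers_expansion d (A : 'M[K]_d.+1) : exists zs : seq K,
  [/\ uniq zs, forall z, z \in zs -> eigenvalue A z &
  forall (v : 'rV_d.+1) (w : 'cV_d.+1), exists c : K -> nat -> K, forall n,
    (v *m A ^+ n *m w) 0 0 =
      \sum_(z <- zs) \sum_(j < d.+1) ('C(n, j)%:R * z ^+ (n - j)) * c z j].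
Proof.
have [rs hrs] := closed_field_poly_normal (char_poly A).
have mon : char_poly A \is monic := char_poly_monic A.
rewrite (monicP mon) scale1r in hrs.
have srs : size rs = d.+1.
  have := size_char_poly A; rewrite hrs size_prod_XsubC => /eqP.
  by rewrite eqSS => /eqP.
pose zs := undup rs; exists zs; split; first exact: undup_uniq.
  move=> z; rewrite mem_undup eigenvalue_root_char hrs => zr.
  by rewrite root_prod_XsubC.
move=> v w.
pose p_ (i : 'I_(size zs)) := ('X - (nth 0 zs i)%:P) ^+ d.+1.
have dv : mxminpoly A %| \prod_i p_ i.
  apply: dvdp_trans (mxminpoly_dvd_char A) _.
  rewrite hrs /p_ prodrXl -srs.
  pose Q := \prod_(i < size zs) ('X - (nth 0 zs i)%:P); rewrite -/Q.
  have hQ z : z \in rs -> 'X - z%:P %| Q.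
    rewrite -mem_undup -/zs => /(nthP 0)[i iz <-].
    by rewrite /Q (bigD1 (Ordinal iz)) //= dvdp_mulIl.
  elim: (rs) hQ => [|z s IH] hQ; first by rewrite big_nil dvd1p.
  rewrite big_cons /= exprS dvdp_mul// ?hQ ?mem_head// IH// => y ys.
  by apply: hQ; rewrite inE ys orbT.
have cop : {in predT &, forall i j : 'I_(size zs), j != i -> coprimep (p_ i) (p_ j)}.
  move=> i j _ _ nij; rewrite /p_ coprimep_expr ?coprimep_expl// coprimep_XsubC root_XsubC.
  by rewrite nth_uniq ?undup_uniq// eq_sym.
have : (v <= \sum_i kermxpoly A (p_ i))%MS.
  rewrite -(kermxpoly_prod A cop) (kermxpoly_min dv); exact: submx1.
move=> /sub_sumsmxP[u_ hu].
pose vz i := u_ i *m kermxpoly A (p_ i).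
have hvz i : vz i *m (A - (nth 0 zs i)%:M) ^+ d.+1 = 0.
  rewrite -horner_mx_XsubC -rmorphXn /=; apply/sub_kermxP; exact: submxMl.
(* Passes from positions in [zs] to eigenvalues; as [zs] has no repetition, the sum has a single
   term for each z in it. *)
pose c z j := \sum_(i < size zs | nth 0 zs i == z) (vz i *m (A - z%:M) ^+ j *m w) 0 0.
exists c => n.
rewrite hu mulmx_suml mulmx_suml summxE (big_nth 0) big_mkord.
apply: eq_bigr => i _; rewrite -/(vz i) (power_on_geigenspace n (hvz i)).
rewrite mulmx_suml summxE; apply: eq_bigr => j _.
rewrite -scalemxAl mxE; congr (_ * _); rewrite /c (big_pred1 i)// => k /=.
by rewrite nth_uniq ?undup_uniq.
Qed.

End powers_of_matrices.

(** * Dominant terms *)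

Section vanishing.
Variable R : realType.

Definition vanishes (u : nat -> R[i]) := forall e : R, 0 < e ->
  exists N0, forall n, (N0 <= n)%N -> nm (u n) <= e.

Lemma vanishes_le (u : nat -> R[i]) (v : nat -> R) M :
  (forall n, (M <= n)%N -> nm (u n) <= v n) -> (v @ \oo --> (0 : R))%classic -> vanishes u.
Proof.
move=> uv /cvgrPdist_le v0 e e0; have [N0 _ h] := v0 e e0.
exists (maxn M N0) => n; rewrite geq_max => /andP[Mn Nn].
apply: le_trans (uv _ Mn) _; apply: le_trans (ler_norm _) _.
by rewrite -normrN -sub0r; exact: h.
Qed.

Lemma vanishes_ext (u v : nat -> R[i]) M : (forall n, (M <= n)%N -> u n = v n) ->
  vanishes v -> vanishes u.
Proof.
move=> uv hv e e0; have [N0 h] := hv e e0.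
exists (maxn M N0) => n; rewrite geq_max => /andP[Mn Nn].
by rewrite uv//; exact: h.
Qed.

Lemma vanishes_sum (I : eqType) (s : seq I) (P : pred I) (F : I -> nat -> R[i]) :
  (forall i, i \in s -> P i -> vanishes (F i)) ->
  vanishes (fun n => \sum_(i <- s | P i) F i n).
Proof.
elim: s => [|i s IH] h e e0; first by exists 0%N => n _; rewrite big_nil nm0 ltW.
have e2 : 0 < e / 2 by rewrite divr_gt0.
have [|N1 h1] := IH _ _ e2; first by move=> j js; apply: h; rewrite inE js orbT.
have [Pi|nPi] := boolP (P i); last first.
  exists N1 => n /h1 hn; rewrite big_cons (negbTE nPi); apply: le_trans hn _.
  by rewrite ler_pdivrMr// ler_pMr// ler1n.
have [N2 h2] := h i (mem_head _ _) Pi _ e2.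
exists (maxn N1 N2) => n; rewrite geq_max => /andP[n1 n2].
rewrite big_cons Pi; apply: le_trans (nmD _ _) _.
by rewrite [leRHS]splitr lerD ?h1 ?h2.
Qed.

Lemma harmonic_shift_cvg0 (c : R) (M : nat) :
  ((fun n : nat => c / (n - M)%:R) @ \oo --> (0 : R))%classic.
Proof.
apply/cvgrPdist_le => e e0.
exists (M + (Num.bound (`|c| / e)).+1)%N => // n /= nM.
rewrite sub0r normrN normrM normfV normr_nat.
have n0 : 0 < ((n - M)%:R : R).
  by rewrite ltr0n subn_gt0; apply: leq_trans nM; rewrite addnS ltnS leq_addr.
rewrite ler_pdivrMr//; apply: bound_leM => //.
by rewrite leq_subRL; [apply: leq_trans nM; rewrite leq_add2l|apply: leq_trans nM; exact: leq_addr].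
Qed.

Lemma bin_le_exp (a : R) (n j : nat) : 0 <= a -> 'C(n, j)%:R * a ^+ j <= (1 + a) ^+ n.
Proof.
move=> a0; have [nj|jn] := ltnP n j.
  by rewrite bin_small// mul0r exprn_ge0// addr_ge0.
have jn' : (j < n.+1)%N by [].
rewrite exprDn (bigD1 (Ordinal jn')) //= expr1n mul1r -[X in X + _]mulr_natl lerDl.
by apply: sumr_ge0 => i _; rewrite expr1n mul1r mulrn_wge0// exprn_ge0.
Qed.

(** One term of the expansion of (1 + a)^n bounds 'C(n, j) a^j, and a = (1 - q) / 2 still gives (1 +
    a) q < 1. *)
Lemma bin_expr_cvg0 (q : R) (j : nat) : 0 <= q < 1 ->
  ((fun n : nat => 'C(n, j)%:R * q ^+ n) @ \oo --> (0 : R))%classic.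
Proof.
move=> /andP[q0 q1].
pose a := (1 - q) / 2; have a0 : 0 < a by rewrite divr_gt0// subr_gt0.
have x0 : 0 <= (1 + a) * q by rewrite mulr_ge0// addr_ge0// ltW.
have x1 : (1 + a) * q < 1 by rewrite /a; nra.
have lim : ((fun n : nat => (a ^+ j)^-1 * ((1 + a) * q) ^+ n) @ \oo --> (0 : R))%classic.
  rewrite -(mulr0 (a ^+ j)^-1); apply: cvgM; first exact: cvg_cst.
  by apply: cvg_expr; rewrite ger0_norm.
apply: (squeeze_cvgr _ (cvg_cst 0) lim); near=> n; apply/andP; split.
  by rewrite mulr_ge0// exprn_ge0.
rewrite ler_pdivlMl ?exprn_gt0// [((1 + a) * q) ^+ n]exprMn mulrA.
apply: ler_wpM2r; first exact: exprn_ge0.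
by rewrite mulrC; apply: bin_le_exp; exact: ltW.
Unshelve. all: by end_near. Qed.

(** Neighbouring coefficients have the ratio (m + 1) / (n - m), at most k / (n - k) for m < k. As 2k
    <= n this is at most 1, so further steps only help. *)
Lemma bin_ratio_le (j k n : nat) : (j < k)%N -> (2 * k <= n)%N ->
  'C(n, j)%:R / 'C(n, k)%:R <= k%:R / (n - k)%:R :> R.
Proof.
move=> jk kn.
have bk0 m : (m <= k)%N -> 0 < ('C(n, m)%:R : R).
  by move=> mk; rewrite ltr0n bin_gt0; apply: leq_trans mk _; apply: leq_trans kn; rewrite leq_pmull.
have nk : 0 < ((n - k)%:R : R).
  rewrite ltr0n subn_gt0; apply: leq_trans kn; rewrite mul2n -addnn -addn1 leq_add2l.
  exact: leq_ltn_trans jk.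
have step m : (m < k)%N -> 'C(n, m)%:R <= 'C(n, m.+1)%:R * (k%:R / (n - k)%:R) :> R.
  move=> mk; rewrite mulrA ler_pdivlMr// -!natrM ler_nat.
  have e := mul_bin_left n m.
  apply: (@leq_trans ((n - m) * 'C(n, m))); first by rewrite mulnC leq_mul2r leq_sub2l ?orbT// ltnW.
  by rewrite -e mulnC leq_mul2l mk orbT.
have q1 : k%:R / (n - k)%:R <= 1 :> R.
  by rewrite ler_pdivrMr// mul1r ler_nat leq_subRL ?addnn -?mul2n// (leq_trans _ kn)// leq_pmull.
have mono t : forall m, (m + t.+1 = k)%N ->
    'C(n, m)%:R <= 'C(n, k)%:R * (k%:R / (n - k)%:R) :> R.
  elim: t => [|t IH] m mk.
    by rewrite -{1}mk addn1; apply: step; rewrite -mk addn1.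
  have mk' : (m < k)%N by rewrite -mk -addSnnS leq_addr.
  apply: le_trans (step _ mk') _; apply: le_trans (IH m.+1 _); last by rewrite addSnnS.
  by rewrite ler_piMr.
rewrite ler_pdivrMr ?bk0// mulrC; apply: (mono (k - j.+1)%N).
by rewrite -addSnnS subnKC.
Qed.

(** For p = 1 the difference equals k / (n + 1 - k); larger shifts are products of such ratios. *)
Lemma bin_shift_ratio (k p : nat) (e : R) : 0 < e -> exists N0, forall n,
  (N0 <= n)%N -> `|'C(n + p, k)%:R / 'C(n, k)%:R - 1| <= e.
Proof.
have bk0 m : (k <= m)%N -> 0 < ('C(m, k)%:R : R) by move=> mk; rewrite ltr0n bin_gt0.
have one (e' : R) : 0 < e' -> exists N0, forall n, (N0 <= n)%N ->
    `|'C(n.+1, k)%:R / 'C(n, k)%:R - 1| <= e'.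
  move=> e'0; have /cvgrPdist_le /(_ _ e'0) [N0 _ h] := harmonic_shift_cvg0 k%:R k.
  exists (maxn k N0) => n; rewrite geq_max => /andP[kn Nn].
  have nk : 0 < ((n.+1 - k)%:R : R) by rewrite ltr0n subn_gt0 ltnS.
  have -> : 'C(n.+1, k)%:R / 'C(n, k)%:R - 1 = k%:R / (n.+1 - k)%:R :> R.
    have := congr1 (fun m : nat => (m%:R : R)) (mul_bin_down n.+1 k).
    rewrite /= !natrM => eC.
    have eC' : 'C(n.+1, k)%:R = n.+1%:R * 'C(n, k)%:R / (n.+1 - k)%:R :> R.
      by rewrite eC mulrAC divff ?mul1r// gt_eqF.
    have sk : n.+1%:R = k%:R + (n.+1 - k)%:R :> R by rewrite -natrD subnKC// ltnW.
    rewrite eC' sk; field; rewrite gt_eqF//= gt_eqF// bk0//.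
  have := h n.+1 (leqW Nn); rewrite sub0r normrN; exact.
elim: p e => [|p IH] e e0.
  exists k => n kn; rewrite addn0 divff ?gt_eqF ?bk0// subrr normr0; exact: ltW.
pose e' := Num.min (e / 3) 1.
have e'0 : 0 < e' by rewrite lt_min divr_gt0// ltr01.
have e'1 : e' <= e / 3 by rewrite ge_min lexx.
have e'2 : e' <= 1 by rewrite ge_min lexx orbT.
have [N1 h1] := IH _ e'0; have [N2 h2] := one _ e'0.
exists (maxn k (maxn N1 N2)) => n; rewrite !geq_max => /and3P[kn n1 n2].
have := h1 _ n1; have := h2 (n + p)%N (leq_trans n2 (leq_addr _ _)).
rewrite -addnS; set a := 'C(n + p.+1, k)%:R / _; set c := 'C(n + p, k)%:R / _ => ha hc.
have -> : 'C(n + p.+1, k)%:R / 'C(n, k)%:R = a * c.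
  rewrite /a /c; field; rewrite gt_eqF ?bk0//= gt_eqF// bk0//.
  exact: leq_trans kn (leq_addr _ _).
have -> : a * c - 1 = (a - 1) * (c - 1) + (a - 1) + (c - 1) by ring.
apply: le_trans (ler_normD _ _) _; apply: le_trans (lerD (ler_normD _ _) (lexx _)) _.
rewrite normrM.
have : `|a - 1| * `|c - 1| <= e' * 1.
  by apply: ler_pM => //; apply: le_trans hc _.
lra.
Qed.

End vanishing.

Section asymptotics.
Variable R : realType.

Lemma seq_argmax (T : eqType) (s : seq T) (f : T -> R) : s != [::] ->
  exists2 x, x \in s & forall y, y \in s -> f y <= f x.
Proof.
elim: s => // x s IH _; have [s0|/IH [m ms hm]] := eqVneq s [::].
  by exists x; rewrite ?mem_head// => y; rewrite s0 inE => /eqP ->.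
have [h|h] := leP (f x) (f m).
  exists m; first by rewrite inE ms orbT.
  by move=> y; rewrite inE => /orP[/eqP ->//|/hm].
exists x; first exact: mem_head.
by move=> y; rewrite inE => /orP[/eqP ->//|/hm hy]; rewrite (le_trans hy)// ltW.
Qed.

(** Among the terms with z and coefficient nonzero, r is the largest modulus and k the largest j
    occurring with modulus r; the terms with |z| = r and j = k survive the division by 'C(n, k) r^n.
    If there are no such terms, only z = 0 contributes, and its powers are gone from n = D on. *)
Lemma expansion_asymptotics (zs : seq R[i]) (c : R[i] -> nat -> R[i]) (D : nat)
    (s : nat -> R[i]) : uniq zs ->
  (forall n, s n = \sum_(z <- zs) \sum_(j < D) ('C(n, j)%:R * z ^+ (n - j)) * c z j) ->
  (forall n, (D <= n)%N -> s n = 0) \/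
  exists r k l, [/\ 0 < r, l != [::],
    (forall p, p \in l -> [/\ p.1 != 0, r%:C * p.2 \in zs & nm p.2 = 1]),
    uniq [seq p.2 | p <- l] &
    vanishes (fun n => s n / ('C(n, k)%:R * r%:C ^+ n) - expsum l n)].
Proof.
move=> uzs hs.
pose T := [seq zj <- [seq (z, j) | z <- zs, j <- iota 0 D] | (zj.1 != 0) && (c zj.1 zj.2 != 0)].
have inT z j : z \in zs -> (j < D)%N -> z != 0 -> c z j != 0 -> (z, j) \in T.
  move=> zz jD z0 c0; rewrite mem_filter /= z0 c0; apply/allpairsP; exists (z, j).
  by rewrite /= mem_iota.
have [T0|Tn] := eqVneq T [::].
  left=> n Dn; rewrite hs big_seq big1// => z zz; rewrite big1// => j _.
  have [->|z0] := eqVneq z 0.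
    by rewrite expr0n subn_eq0 leqNgt (leq_trans (ltn_ord j) Dn) mulr0 mul0r.
  have [->|c0] := eqVneq (c z j) 0; first by rewrite mulr0.
  by have := inT z j zz (ltn_ord j) z0 c0; rewrite T0.
right; have [[z1 j1] zT hmax] := seq_argmax (fun zj => nm zj.1) Tn.
pose r := nm z1; rewrite /= -/r in hmax.
pose T2 := [seq zj <- T | nm zj.1 == r].
have [|[z2 k] zkT kmax] := @seq_argmax _ T2 (fun zj => zj.2%:R).
  by apply/eqP => T20; have : (z1, j1) \in T2 by [rewrite mem_filter eqxx zT]; rewrite T20.
rewrite /= in kmax; move: zkT; rewrite !mem_filter /= => /andP[/eqP z2r /andP[/andP[z20 ck0]]].
move=> /allpairsP[[z' k'] [/= z2z k2 [ez ek]]]; rewrite -ez -ek {z' k' ez ek} mem_iota /= add0n in z2z k2.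
have r0 : 0 < r by rewrite -z2r nm_gt0.
have rC0 : r%:C != 0 :> R[i] by rewrite -nm_eq0 nmR normr_eq0 gt_eqF.
pose P z := [&& z != 0, nm z == r & c z k != 0].
(* As z^(n - k) / r^n = z^-k (z / r)^n, the factor z^-k goes into the coefficient. *)
pose l := [seq (c z k * z ^- k, z / r%:C) | z <- zs & P z].
have lE n : expsum l n = \sum_(z <- zs | P z) (c z k * z ^- k) * (z / r%:C) ^+ n.
  by rewrite /expsum big_map big_filter.
exists r, k, l; split => //.
- apply/eqP => l0.
  have zf : z2 \in [seq z <- zs | P z] by rewrite mem_filter /P z20 z2r eqxx ck0 z2z.
  by have := map_f (fun z => (c z k * z ^- k, z / r%:C)) zf; rewrite -/l l0.
- move=> p /mapP[z]; rewrite mem_filter => /andP[/and3P[z0 /eqP zr cz] zz] -> /=.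
  split; first by rewrite mulf_neq0// invr_eq0 expf_eq0 (negbTE z0) andbF.
    by rewrite mulrC divfK.
  by rewrite nmM nmV nmR zr gtr0_norm// divff// gt_eqF.
- rewrite -map_comp map_inj_uniq ?filter_uniq// => x y /= /mulIf; apply.
  by rewrite invr_eq0.
pose term z j n := ('C(n, j)%:R * z ^+ (n - j)) * c z j / ('C(n, k)%:R * r%:C ^+ n).
pose G z j n := term z j n - (if P z && (j == k) then term z k n else 0).
apply: (@vanishes_ext _ _ (fun n => \sum_(z <- zs) \sum_(j < D) G z j n) D).
  move=> n Dn; rewrite hs lE mulr_suml.
  have -> : \sum_(z <- zs | P z) (c z k * z ^- k) * (z / r%:C) ^+ n =
      \sum_(z <- zs) \sum_(j < D) (if P z && (j == k :> nat) then term z k n else 0).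
    rewrite big_mkcond; apply: eq_bigr => z _.
    case: (boolP (P z)) => [Pz|_] /=; last by rewrite big1.
    rewrite -big_mkcond /= (big_pred1 (Ordinal k2)) => [|j]; last by [].
    have kn : (k <= n)%N by apply: leq_trans Dn; apply: ltnW.
    have z0 : z != 0 by case/and3P: Pz.
    rewrite /term exprMn exprVn.
    rewrite -{1}(subnK kn) exprD.
    have b0 : 'C(n, k)%:R != 0 :> R[i] by rewrite pnatr_eq0 -lt0n bin_gt0.
    field; rewrite b0 !expf_neq0//.
  rewrite -sumrB; apply: eq_bigr => z _; rewrite mulr_suml -sumrB.
  by apply: eq_bigr.
apply: vanishes_sum => z zz _; apply: vanishes_sum => j _ _.
have zero u : (forall n, (D <= n)%N -> u n = 0 :> R[i]) -> vanishes u.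
  by move=> h e e0; exists D => n /h ->; rewrite nm0 ltW.
case: (boolP (P z && (j == k :> nat))) => [/[dup] Pj /andP[_ /eqP jk]|nP].
  by apply: zero => n _; rewrite /G Pj jk subrr.
apply: (@vanishes_ext _ _ (term z j) 0); first by move=> n _; rewrite /G (negbTE nP) subr0.
have [z0|z0] := eqVneq z 0.
  apply: zero => n Dn; rewrite /term z0 expr0n subn_eq0 leqNgt (leq_trans (ltn_ord j) Dn).
  by rewrite mulr0 !mul0r.
have [cj0|cj0] := eqVneq (c z j) 0.
  by apply: zero => n Dn; rewrite /term cj0 mulr0 mul0r.
have zjT := inT z j zz (ltn_ord j) z0 cj0.
have zr := hmax _ zjT; rewrite /= in zr.
have nz0 : 0 < nm z by rewrite nm_gt0.
have nmterm n : (D <= n)%N -> nm (term z j n) =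
    nm (c z j) * nm z ^- j * ('C(n, j)%:R / 'C(n, k)%:R * (nm z / r) ^+ n).
  move=> Dn; have jn : (j <= n)%N by apply: leq_trans Dn; apply: ltnW.
  have kn : (k <= n)%N by apply: leq_trans Dn; apply: ltnW.
  rewrite /term !nmM nmV !nmM !nmX !nm_nat nmR (gtr0_norm r0) exprMn exprVn.
  have -> : nm z ^+ n = nm z ^+ (n - j) * nm z ^+ j by rewrite -exprD subnK.
  field.
  by rewrite !expf_neq0 ?gt_eqF// ltr0n bin_gt0.
have K0 : 0 <= nm (c z j) * nm z ^- j by rewrite mulr_ge0 ?nm_ge0// invr_ge0 exprn_ge0// nm_ge0.
(* A term of smaller modulus decays geometrically; one of modulus r has j < k and decays like 1 /
   n. *)
have [zlt|zge] := ltP (nm z) r.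
  apply: (@vanishes_le _ _ (fun n => nm (c z j) * nm z ^- j * ('C(n, j)%:R * (nm z / r) ^+ n)) D).
    move=> n Dn; rewrite nmterm// ler_wpM2l// ler_wpM2r ?exprn_ge0 ?divr_ge0 ?nm_ge0 ?(ltW r0)//.
    rewrite ler_piMr// invf_le1 ?ltr0n ?bin_gt0 ?ler1n ?bin_gt0//.
      by apply: leq_trans Dn; apply: ltnW.
    by apply: leq_trans Dn; apply: ltnW.
  rewrite -(mulr0 (nm (c z j) * nm z ^- j)); apply: cvgM; first exact: cvg_cst.
  by apply: bin_expr_cvg0; rewrite divr_ge0 ?nm_ge0 ?(ltW r0)//= ltr_pdivrMr// mul1r.
have {zr zge}zr : nm z = r by apply/eqP; rewrite eq_le zr.
have jk : (j < k)%N.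
  have : (j <= k)%N.
    have : (z, j : nat) \in T2 by rewrite mem_filter zr eqxx zjT.
    by move=> /kmax /=; rewrite ler_nat.
  rewrite leq_eqVlt => /orP[/eqP jk|//].
  by move: nP; rewrite /P z0 zr eqxx -jk cj0 eqxx.
apply: (@vanishes_le _ _ (fun n => nm (c z j) * nm z ^- j * (k%:R / (n - k)%:R)) (maxn D (2 * k))).
  move=> n; rewrite geq_max => /andP[Dn kn]; rewrite nmterm// ler_wpM2l//.
  by rewrite zr divff ?gt_eqF// expr1n mulr1 bin_ratio_le.
rewrite -(mulr0 (nm (c z j) * nm z ^- j)); apply: cvgM; first exact: cvg_cst.
exact: harmonic_shift_cvg0.
Qed.

End asymptotics.

(** * Nonresonance implies the Benford property *)

Section nonresonant_to_benford.
Variable R : realType.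
Implicit Types (z w : R[i]) (r : R).

Lemma eigenvalue_conj d (A : 'M[R]_d) z : spectrum A z -> spectrum A (cj z).
Proof.
rewrite /spectrum /= !eigenvalue_root_char -map_char_poly /root.
rewrite -!/(root _ _) -[cj z]/(conjc z) -complex_root_conj.
have -> // : map_poly conjc (map_poly (real_complex R) (char_poly A)) =
  map_poly (real_complex R) (char_poly A).
by apply/polyP => i; rewrite !coef_map /= oppr0.
Qed.

Section circle_of_eigenvalues.
Variables (b : nat) (r : R) (Z : set R[i]).
Hypotheses (r0 : 0 < r) (Zr : forall z, Z z -> nm z = r)
  (Zc : forall z, Z z -> Z (cj z)).

(** The real trace of the span, which [spanQ] forms inside the complex numbers. *)
Definition spanH : set R := [set t | spanQ [set x%:C | x in Delta Z] t%:C]%classic.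

Lemma spanQ_sub (S : set R[i]) : Qsubspace (spanQ S).
Proof.
split=> [V [[h _ _] _]|u v hu hv V hV|q v hv V hV] //.
- by case: (hV) => -[_ h _] _; apply: h; [exact: hu|exact: hv].
- by case: (hV) => -[_ _ h] _; apply: h; exact: hv.
Qed.

Lemma sub_spanQ (S : set R[i]) v : S v -> spanQ S v.
Proof. by move=> Sv V [_]; apply. Qed.

Lemma spanHD s t : spanH s -> spanH t -> spanH (s + t).
Proof. by rewrite /spanH /= rmorphD; have [_ h _] := spanQ_sub [set x%:C | x in Delta Z]%classic; exact: h. Qed.

Lemma spanHZ (q : rat) t : spanH t -> spanH (ratr q * t).
Proof.
rewrite /spanH /= rmorphM /= fmorph_rat; have [_ _ h] := spanQ_sub [set x%:C | x in Delta Z]%classic; exact: h.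
Qed.

Lemma spanHN t : spanH t -> spanH (- t).
Proof. by move=> /(spanHZ (-1)); rewrite rmorphN rmorph1 mulN1r. Qed.

Lemma spanH0 : spanH 0.
Proof. by rewrite /spanH /=; have [h _ _] := spanQ_sub [set x%:C | x in Delta Z]%classic; exact: h. Qed.

Lemma spanH_Delta t : Delta Z t -> spanH t.
Proof. by move=> h; apply: sub_spanQ; exists t. Qed.

Definition unitH (z : R[i]) := exists2 t, spanH t & z = ee t.

Lemma unitH1 : unitH 1. Proof. by exists 0; rewrite ?ee0//; exact: spanH0. Qed.

Lemma unitHM z w : unitH z -> unitH w -> unitH (z * w).
Proof.
by move=> [s hs ->] [t ht ->]; exists (s + t); rewrite ?eeD//; exact: spanHD.
Qed.

Lemma unitHV z : unitH z -> unitH z^-1.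
Proof. by move=> [s hs ->]; exists (- s); rewrite ?eeN//; exact: spanHN. Qed.

Lemma unitH_nm z : unitH z -> nm z = 1.
Proof. by move=> [s _ ->]; exact: nm_ee. Qed.

Variables (z0 : R[i]) (Zz0 : Z z0).

Lemma Delta1 : Delta Z 1.
Proof. by exists z0, z0; rewrite subrr mul0r addr0. Qed.

Lemma spanH_int (k : int) : spanH k%:~R.
Proof.
have := spanHZ (k%:~R) (spanH_Delta Delta1).
by rewrite mulr1 ratr_int.
Qed.

Lemma Z_neq0 z : Z z -> z != 0.
Proof. by move=> /Zr zr; rewrite -nm_eq0 zr gt_eqF. Qed.

Lemma Z_polar z : Z z -> z / r%:C = ee (arg z / (2 * pi)).
Proof.
move=> Zz; rewrite {1}(polar_ee (Z_neq0 Zz)) Zr// mulrAC divff ?mul1r//.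
by rewrite -nm_eq0 nmR normr_eq0 gt_eqF.
Qed.

(* The arguments of z and of its conjugate are opposite, so their difference
   puts twice the argument of z in the span. *)
Lemma Z_unitH z : Z z -> unitH (z / r%:C).
Proof.
move=> Zz; rewrite Z_polar//; exists (arg z / (2 * pi)) => //.
set a := arg z / (2 * pi); set c := arg (cj z) / (2 * pi).
have : ee (c + a) = 1.
  rewrite eeD -[ee c]Z_polar; last exact: Zc.
  rewrite -[ee a]Z_polar// mulrACA mulrC [cj z * z]mulrC mul_conj Zr//.
  rewrite -invfM -rmorphM /= -expr2 mulVf//.
  by rewrite -nm_eq0 nmR normr_eq0 expf_neq0// gt_eqF.
move=> /ee_eq1[k hk].
have hD : spanH (1 + (a - c)).
  apply: spanH_Delta; exists z, (cj z); split=> //; first exact: Zc.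
  by rewrite mulrBl.
have := spanHZ (2^-1) (spanHD (spanHD hD (spanHN (spanH_Delta Delta1))) (spanH_int k)).
have -> // : ratr 2^-1 * (1 + (a - c) - 1 + k%:~R) = a.
by rewrite -hk fmorphV rmorph_nat; field.
Qed.

(** Membership in H puts (i - j) rho in the span up to an integer; integers belong to the span
    because 1 is in [Delta Z], and one may divide by i - j. *)
Lemma spanH_twist (rho : R) : ~ spanH rho ->
  forall i j : nat, unitH (ee rho ^+ i / ee rho ^+ j) -> i = j.
Proof.
move=> hr i j [t ht]; rewrite -!eeMn -eeB => e.
have /ee_eq1[k hk] : ee (i%:R * rho - j%:R * rho - t) = 1.
  by rewrite eeB e divff// ee_neq0.
have h : spanH ((i%:R - j%:R) * rho).
  have -> : (i%:R - j%:R) * rho = t + k%:~R by rewrite -hk; ring.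
  by apply: spanHD => //; exact: spanH_int.
apply/eqP; apply/negPn/negP => nij; apply: hr.
have d0 : (i%:R - j%:R : R) != 0 by rewrite subr_eq0 eqr_nat.
have := spanHZ ((i%:R - j%:R)^-1) h.
rewrite fmorphV rmorphB !rmorph_nat mulrA mulVf ?mul1r//.
Qed.

(** Equal h-th powers make the difference of the arguments a rational multiple of 2 pi, hence give a
    rational element of [Delta Z]; this must be 1. *)
Lemma Z_nondegenerate z w (h : nat) : (Delta Z `&` range (ratr : rat -> R) = [set 1])%classic ->
  Z z -> Z w -> (0 < h)%N -> (z / r%:C) ^+ h = (w / r%:C) ^+ h -> z = w.
Proof.
move=> hD Zz Zw h0; rewrite !Z_polar// => e.
have /ee_eq1[k hk] : ee (h%:R * (arg z / (2 * pi) - arg w / (2 * pi))) = 1.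
  by rewrite eeMn eeB expr_div_n e divff// expf_neq0// ee_neq0.
have hR : h%:R != 0 :> R by rewrite pnatr_eq0 -lt0n.
have dk : arg z / (2 * pi) - arg w / (2 * pi) = k%:~R / h%:R.
  by rewrite -hk mulrAC divff// mul1r.
have : (Delta Z `&` range (ratr : rat -> R))%classic (1 + (arg z - arg w) / (2 * pi)).
  split; first by exists z, w.
  exists (1 + k%:~R / h%:R) => //.
  by rewrite mulrBl dk rmorphD rmorph1 fmorph_div /= ratr_int rmorph_nat.
rewrite hD /= => /eqP; rewrite -subr_eq0 addrAC subrr add0r mulrBl subr_eq0 => /eqP ea.
by rewrite (polar_ee (Z_neq0 Zz)) (polar_ee (Z_neq0 Zw)) !Zr// ea.
Qed.

End circle_of_eigenvalues.

Lemma nondegenerate_uniq (l : seq (R[i] * R[i])) : uniq [seq p.2 | p <- l] ->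
  (forall p q (h : nat), p \in l -> q \in l -> (0 < h)%N -> p.2 ^+ h = q.2 ^+ h -> p.2 = q.2) ->
  nondegenerate l.
Proof.
elim: l => //= p l IH /andP[pl ul] hl; split; last first.
  by apply: IH => // q q' h ql ql'; apply: hl; rewrite inE ?ql ?ql' orbT.
move=> q h ql h0; apply/eqP => e; move/negP: pl; apply.
by rewrite (hl p q h) ?map_f// inE ?eqxx ?ql ?orbT.
Qed.

Theorem nonresonant_benford d (A : 'M[R]_d.+1) (b : nat) : (1 < b)%N ->
  nonresonant b (spectrum A) -> forall x y : 'cV[R]_d.+1,
  benford b (fun n => (x^T *m (A ^+ n) *m y) 0 0) \/
  terminating d.+1 (fun n => (x^T *m (A ^+ n) *m y) 0 0).
Proof.
move=> b1 hnr x y.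
have [zs [uzs ezs hzs]] := powers_expansion (map_mx (real_complex R) A).
have [c hc] := hzs (map_mx (real_complex R) x^T) (map_mx (real_complex R) y).
pose s n := (map_mx (real_complex R) x^T *m (map_mx (real_complex R) A) ^+ n *m map_mx (real_complex R) y) 0 0.
have sE n : s n = ((x^T *m (A ^+ n) *m y) 0 0)%:C.
  by rewrite /s -rmorphXn /= -!map_mxM mxE.
have [h|[r [k [l [r0 l0 hl ul van]]]]] := expansion_asymptotics uzs hc.
  right=> n dn; have := h n dn; rewrite -/(s n) sE => /eqP.
  by rewrite -nm_eq0 nmR normr_eq0 => /eqP.
left; pose Z : set R[i] := (spectrum A `&` circle r)%classic.
have ZE z : Z z <-> spectrum A z /\ nm z = r.
  rewrite /Z /circle /= normcE_nm; split=> -[h1 h2]; split=> //; last by rewrite h2.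
  by case: h2.
have lZ p : p \in l -> Z (r%:C * p.2).
  move=> /hl [_ pz p1]; apply/ZE; split; first exact: ezs.
  by rewrite nmM p1 nmR gtr0_norm// mulr1.
have Zr z : Z z -> nm z = r by move=> /ZE[].
have Zc z : Z z -> Z (cj z).
  by move=> /ZE[h1 h2]; apply/ZE; split; [exact: eigenvalue_conj|rewrite nm_conj].
have [p0 p0l] : exists p, p \in l.
  by case: (l) l0 => // p ? _; exists p; rewrite mem_head.
have Z0 := lZ _ p0l.
have rC0 : r%:C != 0 :> R[i] by rewrite -nm_eq0 nmR normr_eq0 gt_eqF.
have [Zs|[hD hS]] := hnr r r0.
  by have : (spectrum A `&` circle r)%classic (r%:C * p0.2) by []; rewrite Zs.
rewrite -/Z in hD hS.
have divK z : (r%:C * z) / r%:C = z by rewrite mulrC mulrA mulVf// mul1r.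
have bk0 n : (k <= n)%N -> 0 < 'C(n, k)%:R :> R by move=> kn; rewrite ltr0n bin_gt0.
(* The growth factor is 'C(n, k), positive from n = k on; the remainder is whatever the leading
   exponential sum leaves over. *)
apply: (@benford_of_expsum _ b b1 r l (unitH Z) r0 l0 _ _ _ _ _ _ _
  (fun n => 'C(n, k)%:R) (fun n => s n / ('C(n, k)%:R * r%:C ^+ n) - expsum l n) _ k).
- move=> p pl; have [p10 _ _] := hl _ pl; split=> //.
  by rewrite -[p.2]divK; apply: Z_unitH Z0 _ (lZ _ pl).
- apply: nondegenerate_uniq => // p q h pl ql h0 e.
  rewrite -[p.2]divK -[q.2]divK; congr (_ / _).
  by apply: (Z_nondegenerate r0 Zr hD (lZ _ pl) (lZ _ ql) h0); rewrite !divK.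
- exact: unitH1.
- exact: unitHM.
- exact: unitHV.
- exact: unitH_nm.
- by apply: spanH_twist Z0 _ _ => //.
- exact: bk0.
- by move=> p e e0; exact: bin_shift_ratio.
- exact: van.
- move=> n kn; rewrite addrC subrK -nmR -sE nmM nmV nmM nmX nm_nat nmR (gtr0_norm r0).
  by field; rewrite expf_neq0 ?gt_eqF// bk0.
Qed.

End nonresonant_to_benford.

(** * Realising exponential sums *)

Section realization.
Variable R : realType.

Lemma poly_nonroot_nat (p : {poly R[i]}) : p != 0 -> exists t : nat, ~~ root p t%:R.
Proof.
move=> p0; apply: contrapT => /forallNP h.
have := max_poly_roots p0 (rs := [seq t%:R | t <- iota 0 (size p)]).
rewrite size_map size_iota ltnn => H; have : false; last by [].
apply: H; last by rewrite map_inj_uniq ?iota_uniq//; move=> i j /eqP; rewrite eqr_nat => /eqP.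
by apply/allP => z /mapP[t _ ->]; have /negP := h t; rewrite negbK.
Qed.

Lemma eigen_power d (A : 'M[R[i]]_d.+1) (v : 'rV_d.+1) z n :
  v *m A = z *: v -> v *m A ^+ n = z ^+ n *: v.
Proof.
move=> e; elim: n => [|n IH]; first by rewrite !expr0 mulmx1 scale1r.
by rewrite !exprSr -mulmxE mulmxA IH -scalemxAl e scalerA.
Qed.

(** On the curve of real vectors (1, t, ..., t^d) the pairing with a nonzero left eigenvector is a
    nonzero polynomial in t, so some natural t avoids the roots for all eigenvalues at once. *)
Lemma generic_vector d (A : 'M[R]_d.+1) (zs : seq R[i]) :
  (forall z, z \in zs -> spectrum A z) ->
  exists y : 'cV[R]_d.+1, forall z, z \in zs -> exists v : 'rV[R[i]]_d.+1,
    v *m map_mx (real_complex R) A = z *: v /\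
    (v *m map_mx (real_complex R) y) 0 0 != 0.
Proof.
move=> hz.
have /choice[V hV] : forall z, exists v : 'rV[R[i]]_d.+1, z \in zs ->
    v *m map_mx (real_complex R) A = z *: v /\ v != 0.
  move=> z; have [zz|_] := boolP (z \in zs); last by exists 0.
  by have /eigenvalueP[v hv v0] := hz z zz; exists v.
pose P z := \poly_(i < d.+1) (V z 0 (inord i)).
have P0 z : z \in zs -> P z != 0.
  move=> /hV[_]; apply: contra => /eqP p0; apply/eqP/rowP => i; rewrite mxE.
  have := congr1 (fun p : {poly R[i]} => p`_i) p0.
  by rewrite coef_poly ltn_ord inord_val coef0.
have [t ht] : exists t : nat, ~~ root (\prod_(z <- zs) P z) t%:R.
  apply: poly_nonroot_nat; rewrite prodf_seq_neq0; apply/allP => z /P0 //.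
exists (\col_i (t%:R ^+ i)) => z zz; exists (V z); split; first by have [] := hV z zz.
have -> : (V z *m map_mx (real_complex R) (\col_i t%:R ^+ i)) 0 0 = (P z).[t%:R].
  rewrite mxE horner_poly; apply: eq_bigr => i _.
  by rewrite !mxE inord_val rmorphXn /= rmorph_nat.
apply: contra ht => /eqP h0; rewrite /root horner_prod (big_rem z) //= h0 mul0r //.
Qed.

(** One y serves every list, so the vectors x found for the single terms may be added. A real x
    suffices: replacing a complex left vector by its real part takes the real part of the
    sequence. *)
Lemma realize d (A : 'M[R]_d.+1) (zs : seq R[i]) :
  (forall z, z \in zs -> spectrum A z) ->
  exists y : 'cV[R]_d.+1, forall l : seq (R[i] * R[i]),
    (forall p, p \in l -> p.2 \in zs) ->
  exists x : 'cV[R]_d.+1, forall n,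
    (x^T *m A ^+ n *m y) 0 0 = Re (expsum l n).
Proof.
move=> hz; have [y hy] := generic_vector hz; exists y.
elim=> [|[c z] l IH] hl.
  by exists 0 => n; rewrite trmx0 !mul0mx mxE /expsum big_nil.
have [|x1 h1] := IH; first by move=> p pl; apply: hl; rewrite inE pl orbT.
have [v [ev v0]] := hy z (hl _ (mem_head _ _)).
pose u := (c / (v *m map_mx (real_complex R) y) 0 0) *: v.
pose x2 := \col_i Re (u 0 i).
have h2 n : (x2^T *m A ^+ n *m y) 0 0 = Re (c * z ^+ n).
  have -> : c * z ^+ n = (u *m map_mx (real_complex R) A ^+ n *m map_mx (real_complex R) y) 0 0.
    have sc (a : R[i]) (M : 'M[R[i]]_1) : (a *: M) 0 0 = a * M 0 0 by rewrite mxE.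
    by rewrite /u -scalemxAl (eigen_power n ev) scalerA -scalemxAl sc mulrAC divfK.
  rewrite -rmorphXn /= -[u *m _ *m _]mulmxA -map_mxM -[in LHS]mulmxA mxE [in RHS]mxE Re_sum; apply: eq_bigr => i _.
  by rewrite !mxE mulrC [in RHS]mulrC ReZ.
exists (x1 + x2) => n; rewrite expsum_cons ReD -h1 -h2.
by rewrite linearD /= !mulmxDl mxE addrC.
Qed.

End realization.

(** * Characters of Benford sequences *)

Section weyl.
Variables (R : realType) (b : nat).
Hypothesis b1 : (1 < b)%N.

Lemma cmean_eql (u : nat -> R[i]) l m : l = m -> cmean u l -> cmean u m.
Proof. by move=> ->. Qed.

Lemma cmean_near (u : nat -> R[i]) :
  (forall eps : R, 0 < eps -> exists w, cmean w 0 /\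
     exists N0, forall N, (N0 <= N)%N -> \sum_(n < N) nm (u n - w n) <= eps * N%:R) ->
  cmean u 0.
Proof.
move=> h e e0; have e2 : 0 < e / 2 by rewrite divr_gt0.
have [w [cw [N0 h0]]] := h _ e2; have [N1 h1] := cw _ e2.
exists (maxn N0 N1) => N; rewrite geq_max => /andP[n0 n1].
have {}h1 := h1 _ n1; have {}h0 := h0 _ n0; rewrite mul0r subr0 in h1.
rewrite mul0r subr0.
have -> : \sum_(n < N) u n = \sum_(n < N) w n + \sum_(n < N) (u n - w n).
  by rewrite -big_split; apply: eq_bigr => n _ /=; rewrite addrC subrK.
apply: le_trans (nmD _ _) _; have h2 := nm_sum (index_enum 'I_N) xpredT (fun n => u n - w n).
rewrite [e]splitr mulrDl; apply: lerD => //; exact: le_trans h2 h0.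
Qed.

(** Shifted to [n.+1] because Benford counts start at the index 1 and [cmean] sums from 0. *)
Lemma benford_ind_mean (x : nat -> R) (s : R) : benford b x -> 1 <= s < b%:R ->
  cmean (fun n => (s < significand b (x n.+1))%R%:R) (1 - logb b s)%:C.
Proof.
move=> hx hs e e0; have /cvgrPdist_le /(_ e e0) [N0 _ h] := hx s hs.
exists N0.+1 => N NN; have N0' : 0 < (N%:R : R) by rewrite ltr0n; apply: leq_ltn_trans NN.
have := h N (ltnW NN); set c := count _ _ => hc.
have -> : \sum_(n < N) ((s < significand b (x n.+1))%R%:R : R[i]) = (N%:R - c%:R)%:C.
  have <- : \sum_(n < N) ((s < significand b (x n.+1))%R%:R : R) = N%:R - c%:R.
    rewrite /c; elim: (N) => [|M IH]; first by rewrite big_ord0 subr0.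
    have -> : iota 1 M.+1 = iota 1 M ++ [:: M.+1] by rewrite -[M.+1]addn1 iotaD /= add1n addn1.
    rewrite big_ord_recr IH count_cat /= addn0 natrD -natr1 ltNge.
    by case: (_ <= s) => /=; ring.
  by rewrite rmorph_sum; apply: eq_bigr => n _; rewrite rmorph_nat.
rewrite -(rmorph_nat (real_complex R) N) -rmorphM -rmorphB nmR.
have -> : N%:R - c%:R - (1 - logb b s) * N%:R = (logb b s - c%:R / N%:R) * N%:R.
  by field; rewrite gt_eqF.
by rewrite normrM normr_nat ler_wpM2r.
Qed.

Lemma sum_roots_of_unity (h Q : nat) : (0 < h < Q)%N ->
  \sum_(i < Q) ee (h%:R * (i%:R / Q%:R)) = 0 :> R[i].
Proof.
move=> /andP[h0 hQ]; have Q0 : Q%:R != 0 :> R by rewrite pnatr_eq0 -lt0n; apply: leq_ltn_trans hQ.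
pose w : R[i] := ee (h%:R / Q%:R).
have w1 : w != 1.
  apply/eqP => /ee_eq1[k hk].
  have k0 : (0 : R) < k%:~R by rewrite -hk divr_gt0 ?ltr0n// (leq_ltn_trans _ hQ).
  have k1 : (k%:~R : R) < 1%:~R by rewrite -hk ltr_pdivrMr ?mul1r ?ltr_nat// ltr0n (leq_ltn_trans _ hQ).
  by move: k0 k1; rewrite ltr0z ltr_int; case: (k) => // -[].
have : (w - 1) * \sum_(i < Q) w ^+ i = 0.
  rewrite -subrX1 -eeMn.
  have -> : Q%:R * (h%:R / Q%:R) = h%:R :> R by field.
  by rewrite ee_nat subrr.
move=> /eqP; rewrite mulf_eq0 subr_eq0 (negbTE w1) /= => /eqP e.
transitivity (\sum_(i < Q) w ^+ i); last exact: e.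
apply: eq_bigr => i _; rewrite -eeMn; congr ee; by field.
Qed.

(** One direction of Weyl's criterion, by approximating the character with a step function of the
    significand. The values of [a] at zeros of x need only be bounded, since zeros have density
    0. *)
Lemma benford_weyl (x : nat -> R) (h : nat) (a : nat -> R[i]) : benford b x ->
  (0 < h)%N -> (forall n, nm (a n) <= 1) ->
  (forall n, x n.+1 != 0 -> a n = ee (h%:R * logb b `|x n.+1|)) -> cmean a 0.
Proof.
move=> hx h0 a1 ha; apply: cmean_near => eps eps0.
have lb0 : 0 < ln (b%:R : R) := lnb_gt0 R b1.
have e2 : 0 < eps / 2 by rewrite divr_gt0.
have [d d0 hd] := ee_cont e2.
(* Q > h makes the sum of the roots of unity vanish; Q > h / d makes a step of length 1 / Q change
   the character by less than eps / 2. *)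
pose Q := (maxn h (Num.bound (h%:R / d))).+1.
have hQ : (0 < h < Q)%N by rewrite h0 ltnS leq_maxl.
have Q0 : 0 < (Q%:R : R) by [].
have hQd : h%:R / Q%:R < d.
  rewrite ltr_pdivrMr// mulrC -ltr_pdivrMr//.
  have hb : h%:R / d < (Num.bound (h%:R / d))%:R by apply: archi_boundP; rewrite divr_ge0// ltW.
  by apply: lt_le_trans hb _; rewrite ler_nat leqW// leq_maxr.
clearbody Q.
pose g (i : nat) : R[i] := ee (h%:R * (i%:R / Q%:R)).
pose th (i : nat) : R := expR (i%:R / Q%:R * ln b%:R).
have lth i : logb b (th i) = i%:R / Q%:R by rewrite /logb expRK mulfK// gt_eqF.
have th0 i : 0 < th i by exact: expR_gt0.
have thb (i : 'I_Q) : 1 <= th i < b%:R.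
  apply/andP; split; first by rewrite -expR0 ler_expR mulr_ge0 ?divr_ge0// ltW.
  have b0 : 0 < (b%:R : R) by rewrite ltr0n ltnW.
  rewrite -[ltRHS](lnK b0) ltr_expR gtr_pMl// ltr_pdivrMr// mul1r ltr_nat//.
pose ind (i n : nat) : R[i] := (th i < significand b (x n.+1))%R%:R.
(* The step function with jumps at b^(i / Q). It telescopes to [g J] when (J - 1) / Q < log_b S <= J
   / Q for the significand S. *)
pose w n := 1 + \sum_(i < Q) (g i.+1 - g i) * ind i n.
exists w; split.
  apply: (@cmean_eql _ (1 + \sum_(i < Q) (g i.+1 - g i) * (1 - i%:R / Q%:R)%:C)).
    (* Abel summation: the mean of the step function reduces to the sum of all g i, which is
       zero. *)
    have abel m : \sum_(i < m) (g i.+1 - g i) * (Q%:R - i%:R) =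
        g m * (Q%:R - m%:R) - g 0 * Q%:R + \sum_(i < m) g i.+1 :> R[i].
      elim: m => [|m IH]; first by rewrite !big_ord0 subr0 subrr add0r.
      by rewrite !big_ord_recr /= IH -natr1; ring.
    have QC : Q%:R != 0 :> R[i] by rewrite pnatr_eq0 -lt0n; case/andP: hQ => _; apply: leq_ltn_trans.
    have -> : \sum_(i < Q) (g i.+1 - g i) * (1 - i%:R / Q%:R)%:C =
        (\sum_(i < Q) (g i.+1 - g i) * (Q%:R - i%:R)) / Q%:R.
      rewrite mulr_suml; apply: eq_bigr => i _.
      rewrite rmorphB rmorphM fmorphV !rmorph_nat rmorph1; by field.
    have sg : \sum_(i < Q) g i.+1 = g Q - g 0%N.
      have e : g 0%N + \sum_(i < Q) g i.+1 = \sum_(i < Q) g i + g Q.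
        transitivity (\sum_(i < Q.+1) g i); first by rewrite big_ord_recl.
        by rewrite big_ord_recr.
      move: e; rewrite (sum_roots_of_unity hQ) add0r => <-.
      by rewrite addrC addKr.
    rewrite abel subrr mulr0 sg add0r /g mul0r mulr0 ee0 divff ?gt_eqF// mulr1 ee_nat.
    by rewrite subrr addr0 mul1r mulNr divff// subrr.
  apply: cmeanD; first exact: cmean_cst.
  apply: cmean_sum => i; apply: cmeanZ; rewrite -lth; exact: benford_ind_mean.
have e4 : 0 < eps / 4 by rewrite divr_gt0.
have h11 : 1 <= (1 : R) < b%:R by rewrite lexx ltr1n.
have /cvgrPdist_le /(_ _ e4) [N0 _ hN0] := hx 1 h11.
exists N0.+1 => N NN; have N0' : 0 < (N%:R : R) by rewrite ltr0n; apply: leq_ltn_trans NN.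
(* Zeros and exact powers of b, where the approximation is given up at a cost of 2; taking s = 1 in
   the Benford property shows that they have density 0. *)
pose low n := significand b (x n.+1) <= 1.
have clow : (count low (iota 0 N))%:R <= eps / 4 * N%:R.
  have -> : count low (iota 0 N) = count (fun n => significand b (x n) <= 1) (iota 1 N).
    by rewrite -[1%N in RHS]addn0 iotaDl count_map.
  have := hN0 N (ltnW NN); rewrite /logb ln1 mul0r sub0r normrN normrM normr_nat normfV normr_nat.
  by rewrite ler_pdivrMr.
have tele J m : \sum_(i < m) (g i.+1 - g i) * (i < J)%:R = g (minn m J) - g 0%N.
  elim: m => [|m IH]; first by rewrite big_ord0 min0n subrr.
  rewrite big_ord_recr /= IH; case: (ltnP m J) => mJ.
    by rewrite mulr1 (minn_idPl mJ); ring.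
  by rewrite mulr0 addr0 (minn_idPr (leqW mJ)).
have g0 : g 0%N = 1 by rewrite /g mul0r mulr0 ee0.
have pt n : nm (a n - w n) <= eps / 2 + (if low n then 2 else 0).
  rewrite /low; case: ifPn => [sl|]; last rewrite -ltNge => sl.
    have -> : w n = 1.
      rewrite /w big1 ?addr0// => i _; rewrite /ind ltNge.
      by have /andP[t1 _] := thb i; rewrite (le_trans sl t1) mulr0.
    apply: le_trans (nmB _ _) _; rewrite nm1; have := a1 n; lra.
  have xn : x n.+1 != 0.
    by apply: contraL sl => /eqP ->; rewrite /significand eqxx -leNgt.
  rewrite addr0 ha//; have [k [-> /andP[_ Sb]]] := logb_significand b1 xn.
  set S := significand b (x n.+1) in sl Sb *; pose y := logb b S.
  have S0 : 0 < S by apply: lt_trans sl.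
  have y0 : 0 < y by rewrite /y /logb divr_gt0// ln_gt0.
  have y1 : y <= 1.
    by rewrite -[1]/(1%:~R) -(logbXz R b1 1) expr1z ler_logb ?(ltW Sb)//; exact: lt_trans Sb.
  pose J := `|Num.ceil (Q%:R * y)|%N.
  have c0 : 0 <= Num.ceil (Q%:R * y) by rewrite ceil_ge0// (lt_trans (ltrN10 R))// mulr_gt0.
  have JE : (J%:R : R) = (Num.ceil (Q%:R * y))%:~R by rewrite -[J%:R]/((J : int)%:~R) gez0_abs.
  have J1 : Q%:R * y <= J%:R by rewrite JE; exact: ceil_ge.
  have J2 : J%:R < Q%:R * y + 1 by rewrite JE -ltrBlDr -[1]/(1%:~R) -intrB; exact: ceilB1_lt.
  have indJ (i : 'I_Q) : ind i n = (i < J)%N%:R.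
    rewrite /ind -/S; congr (nat_of_bool _)%:R.
    rewrite ltNge -(ler_logb b1 S0 (th0 i)) -/y lth -ltNge ltr_pdivrMr// [y * _]mulrC.
    apply/idP/idP => h1; first by rewrite -(ltr_nat R); apply: lt_le_trans J1.
    have : i%:R + 1 <= J%:R :> R by rewrite natr1 ler_nat.
    lra.
  have JQ : (J <= Q)%N.
    have : J%:R < Q%:R + 1 :> R by apply: lt_le_trans J2 _; rewrite lerD2r ger_pMr.
    by rewrite natr1 ltr_nat.
  have -> : w n = g J.
    rewrite /w (eq_bigr (fun i : 'I_Q => (g i.+1 - g i) * (i < J)%N%:R)) => [|i _]; last by rewrite indJ.
    by rewrite tele (minn_idPr JQ) g0 addrC subrK.
  have -> : ee (h%:R * (y + k%:~R)) = ee (h%:R * y) :> R[i].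
    by rewrite mulrDr eeD -[h%:R * k%:~R]/((h : int)%:~R * k%:~R) -intrM ee_int mulr1.
  have -> : ee (h%:R * y) - g J = g J * (ee (h%:R * (y - J%:R / Q%:R)) - 1).
    rewrite mulrBr mulr1 /g -eeD; congr (ee _ - _).
    by rewrite mulrBr addrCA subrr addr0.
  rewrite nmM nm_ee mul1r ltW// hd// normrM normr_nat.
  apply: le_lt_trans hQd; rewrite ler_wpM2l// -normrN opprB ger0_norm.
    by rewrite lerBlDr ler_pdivrMr// mulrDl mulVf ?gt_eqF// addrC [y * _]mulrC ltW.
  by rewrite subr_ge0 ler_pdivlMr// mulrC.
apply: (@le_trans _ _ (\sum_(n < N) (eps / 2 + (if low n then 2 else 0)))).
  by apply: ler_sum => n _; exact: pt.
rewrite big_split /= sum_if_count sumr_const card_ord -[_ *+ N]mulr_natl; lra.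
Qed.

End weyl.

Section root_of_unity_resonance.
Variable R : realType.

Lemma count_multiples (h m : nat) : (0 < h)%N ->
  (m <= count (fun n => (h %| n)%N) (iota 1 (h * m)))%N.
Proof.
move=> h0; rewrite -[X in (X <= _)%N](size_iota 1) -(size_map (muln h)) -size_filter.
apply: uniq_leq_size.
  rewrite map_inj_uniq ?iota_uniq// => i j /eqP; rewrite eqn_mul2l.
  by rewrite -leqn0 leqNgt h0 /= => /eqP.
move=> n /mapP[j]; rewrite mem_iota => /andP[j1 jm] ->.
rewrite mem_filter dvdn_mulr//= mem_iota muln_gt0 h0 j1 /=.
by rewrite add1n ltnS leq_mul2l; apply/orP; right; rewrite -ltnS -add1n.
Qed.

(* As 0 has significand 0, the zeros count for s = 1, where log_b s = 0. *)
Lemma not_benford_of_zeros (b : nat) (x : nat -> R) (h : nat) : (1 < b)%N -> (0 < h)%N ->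
  (forall n, (h %| n)%N -> x n = 0) -> ~ benford b x.
Proof.
move=> b1 h0 xz hb.
have h11 : 1 <= (1 : R) < b%:R by rewrite lexx ltr1n.
have hR : 0 < (h%:R : R) by rewrite ltr0n.
have e0 : 0 < (2 * h%:R)^-1 :> R by rewrite invr_gt0 mulr_gt0.
have /cvgrPdist_le /(_ _ e0) [N0 _ hN0] := hb 1 h11.
pose N := (h * N0.+1)%N.
have NN : (N0 <= N)%N by apply: leq_trans (leqnSn _) _; rewrite leq_pmull.
have := hN0 N NN; rewrite /logb ln1 mul0r sub0r normrN normrM normr_nat normfV normr_nat.
apply/negP; rewrite -ltNge.
have N00 : 0 < (N%:R : R) by rewrite ltr0n muln_gt0 h0.
rewrite ltr_pdivlMr//; apply: (@lt_le_trans _ _ N0.+1%:R).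
  rewrite /N natrM; have -> : (2 * h%:R)^-1 * (h%:R * N0.+1%:R) = N0.+1%:R / 2 :> R.
    by field; rewrite gt_eqF.
  by rewrite ltr_pdivrMr// ltr_pMr// ltr1n.
rewrite ler_nat; apply: leq_trans (count_multiples _ h0) _.
by apply: sub_count => n /= hn; rewrite xz// /significand eqxx.
Qed.

Lemma root_of_unity_resonance d (A : 'M[R]_d.+1) (b : nat) (z w : R[i]) (h : nat) :
  (1 < b)%N -> spectrum A z -> spectrum A w -> z != 0 -> z != w -> (0 < h)%N ->
  z ^+ h = w ^+ h -> exists x y : 'cV[R]_d.+1,
  ~ (benford b (fun n => (x^T *m (A ^+ n) *m y) 0 0) \/
     terminating d.+1 (fun n => (x^T *m (A ^+ n) *m y) 0 0)).
Proof.
move=> b1 hz hw z0 zw h0 e.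
have [|y hy] := @realize _ d A [:: z; w].
  by move=> u; rewrite !inE => /orP[/eqP ->|/eqP ->].
(* Past the index of termination and congruent to 1 modulo h: the common factor (z^h)^(d + 1) splits
   off and leaves z - w. With [al] conjugate to z^m - w^m, the m-th value is |z^m - w^m|^2. *)
pose m := (h * d.+1).+1.
pose al : R[i] := cj (z ^+ m - w ^+ m).
have [|x hx] := hy [:: (al, z); (- al, w)].
  by move=> p; rewrite !inE => /orP[/eqP ->|/eqP ->] /=; rewrite eqxx ?orbT.
have {}hx n : (x^T *m A ^+ n *m y) 0 0 = Re (al * (z ^+ n - w ^+ n)).
  by rewrite hx /expsum !big_cons big_nil addr0 /= mulrBr mulNr.
exists x, y; case=> [|ht].
  apply: (@not_benford_of_zeros _ _ h) => // n /dvdnP[k ->].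
  by rewrite hx mulnC !exprM e subrr mulr0.
have := ht m; rewrite hx => /(_ _)/eqP; rewrite mulrC mul_conj /= => hh.
have {hh} : nm (z ^+ m - w ^+ m) ^+ 2 == 0.
  by apply: hh; rewrite /m ltnS (leq_trans (leqnSn d))// leq_pmull.
rewrite expf_eq0 /= nm_eq0 /m !exprSr !exprM -e -mulrBr mulf_eq0 subr_eq0 (negbTE zw) orbF.
by rewrite !expf_eq0 (negbTE z0) andbF andbF.
Qed.

End root_of_unity_resonance.

(** * Words in the normalized eigenvalues *)

Section words.
Variable R : realType.
Variables (r : R) (Z : set R[i]).
Hypotheses (r0 : 0 < r) (Zr : forall z, Z z -> nm z = r).

Definition letter (v : R[i]) := exists2 z, Z z & v = z / r%:C \/ v = (z / r%:C)^-1.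

Definition word (g : R[i]) := exists2 ws : seq R[i],
  (forall v, v \in ws -> letter v) & g = \prod_(v <- ws) v.

Lemma word1 : word 1. Proof. by exists [::]; rewrite ?big_nil. Qed.

Lemma word_letter v : letter v -> word v.
Proof. by move=> hv; exists [:: v]; rewrite ?big_seq1// => u; rewrite inE => /eqP ->. Qed.

Lemma wordM g h : word g -> word h -> word (g * h).
Proof.
move=> [s hs ->] [t ht ->]; exists (s ++ t); last by rewrite big_cat.
by move=> v; rewrite mem_cat => /orP[/hs|/ht].
Qed.

Lemma wordX g n : word g -> word (g ^+ n).
Proof.
by move=> hg; elim: n => [|n IH]; [exact: word1|rewrite exprS; exact: wordM].
Qed.

Lemma letterV v : letter v -> letter v^-1.
Proof. by move=> [z Zz [->|->]]; exists z => //; rewrite ?invrK; [right|left]. Qed.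

Lemma wordV g : word g -> word g^-1.
Proof.
move=> [s hs ->]; exists [seq v^-1 | v <- s].
  by move=> u /mapP[v /hs hv ->]; exact: letterV.
by rewrite big_map prodfV.
Qed.

(** The reals with a positive multiple h t for which [ee] is a word form a rational subspace: h h'
    works for a sum, and a factor q multiplies h by its denominator. This subspace contains
    [Delta Z], whose elements give quotients of two letters. *)
Lemma span_word t : spanH Z t -> exists2 h : nat, (0 < h)%N & word (ee (h%:R * t)).
Proof.
pose V : set R[i] := [set v | exists2 s : R, v = s%:C &
  exists2 h : nat, (0 < h)%N & word (ee (h%:R * s))]%classic.
move=> /(_ V)[|s /complexI ->] //; split; last first.
  move=> _ [s [z [w [Zz Zw ->]]] <-]; exists (1 + (arg z - arg w) / (2 * pi)) => //.
  exists 1%N => //; rewrite mul1r eeD ee1 mul1r mulrBl eeB.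
  rewrite -(Z_polar r0 Zr Zz) -(Z_polar r0 Zr Zw).
  by apply: wordM; apply: word_letter; [exists z => //; left|exists w => //; right].
split.
- by exists 0 => //; exists 1%N => //; rewrite mulr0 ee0; exact: word1.
- move=> _ _ [s -> [h h0 hs]] [s' -> [h' h'0 hs']]; exists (s + s'); first by rewrite rmorphD.
  exists (h * h')%N; first by rewrite muln_gt0 h0.
  have -> : (h * h')%:R * (s + s') = h'%:R * (h%:R * s) + h%:R * (h'%:R * s') :> R.
    by rewrite natrM; ring.
  by rewrite eeD !(eeMn (_ * _)); apply: wordM; exact: wordX.
move=> q _ [s -> [h h0 hs]]; exists (ratr q * s); first by rewrite rmorphM /= fmorph_rat.
pose m := `|denq q|%N.
have m0 : (0 < m)%N by rewrite absz_gt0 denq_neq0.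
have mE : (m%:R : R) = (denq q)%:~R by rewrite -[m%:R]/((m : int)%:~R) absz_denq.
have md0 : (denq q)%:~R != 0 :> R by rewrite intr_eq0 denq_neq0.
exists (h * m)%N; first by rewrite muln_gt0 h0.
have -> : (h * m)%:R * (ratr q * s) = (numq q)%:~R * (h%:R * s).
  by rewrite natrM mE /ratr; field.
case: (numq q) => n; first by rewrite -[_%:~R]/(n%:R) eeMn; exact: wordX.
by rewrite NegzE mulrNz mulNr eeN eeMn; apply: wordV; exact: wordX.
Qed.

End words.

(** * Averaging over the disc *)

Local Open Scope classical_set_scope.
Local Open Scope ring_scope.

Section affine_substitution.
Variable R : realType.
Local Notation mu := (@lebesgue_measure R).

Definition affine (s t : R) : measurableTypeR R -> measurableTypeR R := fun x => s * x + t.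

Lemma measurable_affine (s t : R) : measurable_fun setT (affine s t).
Proof. by apply: measurable_funD => //; exact: measurable_funM. Qed.

Section affine_image.
Variables s t : R.

Definition affine_image : set (measurableTypeR R) -> \bar R := pushforward mu (affine s t).

Let affine_image0 : affine_image set0 = 0%E.
Proof. by rewrite /affine_image /pushforward preimage_set0 measure0. Qed.

Let affine_image_ge0 A : (0 <= affine_image A)%E.
Proof. exact: (measure_ge0 (mu : {measure set _ -> \bar R})). Qed.

Let affine_image_sigma_additive : semi_sigma_additive affine_image.
Proof. by apply: measure_semi_sigma_additive; exact: measurable_affine. Qed.

HB.instance Definition _ := isMeasure.Build _ _ _ affine_image
  affine_image0 affine_image_ge0 affine_image_sigma_additive.

End affine_image.

(** By uniqueness of the Lebesgue measure it suffices to measure half-open intervals; for s < 0 the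
    preimage is half-open at the other end, with the expected length. *)
Lemma lebesgue_measure_affine (s t : R) (A : set (measurableTypeR R)) : s != 0 ->
  measurable A -> mu A = mscale (NngNum (normr_ge0 s)) (affine_image s t) A.
Proof.
move=> s0 mA; apply: lebesgue_measure_unique => // X [[u v] _ <-] /=.
rewrite /mscale /= /affine_image /pushforward.
have [sp|sn|s00] := ltgtP 0 s; last by rewrite -s00 eqxx in s0.
- have -> : affine s t @^-1` [set` `]u, v]] = [set` `](u - t) / s, (v - t) / s]].
    apply/seteqP; split=> x /=; rewrite !in_itv /= /affine.
      by move=> /andP[h1 h2]; rewrite ltr_pdivrMr// ler_pdivlMr//; apply/andP; split; lra.
    by rewrite ltr_pdivrMr// ler_pdivlMr// => /andP[h1 h2]; apply/andP; split; lra.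
  rewrite !lebesgue_measure_itv /= !lte_fin ltr_pM2r ?invr_gt0// ltrD2r.
  case: ifP => uv; last by rewrite mule0.
  by rewrite -!EFinB -EFinM (gtr0_norm sp); congr EFin; field.
- have -> : affine s t @^-1` [set` `]u, v]] = [set` `[(v - t) / s, (u - t) / s[].
    apply/seteqP; split=> x /=; rewrite !in_itv /= /affine.
      by move=> /andP[h1 h2]; rewrite ler_ndivrMr// ltr_ndivlMr//; apply/andP; split; lra.
    by rewrite ler_ndivrMr// ltr_ndivlMr// => /andP[h1 h2]; apply/andP; split; lra.
  rewrite !lebesgue_measure_itv /= !lte_fin ltr_nM2r ?invr_lt0// ltrD2r.
  case: ifP => uv; last by rewrite mule0.
  by rewrite -!EFinB -EFinM (ltr0_norm sn); congr EFin; field.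
Qed.

Lemma integral_affine (s t : R) (f : R -> R) : s != 0 ->
  measurable_fun setT f -> (forall x, 0 <= f x) ->
  (\int[mu]_x (f x)%:E = `|s|%:E * \int[mu]_x (f (s * x + t))%:E)%E.
Proof.
move=> s0 mf f0.
have mf' : measurable_fun [set: measurableTypeR R] (EFin \o f) by exact/measurable_EFinP.
transitivity (\int[mscale (NngNum (normr_ge0 s)) (affine_image s t)]_x (f x)%:E)%E.
  apply: eq_measure_integral => A mA _; exact: lebesgue_measure_affine.
rewrite ge0_integral_mscale//; last by move=> x _; rewrite lee_fin.
congr (_ * _)%E; rewrite [LHS](@ge0_integral_pushforward _ _ _ _ _ _ (measurable_affine s t))//.
by move=> x _; rewrite lee_fin.
Qed.

End affine_substitution.

Section disc.
Variable R : realType.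
Local Notation mu := (@lebesgue_measure R).

(** Applied to u = |xi|^2. Square roots of negative numbers are 0, so the weight is supported in the
    disc without an indicator function. *)
Definition dome (u : R) : R := Num.sqrt (1 - u).

Lemma dome_ge0 u : 0 <= dome u. Proof. exact: sqrtr_ge0. Qed.

Lemma measurable_dome1 : measurable_fun setT dome.
Proof.
apply: continuous_measurable_fun => u; apply: continuous_comp; last exact: sqrt_continuous.
by apply: cvgB; [exact: cvg_cst|exact: cvg_id].
Qed.

(** Half the area of the unit disc; only that it is finite and positive matters. *)
Definition kappa0 : \bar R := (\int[mu]_b (dome (b ^+ 2))%:E)%E.

Definition cap (y : R) : R := Num.max 0 (1 - y ^+ 2).

(** Scaling b by c = sqrt(1 - y^2) yields one factor c from the weight and one from the measure;
    their product is the polynomial 1 - y^2. *)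
Lemma dome_slice (y : R) :
  (\int[mu]_b (dome (b ^+ 2 + y ^+ 2))%:E = (cap y)%:E * kappa0)%E.
Proof.
rewrite /cap; have [h|h] := leP (1 - y ^+ 2) 0.
  rewrite mul0e integral0_eq// => b _; congr EFin; apply: ler0_sqrtr.
  by have := sqr_ge0 b; lra.
pose c := Num.sqrt (1 - y ^+ 2).
have c0 : 0 < c by rewrite sqrtr_gt0.
have c2 : c ^+ 2 = 1 - y ^+ 2 by rewrite sqr_sqrtr// ltW.
have mf : measurable_fun setT (fun b : R => dome (b ^+ 2 + y ^+ 2)).
  apply: (measurableT_comp measurable_dome1).
  by apply: measurable_funD => //; exact: measurable_funX.
rewrite (@integral_affine _ c 0)// ?gt_eqF//; last by move=> b; exact: dome_ge0.
have e (x : R) : dome ((c * x + 0) ^+ 2 + y ^+ 2) = c * dome (x ^+ 2).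
  rewrite /dome addr0.
  have -> : 1 - ((c * x) ^+ 2 + y ^+ 2) = c ^+ 2 * (1 - x ^+ 2).
    by clearbody c; rewrite (_ : y ^+ 2 = 1 - c ^+ 2); [ring|lra].
  by rewrite sqrtrM ?sqr_ge0// sqrtr_sqr gtr0_norm.
under eq_integral do rewrite e EFinM.
rewrite ge0_integralZl//=.
- by rewrite muleA -EFinM gtr0_norm// -expr2 c2.
- apply/measurable_EFinP; apply: (measurableT_comp measurable_dome1).
  exact: measurable_funX.
- by move=> x _; rewrite lee_fin dome_ge0.
- by rewrite lee_fin ltW.
Qed.

Lemma integral_swap (F : R -> R -> R) :
  measurable_fun setT (fun z : measurableTypeR R * measurableTypeR R => F z.1 z.2) ->
  (forall a b, 0 <= F a b) ->
  (\int[mu]_a \int[mu]_b (F a b)%:E = \int[mu]_b \int[mu]_a (F a b)%:E)%E.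
Proof.
move=> mF F0.
pose f (z : measurableTypeR R * measurableTypeR R) := (F z.1 z.2)%:E.
have mf : measurable_fun setT f by exact/measurable_EFinP.
by rewrite (@fubini_tonelli _ _ _ _ _ mu mu f mf)// => z; rewrite lee_fin.
Qed.

(* Integrate first along the lines c a - s b = y: the slices of the disc in
   that direction are again discs around 0. *)
Lemma disc_average (Phi : R -> R) (c s : R) : c ^+ 2 + s ^+ 2 = 1 ->
  measurable_fun setT Phi -> (forall x, 0 <= Phi x) ->
  (\int[mu]_b \int[mu]_a (dome (a ^+ 2 + b ^+ 2) * Phi (c * a - s * b))%:E =
   kappa0 * \int[mu]_y (cap y * Phi y)%:E)%E.
Proof.
move=> cs mPhi Phi0.
have k0 : (0 <= kappa0)%E by apply: integral_ge0 => b _; rewrite lee_fin dome_ge0.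
have mcap : measurable_fun setT cap.
  apply: measurable_maxr => //; apply: measurable_funB => //; exact: measurable_funX.
have slice (y : R) : (\int[mu]_b (dome (b ^+ 2 + y ^+ 2) * Phi y)%:E = kappa0 * (cap y * Phi y)%:E)%E.
  under eq_integral do rewrite mulrC EFinM.
  rewrite ge0_integralZl//=; last first.
  - by rewrite lee_fin.
  - by move=> b _; rewrite lee_fin dome_ge0.
  - apply/measurable_EFinP; apply: (measurableT_comp measurable_dome1).
    by apply: measurable_funD => //; exact: measurable_funX.
  by rewrite dome_slice EFinM muleA [RHS]muleC; congr (_ * _)%E; rewrite muleC.
have int_slice : (\int[mu]_y \int[mu]_b (dome (b ^+ 2 + y ^+ 2) * Phi y)%:E =
   kappa0 * \int[mu]_y (cap y * Phi y)%:E)%E.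
  under eq_integral do rewrite slice.
  rewrite ge0_integralZl//.
  - by apply/measurable_EFinP; exact: measurable_funM.
  - by move=> y _; rewrite lee_fin mulr_ge0// /cap le_max lexx.
have m1 := @measurable_fst _ _ (measurableTypeR R) (measurableTypeR R).
have m2 := @measurable_snd _ _ (measurableTypeR R) (measurableTypeR R).
(* For c = 0 the form depends on b alone, and exchanging the integrals replaces the substitution,
   which divides by c. *)
have [c0|cn] := eqVneq c 0.
  have s1 : s ^+ 2 = 1 by rewrite -cs c0 expr0n add0r.
  have sn : s != 0 by apply/eqP => s0; move: s1; rewrite s0 expr0n => /eqP; rewrite eq_sym oner_eq0.
  have ns : `|s| = 1.
    by apply/eqP; rewrite -(@eqrXn2 _ 2)// expr1n real_normK ?num_real// s1.
  have mf : measurable_fun setT (fun z : measurableTypeR R * measurableTypeR R =>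
      dome (z.1 ^+ 2 + z.2 ^+ 2) * Phi (- s * z.2)).
    apply: measurable_funM.
      apply: (measurableT_comp measurable_dome1).
      by apply: measurable_funD; apply: measurable_funX.
    apply: (measurableT_comp mPhi); exact: measurable_funM.
  transitivity (\int[mu]_b \int[mu]_a (dome (a ^+ 2 + b ^+ 2) * Phi (- s * b))%:E)%E.
    apply: eq_integral => b _; apply: eq_integral => a _.
    by rewrite c0 mul0r sub0r mulNr.
  rewrite -(@integral_swap (fun a b => dome (a ^+ 2 + b ^+ 2) * Phi (- s * b)) mf); last by move=> a b; rewrite mulr_ge0// dome_ge0.
  rewrite -int_slice.
  have mf2 : measurable_fun setT (fun z : measurableTypeR R * measurableTypeR R =>
      dome (z.1 ^+ 2 + z.2 ^+ 2) * Phi z.2).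
    apply: measurable_funM.
      apply: (measurableT_comp measurable_dome1).
      by apply: measurable_funD; apply: measurable_funX.
    exact: (measurableT_comp mPhi).
  rewrite -(@integral_swap (fun a y => dome (a ^+ 2 + y ^+ 2) * Phi y) mf2); last by move=> a b; rewrite mulr_ge0// dome_ge0.
  apply: eq_integral => a _.
  rewrite [RHS](@integral_affine _ (- s) 0) ?oppr_eq0//.
  - rewrite normrN ns mul1e; apply: eq_integral => b _.
    by rewrite addr0 exprMn sqrrN s1 mul1r.
  - apply: measurable_funM => //; apply: (measurableT_comp measurable_dome1).
    by apply: measurable_funD => //; exact: measurable_funX.
  - by move=> b; rewrite mulr_ge0// dome_ge0.
(* The substitutions a = (y + s b) / c and then b = c b' - s y compose to a rotation, preserving a^2
   + b^2; their factors |1 / c| and |c| cancel. *)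
pose G (b y : R) := dome ((c^-1 * y + s * b / c) ^+ 2 + b ^+ 2) * Phi y.
have G0 b y : 0 <= G b y by rewrite mulr_ge0// dome_ge0.
have mG : measurable_fun setT (fun z : measurableTypeR R * measurableTypeR R => `|c^-1| * G z.1 z.2).
  apply: measurable_funM => //; apply: measurable_funM.
    apply: (measurableT_comp measurable_dome1).
    apply: measurable_funD; apply: measurable_funX => //.
    apply: measurable_funD; first exact: measurable_funM.
    by apply: measurable_funM => //; exact: measurable_funM.
  exact: (measurableT_comp mPhi).
transitivity (\int[mu]_b \int[mu]_y (`|c^-1| * G b y)%:E)%E.
  apply: eq_integral => b _.
  rewrite (@integral_affine _ c^-1 (s * b / c)) ?invr_eq0//.
  - rewrite -ge0_integralZl//=.
    + apply: eq_integral => y _; rewrite -EFinM /G; congr (_ * (_ * Phi _))%:E.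
      by field.
    + apply/measurable_EFinP; apply: measurable_funM.
        apply: (measurableT_comp measurable_dome1).
        apply: measurable_funD => //; apply: measurable_funX.
        by apply: measurable_funD => //; exact: measurable_funM.
      apply: (measurableT_comp mPhi); apply: measurable_funB => //.
      apply: measurable_funM => //.
      by apply: measurable_funD => //; exact: measurable_funM.
    + by move=> y _; rewrite lee_fin mulr_ge0// dome_ge0.
  - apply: measurable_funM.
      apply: (measurableT_comp measurable_dome1).
      by apply: measurable_funD => //; exact: measurable_funX.
    by apply: (measurableT_comp mPhi); apply: measurable_funB.
  - by move=> y; rewrite mulr_ge0// dome_ge0.
rewrite (@integral_swap (fun b y => `|c^-1| * G b y) mG); last by move=> b y; rewrite mulr_ge0.
rewrite -int_slice; apply: eq_integral => y _.
have mGy : measurable_fun setT (fun b => `|c^-1| * G b y).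
  apply: measurable_funM => //; apply: measurable_funM => //.
  apply: (measurableT_comp measurable_dome1).
  apply: measurable_funD; apply: measurable_funX => //.
  apply: measurable_funD => //.
  by apply: measurable_funM => //; exact: measurable_funM.
rewrite (@integral_affine _ c (- s * y))//; last by move=> b; rewrite mulr_ge0.
rewrite -ge0_integralZl//=.
- apply: eq_integral => b _; rewrite -EFinM mulrA -normrM divff// normr1 mul1r /G.
  congr (dome _ * _)%:E.
  have -> : c^-1 * y + s * (c * b + - s * y) / c = c * y + s * b.
    have -> : c^-1 * y = c^-1 * ((c ^+ 2 + s ^+ 2) * y) by rewrite cs mul1r.
    by field.
  have -> : b ^+ 2 + y ^+ 2 = (c ^+ 2 + s ^+ 2) * (b ^+ 2 + y ^+ 2) by rewrite cs mul1r.
  by ring.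
- apply/measurable_EFinP.
  apply: (measurableT_comp (f := fun b => `|c^-1| * G b y)) => //.
  by apply: measurable_funD => //; exact: measurable_funM.
- by move=> b _; rewrite lee_fin mulr_ge0.
Qed.

Lemma lebesgue_measure_cc (u v : R) : u <= v -> mu [set` `[u, v]] = (v - u)%:E.
Proof.
rewrite lebesgue_measure_itv /= lte_fin le_eqVlt => /orP[/eqP ->|->]; last by rewrite EFinB.
by rewrite ltxx subrr.
Qed.

Lemma kappa0_fin : exists2 k : R, 0 < k & kappa0 = k%:E.
Proof.
have k0 : (0 <= kappa0)%E by apply: integral_ge0 => b _; rewrite lee_fin dome_ge0.
have mi (u v : R) : measurable_fun setT (fun b : R => (\1_([set` `[u, v]] : set R) b : R)%:E).
  exact/measurable_EFinP/measurable_indic.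
have md : measurable_fun setT (fun b : R => (dome (b ^+ 2))%:E).
  apply/measurable_EFinP; apply: (measurableT_comp measurable_dome1).
  exact: measurable_funX.
have ku : (kappa0 <= 2%:E)%E.
  apply: (@le_trans _ _ (\int[mu]_b (\1_([set` `[-1, 1]] : set R) b)%:E)%E).
    apply: ge0_le_integral => //.
    - by move=> b _; rewrite lee_fin dome_ge0.
    - exact: mi.
    move=> b _; rewrite lee_fin indicE; case: (boolP (b \in _)) => hb; last first.
      move: hb; rewrite mem_setE /= in_itv /= -ler_norml -ltNge => hb.
      rewrite /dome ler0_sqrtr// subr_le0 -(@real_normK _ b) ?num_real//.
      by rewrite expr_ge1// ltW.
    by rewrite /dome -[leRHS]sqrtr1 ler_wsqrtr// lerBlDr lerDl sqr_ge0.
  rewrite integral_indic// setIT.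
  apply: (eq_ind_r (fun x => x <= 2%:E)%E _ (lebesgue_measure_cc _)); last by lra.
  by rewrite lee_fin; lra.
have kl : ((1/2)%:E <= kappa0)%E.
  apply: (@le_trans _ _ (\int[mu]_b ((1/2)%:E * (\1_([set` `[-(1/2), 1/2]] : set R) b)%:E))%E).
    rewrite ge0_integralZl//=; last exact: mi.
    rewrite integral_indic// setIT.
    apply: (eq_ind_r (fun x => (1/2)%:E <= (1/2)%:E * x)%E _ (lebesgue_measure_cc _)); last by lra.
    by rewrite -EFinM lee_fin; lra.
  apply: ge0_le_integral => //.
  - by apply: measurable_funeM; exact: mi.
  move=> b _; rewrite -EFinM lee_fin indicE; case: (boolP (b \in _)) => hb; last first.
    by rewrite mulr0 dome_ge0.
  move: hb; rewrite mem_setE /= in_itv /= => /andP[h1 h2].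
  rewrite mulr1 /dome -[1/2]ger0_norm; last lra.
  by rewrite -sqrtr_sqr ler_wsqrtr//; nra.
case: kappa0 k0 ku kl => [k| |]//= k0 ku kl.
by exists k => //; move: kl; rewrite lee_fin; lra.
Qed.

Lemma integral_cap (f : R -> R) :
  (\int[mu]_y (cap y * f y)%:E = \int[mu]_(y in [set` `[-1, 1]%R]) ((1 - y ^+ 2) * f y)%:E)%E.
Proof.
rewrite [RHS]integral_mkcond; apply: eq_integral => y _; rewrite patchE.
have e : (y \in [set` `[-1, 1]%R]) = (0 <= 1 - y ^+ 2).
  by rewrite mem_setE /= in_itv /= -ler_norml -(@expr_le1 _ 2)// real_normK ?num_real// subr_ge0.
rewrite e /cap; have [h|h] := leP 0 (1 - y ^+ 2); first by [].
by rewrite mul0r.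
Qed.

Definition capmean (f : R -> R) : R := (\int[mu]_(y in [set` `[-1, 1]%R]) ((1 - y ^+ 2) * f y))%R.

Lemma cap_integrable (f : R -> R) K : measurable_fun setT f -> (forall x, `|f x| <= K) ->
  mu.-integrable [set` `[-1, 1]%R] (EFin \o (fun y => (1 - y ^+ 2) * f y)).
Proof.
move=> mf fb; apply: measurable_bounded_integrable => //.
- by apply: (eq_ind_r (fun x => x < +oo)%E _ (lebesgue_measure_cc _)); [exact: ltry|lra].
- apply: (@measurable_funS _ _ _ _ setT) => //.
  apply: measurable_funM => //; apply: measurable_funB => //; exact: measurable_funX.
exists K; split; first exact: num_real.
move=> M KM y /=; rewrite in_itv /= => /andP[y1 y2].
rewrite normrM; apply: (@le_trans _ _ (1 * K)); last by rewrite mul1r ltW.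
apply: ler_pM => //; rewrite ger0_norm; nra.
Qed.

Lemma disc_product (Phi : R -> R) (c s : R) : c ^+ 2 + s ^+ 2 = 1 ->
  measurable_fun setT Phi -> (forall x, 0 <= Phi x) ->
  (\int[mu \x mu]_z (dome (z.1 ^+ 2 + z.2 ^+ 2) * Phi (c * z.1 - s * z.2))%:E =
   kappa0 * \int[mu]_y (cap y * Phi y)%:E)%E.
Proof.
move=> cs mPhi Phi0; rewrite -(disc_average cs)//.
pose f (z : measurableTypeR R * measurableTypeR R) :=
  (dome (z.1 ^+ 2 + z.2 ^+ 2) * Phi (c * z.1 - s * z.2))%:E.
have m1 := @measurable_fst _ _ (measurableTypeR R) (measurableTypeR R).
have m2 := @measurable_snd _ _ (measurableTypeR R) (measurableTypeR R).
rewrite (@fubini_tonelli2 _ _ _ _ _ mu mu f)//; last first.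
  by move=> z; rewrite lee_fin mulr_ge0// dome_ge0.
apply/measurable_EFinP; apply: measurable_funM.
  apply: (measurableT_comp measurable_dome1).
  by apply: measurable_funD; apply: measurable_funX.
apply: (measurableT_comp mPhi).
by apply: measurable_funB; apply: measurable_funM.
Qed.

(** Dominated convergence over the disc. By [disc_product] the integral of the n-th term does not
    depend on the direction (c n, s n), so it is kappa0 times a cap average. *)
Lemma smoothing (g : nat -> R -> R) (c s : nat -> R) :
  (forall n, c n ^+ 2 + s n ^+ 2 = 1) -> (forall n, measurable_fun setT (g n)) ->
  (forall n x, `|g n x| <= 1) ->
  (forall a b, (fun N => (\sum_(n < N) g n (c n * a - s n * b)) / N%:R) @ \oo --> (0 : R)) ->
  (fun N => (\sum_(n < N) capmean (g n)) / N%:R) @ \oo --> (0 : R).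
Proof.
move=> cs mg gb gm; have [k k0 ek] := kappa0_fin.
(* Adding 1 makes the integrands nonnegative, as [disc_product] requires. *)
pose Phi n x := 1 + g n x.
have Phi0 n x : 0 <= Phi n x by have := gb n x; rewrite ler_norml /Phi; lra.
have Phi2 n x : Phi n x <= 2 by have := gb n x; rewrite ler_norml /Phi; lra.
have mPhi n : measurable_fun setT (Phi n) by apply: measurable_funD.
have capPhi n : (\int[mu]_y (cap y * Phi n y)%:E)%E = (capmean (cst 1) + capmean (g n))%:E.
  have i : mu.-integrable [set` `[-1, 1]%R] (EFin \o (fun y => (1 - y ^+ 2) * Phi n y)).
    by apply: (@cap_integrable _ 2) => // x; rewrite ger0_norm.
  transitivity ((capmean (Phi n))%:E).
    by rewrite integral_cap /capmean /Rintegral fineK//; exact: integrable_fin_num i.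
  congr EFin; rewrite /capmean -RintegralD//=; last 2 first.
  - by apply: (@cap_integrable _ 1) => // x; rewrite normr1.
  - exact: (@cap_integrable _ 1).
  by apply: eq_Rintegral => y _; rewrite /Phi mulrDr.
pose T := (measurableTypeR R * measurableTypeR R)%type.
pose D (z : T) := dome (z.1 ^+ 2 + z.2 ^+ 2).
have D0 z : 0 <= D z by exact: dome_ge0.
have m1 := @measurable_fst _ _ (measurableTypeR R) (measurableTypeR R).
have m2 := @measurable_snd _ _ (measurableTypeR R) (measurableTypeR R).
have mD : measurable_fun [set: T] D.
  apply: (measurableT_comp measurable_dome1).
  by apply: measurable_funD; apply: measurable_funX.
pose W N (z : T) := (\sum_(n < N) Phi n (c n * z.1 - s n * z.2)) / N%:R.
have W0 N z : 0 <= W N z by rewrite mulr_ge0// ?invr_ge0 ?ler0n// sumr_ge0.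
have W2 N z : W N z <= 2.
  case: N => [|N]; first by rewrite /W invr0 mulr0.
  rewrite /W ler_pdivrMr ?ltr0n//; apply: (@le_trans _ _ (\sum_(n < N.+1) 2)).
    by apply: ler_sum => n _; exact: Phi2.
  by rewrite sumr_const card_ord -[_ *+ _]mulr_natr.
have mPz n : measurable_fun [set: T] (fun z => Phi n (c n * z.1 - s n * z.2)).
  apply: (measurableT_comp (mPhi n)).
  by apply: measurable_funB; apply: measurable_funM.
have mW N : measurable_fun [set: T] (W N).
  by apply: measurable_funM => //; apply: measurable_sum.
have intW N : (\int[mu \x mu]_z (D z * W N.+1 z)%:E)%E =
    (k * (capmean (cst 1) + (\sum_(n < N.+1) capmean (g n)) / N.+1%:R))%:E.
  have N0 : (N.+1%:R : R) != 0 by rewrite pnatr_eq0.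
  transitivity (\int[mu \x mu]_z ((N.+1%:R^-1)%:E *
       (\sum_(n < N.+1) (D z * Phi n (c n * z.1 - s n * z.2))%:E)%E))%E.
    apply: eq_integral => z _; rewrite sumEFin -EFinM; congr EFin.
    by rewrite /W -mulr_sumr mulrA mulrC mulrCA !mulrA; congr (_ * _); rewrite mulrC.
  rewrite ge0_integralZl//=; last 2 first.
  - apply: emeasurable_sum => n; apply/measurable_EFinP; exact: measurable_funM.
  - by move=> z _; apply: sume_ge0 => n _; rewrite lee_fin mulr_ge0.
  rewrite ge0_integral_sum//=; last 2 first.
  - by move=> n; apply/measurable_EFinP; exact: measurable_funM.
  - by move=> n z _; rewrite lee_fin mulr_ge0.
  under eq_bigr => n _ do rewrite (disc_product (cs n))// ek capPhi -EFinM.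
  rewrite sumEFin -EFinM -mulr_sumr big_split /= sumr_const card_ord -[_ *+ _]mulr_natr.
  by congr EFin; field.
have intD : (\int[mu \x mu]_z (D z)%:E)%E = (k * capmean (cst 1))%:E.
  have := @disc_product (cst 1) 1 0; rewrite ek => h.
  transitivity (\int[mu \x mu]_z (D z * 1)%:E)%E.
    by apply: eq_integral => z _; rewrite mulr1.
  rewrite h//; last by rewrite expr1n expr0n addr0.
  rewrite integral_cap EFinM /capmean /Rintegral fineK//.
  apply: integrable_fin_num => //.
  by apply: (@cap_integrable (cst 1) 1) => // x; rewrite normr1.
have iD : (mu \x mu)%E.-integrable setT (fun z => (D z)%:E * 2%:E)%E.
  apply: integrableZr => //; apply/integrableP; split; first exact/measurable_EFinP.
  under eq_integral do rewrite gee0_abs ?lee_fin//.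
  by rewrite intD ltry.
have := @dominated_cvg _ _ _ (mu \x mu)%E setT measurableT
  (fun N z => (D z * W N z)%:E) (fun z => (D z)%:E) (fun z => (D z)%:E * 2%:E)%E.
move=> /(_ _ _ _ iD) dc.
have {}dc : (\int[mu \x mu]_z (D z * W N z)%:E)%E @[N --> \oo] --> (\int[mu \x mu]_z (D z)%:E)%E.
  apply: dc.
  - by move=> N; apply/measurable_EFinP; exact: measurable_funM.
  - move=> z _; apply: cvg_EFin; first exact: nearW.
    rewrite [X in X @ _ --> _](_ : _ = (fun N => D z * W N z)); last by [].
    rewrite -[X in _ --> X]mulr1; apply: cvgM; first exact: cvg_cst.
    have h : (fun N => 1 + (\sum_(n < N.+1) g n (c n * z.1 - s n * z.2)) / N.+1%:R) @ \oo --> (1 : R).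
      rewrite -[X in _ --> X]addr0; apply: cvgD; first exact: cvg_cst.
      by have := gm z.1 z.2; rewrite -cvg_shiftS.
    have e : (fun N => W N.+1 z) =
        (fun N => 1 + (\sum_(n < N.+1) g n (c n * z.1 - s n * z.2)) / N.+1%:R).
      apply/funext => N.
      by rewrite /W /Phi big_split /= sumr_const card_ord mulrDl divff// pnatr_eq0.
    by rewrite -cvg_shiftS; rewrite -e in h; exact: h.
  - by move=> z _; rewrite -EFinM.
  - move=> N z _; have h0 : 0 <= D z * W N z by rewrite mulr_ge0.
    rewrite (gee0_abs (x := (D z * W N z)%:E)) ?[X in is_true X](lee_fin 0)//.
    have e : ((D z)%:E * 2%:E = (D z * 2)%:E)%E by rewrite EFinM.
    rewrite e lee_fin.
    exact: (ler_wpM2l (D0 z) (W2 N z)).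
move: dc; rewrite -cvg_shiftS intD => dc.
have {}dc : (fun N => k * (capmean (cst 1) + (\sum_(n < N.+1) capmean (g n)) / N.+1%:R)) @ \oo --> k * capmean (cst 1).
  have <- : (fun N => fine (\int[mu \x mu]_z (D z * W N.+1 z)%:E)%E) =
    (fun N => k * (capmean (cst 1) + (\sum_(n < N.+1) capmean (g n)) / N.+1%:R)).
    by apply/funext => N; rewrite intW.
  by move/fine_cvgP: dc => [].
have h : (fun N => k^-1 * (k * (capmean (cst 1) + (\sum_(n < N.+1) capmean (g n)) / N.+1%:R)) -
    capmean (cst 1)) @ \oo --> k^-1 * (k * capmean (cst 1)) - capmean (cst 1).
  by apply: cvgB; last exact: cvg_cst; apply: cvgM => //; exact: cvg_cst.
rewrite mulKf ?gt_eqF// subrr in h; rewrite -cvg_shiftS.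
have e : (fun N => (\sum_(n < N.+1) capmean (g n)) / N.+1%:R) =
  (fun N => k^-1 * (k * (capmean (cst 1) + (\sum_(n < N.+1) capmean (g n)) / N.+1%:R)) - capmean (cst 1)).
  by apply/funext => N; rewrite mulKf ?gt_eqF//; ring.
by rewrite -e in h; exact: h.
Qed.

End disc.

(** * Complex powers and their cap averages *)

Section complex_power.
Variable R : realType.
Local Notation mu := (@lebesgue_measure R).
Implicit Types (z al kp : R[i]) (v x : R).

Definition cpow z v : R[i] := (expR (Re z * ln v))%:C * (cos (Im z * ln v) +i* sin (Im z * ln v)).

Lemma cpow1 z : cpow z 1 = 1.
Proof. by rewrite /cpow ln1 !mulr0 expR0 cos0 sin0 mul1r. Qed.

Lemma nm_cpow z v : nm (cpow z v) = expR (Re z * ln v).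
Proof.
rewrite nmM nmR ger0_norm ?expR_ge0//; set t := Im z * ln v.
suff -> : nm (cos t +i* sin t) = 1 by rewrite mulr1.
by rewrite /nm /= cos2Dsin2 sqrtr1.
Qed.

Lemma cpow_natD n z v : 0 < v -> cpow (n%:R + z) v = (v ^+ n)%:C * cpow z v.
Proof.
move=> v0; rewrite /cpow ReD ImD.
have -> : n%:R = (n%:R)%:C :> R[i] by rewrite rmorph_nat.
rewrite /= add0r mulrDl expRD expRM_natl lnK ?posrE//.
by rewrite mulrA -rmorphM.
Qed.

Lemma is_derive_linear (c x : R) : is_derive x 1 (fun u => c * u) c.
Proof.
have h : is_derive x 1 (c *: (@id R)) (c *: 1) by exact: is_deriveZ.
by apply: is_derive_eq h _; rewrite /GRing.scale /= mulr1.
Qed.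

(** Derivatives are taken of real functions, so a complex identity is expressed by the real parts of
    all its multiples [al]; the same device recurs below with unit factors. *)
Lemma is_derive_cpow al z v : 0 < v ->
  is_derive v 1 (fun u => Re (al * cpow z u)) (Re (al * z * cpow (z - 1) v)).
Proof.
move=> v0; pose a := Re z; pose b := Im z; pose L := ln v.
pose phi (L : R) := expR (a * L) * (Re al * cos (b * L) - Im al * sin (b * L)).
have dE : is_derive L 1 (fun u => expR (a * u)) (expR (a * L) * a).
  apply: (@is_derive1_comp _ expR (fun u => a * u)); exact: is_derive_linear.
have dC : is_derive L 1 (fun u => Re al * cos (b * u)) (Re al * (- sin (b * L) * b)).
  apply: (@is_derive1_comp _ (fun u => Re al * u) (fun u => cos (b * u))).
    exact: is_derive_linear.
  apply: (@is_derive1_comp _ cos (fun u => b * u)); exact: is_derive_linear.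
have dS : is_derive L 1 (fun u => Im al * sin (b * u)) (Im al * (cos (b * L) * b)).
  apply: (@is_derive1_comp _ (fun u => Im al * u) (fun u => sin (b * u))).
    exact: is_derive_linear.
  apply: (@is_derive1_comp _ sin (fun u => b * u)); exact: is_derive_linear.
have dphi : is_derive L 1 phi _ := is_deriveM dE (is_deriveB dC dS).
have dL := is_derive1_ln v0.
have h := @is_derive1_comp R phi (@ln R) v _ _ dphi dL.
have -> : (fun u => Re (al * cpow z u)) = phi \o @ln R.
  by apply/funext => u; rewrite /phi /a /b /cpow /=; move: (al) (z) => [p q] [p' q'] /=; ring.
apply: is_derive_eq h _.
rewrite /cpow ReB ImB /= subr0 mulrBl mul1r expRD expRN lnK ?posrE//.
rewrite -/a -/b -/L /GRing.scale /=.
have aux (p q p' q' E c d : R) : (E * (p * (- d * q') - q * (c * q')) + (p * c - q * d) * (E * p')) / v =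
    Re ((p +i* q) * (p' +i* q') * ((E / v)%:C * (c +i* d))) by rewrite /=; ring.
have eC (u : R[i]) : u = Re u +i* Im u by case: u.
by rewrite !fctE [in RHS](eC al) [in RHS](eC z); exact: aux.
Qed.

Lemma derivable_within_continuous (f : R -> R) (a b : R) :
  (forall t : R, a <= t <= b -> derivable f t 1) -> {within `[a, b], continuous f}.
Proof.
move=> hf; apply: continuous_in_subspaceT => t; rewrite inE /= in_itv /= => ht.
by apply/differentiable_continuous/derivable1_diffP; exact: hf.
Qed.

Lemma Rintegral_derive (F f : R -> R) (a b : R) : a < b ->
  (forall t : R, a <= t <= b -> is_derive t 1 F (f t)) ->
  (forall t : R, a <= t <= b -> derivable f t 1) ->
  (\int[mu]_(t in `[a, b]) f t)%R = F b - F a.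
Proof.
move=> ab hF hf.
have cF : {within `[a, b], continuous F}.
  by apply: derivable_within_continuous => t /hF ?; exact: ex_derive.
rewrite /Rintegral (@continuous_FTC2 _ f F)//.
- exact: derivable_within_continuous hf.
- have [_ cl cr] := (continuous_within_itvP F ab).1 cF.
  split => // t; rewrite in_itv /= => /andP[h1 h2].
  by apply: ex_derive; apply: hF; rewrite !ltW.
- move=> t; rewrite in_itv /= => /andP[h1 h2].
  by rewrite derive1E; apply: derive_val; apply: hF; rewrite !ltW.
Qed.

Lemma mean_value_bound (f df : R -> R) (x K : R) :
  (forall t : R, `|t| <= `|x| -> is_derive t 1 f (df t)) ->
  (forall t, `|t| <= `|x| -> `|df t| <= K) -> `|f x - f 0| <= K * `|x|.
Proof.
move=> hf hK.
have main a b : a <= b -> (forall t, a <= t <= b -> `|t| <= `|x|) -> `|f b - f a| <= K * (b - a).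
  move=> ab hab; have [||t tab ->] := @MVT_segment _ f df a b ab.
  - by move=> t; rewrite in_itv /= => /andP[h1 h2]; apply/hf/hab; rewrite !ltW.
  - by apply: derivable_within_continuous => t /hab /hf ?; exact: ex_derive.
  rewrite normrM (ger0_norm (_ : 0 <= b - a)) ?subr_ge0// ler_wpM2r ?subr_ge0//.
  by apply/hK/hab; move: tab; rewrite in_itv.
have [x0|x0] := leP 0 x.
  rewrite (ger0_norm x0) -[X in K * X]subr0; apply: main => // t /andP[t0 tx].
  by rewrite !ger0_norm.
rewrite distrC (ltr0_norm x0) -[X in K * X]sub0r; apply: main; first exact: ltW.
by move=> t /andP[tx t0]; rewrite (ler0_norm t0) (ltr0_norm x0) lerN2.
Qed.

Lemma is_derive_monomial (c x : R) n :
  is_derive x 1 (fun u => c * u ^+ n) (c * (n%:R * x ^+ n.-1)).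
Proof.
apply: (@is_derive1_comp _ (fun u => c * u) (fun u => u ^+ n)).
  exact: is_derive_linear.
have h : is_derive x 1 ((@id R) ^+ n) _ := is_deriveX n (is_derive_id x 1).
have e : (id : R -> R) ^+ n = (fun u => u ^+ n) by apply/funext => u; rewrite exprfctE.
by rewrite e in h; apply: is_derive_eq h _; rewrite /GRing.scale /= mulr1.
Qed.

(* The coefficients of the binomial series of (1 + x)^z. *)
Fixpoint gbin z j : R[i] :=
  if j is j'.+1 then z / j'.+1%:R * gbin (z - 1) j' else 1.

Lemma gbinS z j : gbin (z + 1) j * (z + 1 - j%:R) = gbin z j * (z + 1).
Proof.
elim: j z => [|j IH] z; first by rewrite subr0.
rewrite /= addrK.
have j0 : (j.+1%:R : R[i]) != 0 by rewrite pnatr_eq0.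
have e := IH (z - 1); rewrite subrK in e.
have -> : (z + 1) / j.+1%:R * gbin z j * (z + 1 - j.+1%:R) =
   (z + 1) / j.+1%:R * (gbin z j * (z - j%:R)) by rewrite -natr1; ring.
by rewrite e; ring.
Qed.

Lemma gbin_neq0 z j : Im z != 0 -> gbin z j != 0.
Proof.
elim: j z => [|j IH] z z0 /=; first exact: oner_neq0.
rewrite !mulf_neq0 ?invr_eq0 ?pnatr_eq0 ?IH//.
  by apply: contra z0 => /eqP ->.
by rewrite ImB /= subr0.
Qed.

Lemma ln_half x : `|x| <= 1 / 2 -> `|ln (1 + x)| <= 1.
Proof.
rewrite ler_norml => /andP[h1 h2]; have v0 : 0 < 1 + x by lra.
rewrite ler_norml; apply/andP; split.
  rewrite lerNl -lnV ?posrE//; apply: le_trans (_ : (1 + x)^-1 - 1 <= _).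
    have := @le_ln1Dx _ ((1 + x)^-1 - 1); rewrite addrCA subrr addr0; apply.
    by rewrite ltrBDr addNr invr_gt0.
  by rewrite lerBlDr -(ler_pM2l v0) mulfV ?gt_eqF//; lra.
apply: (le_trans (@le_ln1Dx _ x _)); lra.
Qed.

(** The derivative of the remainder of order m + 1 for z is z times the remainder of order m for z -
    1, so the mean value inequality gains a factor |x|. The constant 2 comes from bounding real and
    imaginary parts separately. *)
Lemma cpow_taylor z m : exists C : R, forall x, `|x| <= 1 / 2 ->
  nm (cpow z (1 + x) - \sum_(j < m) gbin z j * (x ^+ j)%:C) <= C * `|x| ^+ m.
Proof.
elim: m z => [|m IH] z.
  exists (expR `|Re z|) => x hx.
  rewrite big_ord0 subr0 expr0 mulr1 nm_cpow ler_expR.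
  apply: (le_trans (ler_norm _)); rewrite normrM ler_piMr//; exact: ln_half.
have [C hC] := IH (z - 1).
exists (2 * (nm z * C)) => x hx.
pose g t := cpow z (1 + t) - \sum_(j < m.+1) gbin z j * (t ^+ j)%:C.
pose dg t := z * (cpow (z - 1) (1 + t) - \sum_(j < m) gbin (z - 1) j * (t ^+ j)%:C).
have g0 : g 0 = 0.
  rewrite /g addr0 cpow1 big_ord_recl /= expr0 mul1r big1 ?addr0 ?subrr// => j _.
  by rewrite expr0n /= mulr0.
have dgb t : `|t| <= `|x| -> nm (dg t) <= nm z * C * `|x| ^+ m.
  move=> tx; rewrite nmM -mulrA ler_wpM2l ?nm_ge0//.
  apply: (le_trans (hC t (le_trans tx hx))).
  have C0 : 0 <= C.
    have := hC (1/2); rewrite ger0_norm; last lra.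
    move=> /(_ (lexx _)) h; have := le_trans (nm_ge0 _) h.
    by rewrite pmulr_lge0// exprn_gt0//; lra.
  by rewrite ler_wpM2l// lerXn2r ?nnegrE.
have dgd al (t : R) : `|t| <= `|x| -> is_derive t 1 (fun u => Re (al * g u)) (Re (al * dg t)).
  move=> tx.
  have t0 : 0 < 1 + t by have := le_trans tx hx; rewrite ler_norml; lra.
  have -> : (fun u => Re (al * g u)) = (fun u => Re (al * cpow z (1 + u))) -
      \sum_(j < m.+1) (fun u => Re (al * gbin z j) * u ^+ j).
    apply/funext => u; rewrite /g mulrBr ReB !fctE fct_sumE; congr (_ - _).
    rewrite mulr_sumr Re_sum; apply: eq_bigr => j _.
    by rewrite mulrA mulrC ReZ mulrC.
  have d1 : is_derive t 1 (fun u => Re (al * cpow z (1 + u))) (Re (al * z * cpow (z - 1) (1 + t)) * 1).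
    apply: (@is_derive1_comp _ (fun u => Re (al * cpow z u)) (fun u => 1 + u)).
      exact: is_derive_cpow.
    have h := is_deriveD (is_derive_cst (1 : R) t 1) (is_derive_id t 1).
    by apply: is_derive_eq h _; rewrite add0r.
  have d2 := is_derive_sum (fun j : 'I_m.+1 => is_derive_monomial (Re (al * gbin z j)) t j).
  apply: is_derive_eq (is_deriveB d1 d2) _.
  rewrite mulr1 /dg mulrBr mulrBr ReB mulrA; congr (_ - _).
  rewrite big_ord_recl /= mul0r mulr0 add0r !mulr_sumr Re_sum; apply: eq_bigr => j _.
  rewrite /bump /= add1n mulrA -[RHS]/(Re _).
  have -> : al * (z * (gbin (z - 1) j * (t ^+ j)%:C)) =
      (j.+1%:R * t ^+ j)%:C * (al * (z / j.+1%:R * gbin (z - 1) j)).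
    have j0 : (j.+1%:R : R[i]) != 0 by rewrite pnatr_eq0.
    by rewrite rmorphM /= rmorph_nat; field.
  by rewrite ReZ; ring.
have bnd al : nm al = 1 -> `|Re (al * g x)| <= nm z * C * `|x| ^+ m.+1.
  move=> al1.
  have := @mean_value_bound (fun u => Re (al * g u)) (fun u => Re (al * dg u)) x
    (nm z * C * `|x| ^+ m) (dgd al).
  rewrite g0 mulr0 subr0 exprSr mulrA; apply=> t /dgb; apply: le_trans.
  by rewrite (le_trans (norm_Re_le _))// nmM al1 mul1r.
rewrite -/(g x); apply: (le_trans (nm_le_ReIm _)).
have e1 : Re (g x) = Re (1 * g x) by rewrite mul1r.
have e2 : `|Im (g x)| = `|Re ((0 +i* 1) * g x)|.
  by case: (g x) => p q; rewrite /= mul0r mul1r sub0r normrN.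
rewrite e1 e2 -mulrA mulr_natl; apply: lerD; apply: bnd; first exact: nm1.
by rewrite /nm /= expr0n /= add0r expr1n sqrtr1.
Qed.

Section cap_of_power.
Variable s : R.
Hypothesis s0 : s != 0.

(** The function |v|^(2 pi i s); its value 0 at 0 makes means vanish for terminating sequences
    too. *)
Definition psi (v : R) : R[i] := if v == 0 then 0 else ee (s * ln `|v|).

Let w : R[i] := 0 +i* (2 * pi * s).

Lemma Im_w : Im w != 0.
Proof. by rewrite /w /= !mulf_neq0// ?gt_eqF ?pi_gt0. Qed.

Lemma natDw_neq0 (n : nat) : n%:R + w != 0.
Proof.
apply/eqP => /(congr1 (@complex.Im _)) /eqP; rewrite ImD -(rmorph_nat (real_complex R)) /= add0r.
by apply/negP; exact: Im_w.
Qed.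

Lemma psi_cpow v : 0 < v -> psi v = cpow w v.
Proof.
move=> v0; rewrite /psi gt_eqF// gtr0_norm// /cpow /ee /w /= mul0r expR0 mul1r.
by rewrite mulrA.
Qed.

Lemma psiN v : psi (- v) = psi v.
Proof. by rewrite /psi oppr_eq0 normrN. Qed.

Lemma nm_psi v : nm (psi v) <= 1.
Proof. by rewrite /psi; case: eqP => _; rewrite ?nm0 ?ler01// nm_ee. Qed.

(** The antiderivative of (1 - (v - x)^2) v^w that tends to 0 with v, found by expanding the square
    in powers of v. *)
Let H x v := ((1 - x ^+ 2)%:C / (1 + w)) * cpow (1 + w) v
  + ((2 * x)%:C / (2%:R + w)) * cpow (2%:R + w) v - (3%:R + w)^-1 * cpow (3%:R + w) v.

Lemma is_derive_H kp x v : 0 < v ->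
  is_derive v 1 (fun u => Re (kp * H x u)) ((1 - (v - x) ^+ 2) * Re (kp * cpow w v)).
Proof.
move=> v0; have w1 := natDw_neq0 1; have w2 := natDw_neq0 2; have w3 := natDw_neq0 3.
have -> : (fun u => Re (kp * H x u)) =
  (fun u => Re (kp * ((1 - x ^+ 2)%:C / (1 + w)) * cpow (1 + w) u))
  + (fun u => Re (kp * ((2 * x)%:C / (2%:R + w)) * cpow (2%:R + w) u))
  - (fun u => Re (kp * (3%:R + w)^-1 * cpow (3%:R + w) u)).
  by apply/funext => u; rewrite !fctE -ReD -ReB -!mulrA -mulrDr -mulrBr /H -!mulrA.
have d1 := is_derive_cpow (kp * ((1 - x ^+ 2)%:C / (1 + w))) (1 + w) v0.
have d2 := is_derive_cpow (kp * ((2 * x)%:C / (2%:R + w))) (2%:R + w) v0.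
have d3 := is_derive_cpow (kp * (3%:R + w)^-1) (3%:R + w) v0.
apply: is_derive_eq (is_deriveB (is_deriveD d1 d2) d3) _.
rewrite -ReD -ReB.
have -> : 1 + w - 1 = 0%:R + w by rewrite add0r addrC addKr.
have -> : 2%:R + w - 1 = 1%:R + w by rewrite mulr2n; ring.
have -> : 3%:R + w - 1 = 2%:R + w by rewrite -[3%:R]/(2.+1%:R) -[2.+1%:R]natr1; ring.
rewrite !cpow_natD//.
rewrite -ReZ; congr (@complex.Re R _).
have e1 : (1 - x ^+ 2)%:C = 1 - x%:C ^+ 2 by rewrite rmorphB rmorph1 rmorphXn.
have e2 : (2 * x)%:C = 2 * x%:C by rewrite rmorphM rmorph_nat.
have e3 : (1 - (v - x) ^+ 2)%:C = 1 - (v%:C - x%:C) ^+ 2.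
  by rewrite rmorphB rmorph1 rmorphXn rmorphB.
have e4 n : (v ^+ n)%:C = v%:C ^+ n by rewrite rmorphXn.
rewrite e1 e2 e3 !e4.
field.
by rewrite w1 w2 w3.
Qed.

Lemma nm_addw (n : nat) : (1 <= n)%N -> 1 <= nm (n%:R + w).
Proof.
move=> n1; apply: le_trans (norm_Re_le _).
by rewrite ReD -(rmorph_nat (real_complex R)) /= addr0 ger0_norm ?ler0n// ler1n.
Qed.

Lemma nm_H x v : `|x| <= 1 / 2 -> 0 < v <= 1 -> nm (H x v) <= 3 * v.
Proof.
move=> hx /andP[v0 v1]; move: (hx); rewrite ler_norml => /andP[x1 x2].
have nmw : nm (cpow w v) = 1 by rewrite nm_cpow /w /= mul0r expR0.
have aux c (n : nat) : (0 < n)%N -> nm c <= 1 -> nm (c / (n%:R + w) * cpow (n%:R + w) v) <= v.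
  move=> n0 c1; rewrite cpow_natD// nmM [X in _ * X]nmM nmw mulr1 [X in X * _]nmM nmV nmR normrX (ger0_norm (ltW v0)).
  rewrite -[leRHS]mul1r; apply: ler_pM.
  - by rewrite mulr_ge0// ?invr_ge0 nm_ge0.
  - by rewrite exprn_ge0// ltW.
  - by rewrite ler_pdivrMr ?mul1r ?(le_trans c1) ?nm_addw// (lt_le_trans ltr01) ?nm_addw.
  - by rewrite -[leRHS]expr1 ler_wiXn2l// ltW.
have -> : 3 * v = v + v + v by ring.
apply: (le_trans (nmB _ _)); apply: lerD; last first.
  by have := aux 1 3%N isT; rewrite nm1 mul1r; apply.
apply: (le_trans (nmD _ _)); apply: lerD.
  apply: (aux _ 1%N) => //; rewrite nmR ger0_norm; nra.
by apply: (aux _ 2%N) => //; rewrite nmR ler_norml; lra.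
Qed.

(** Writing x = v - 1 in the coefficients leaves only v^(2 + w) and v^(3 + w) at v = 1 + x, both
    smooth near x = 0. *)
Lemma H_top x : `|x| <= 1 / 2 -> H x (1 + x) =
  2 / ((1 + w) * (2%:R + w)) * (cpow (2%:R + w) (1 + x) - cpow (3%:R + w) (1 + x) / (3%:R + w)).
Proof.
rewrite ler_norml => /andP[x1 x2]; have v0 : 0 < 1 + x by lra.
have w1 := natDw_neq0 1; have w2 := natDw_neq0 2; have w3 := natDw_neq0 3.
rewrite /H -[1 + w]/(1%:R + w) !cpow_natD//.
have e1 : (1 - x ^+ 2)%:C = 1 - x%:C ^+ 2 by rewrite rmorphB rmorph1 rmorphXn.
have e2 : (2 * x)%:C = 2 * x%:C by rewrite rmorphM rmorph_nat.
have e4 n : ((1 + x) ^+ n)%:C = (1 + x%:C) ^+ n by rewrite rmorphXn rmorphD rmorph1.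
rewrite e1 e2 !e4; field.
by rewrite w1 w2 w3.
Qed.

Lemma measurable_psi kp : measurable_fun setT (fun v => Re (kp * psi v)).
Proof.
pose th v := 2 * pi * (s * ln `|v|).
have -> : (fun v => Re (kp * psi v)) = (fun v : R => if v == 0 then 0 else
    Re kp * cos (th v) - Im kp * sin (th v)).
  by apply/funext => v; rewrite /psi; case: eqP => _; [rewrite mulr0|case: (kp) => p q].
have mth : measurable_fun setT th.
  apply: measurable_funM => //; apply: measurable_funM => //.
  by apply: (measurableT_comp (@measurable_ln R)); exact: normr_measurable.
apply: measurable_fun_ifT => //.
  exact: measurable_fun_eqr.
apply: measurable_funB; apply: measurable_funM => //.
  by apply: measurableT_comp mth; apply: continuous_measurable_fun; exact: continuous_cos.
by apply: measurableT_comp mth; apply: continuous_measurable_fun; exact: continuous_sin.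
Qed.

Lemma Re_psi_le kp v : nm kp = 1 -> `|Re (kp * psi v)| <= 1.
Proof. by move=> k1; rewrite (le_trans (norm_Re_le _))// nmM k1 mul1r nm_psi. Qed.

Lemma derivable_Re_cpow_shift kp x (c : R) (y : R) : 0 < c * (x + y) ->
  derivable (fun t : R => (1 - t ^+ 2) * Re (kp * cpow w (c * (x + t)))) y 1.
Proof.
move=> h.
have d1 : is_derive y 1 (fun t : R => 1 - t ^+ 2) _ :=
  is_deriveB (is_derive_cst (1 : R) y 1) (is_deriveX 2 (is_derive_id y 1)).
have d2 : is_derive y 1 (fun t => c * (x + t)) _ :=
  @is_derive1_comp R (fun u => c * u) (fun t => x + t) _ _ _ (is_derive_linear c _)
   (is_deriveD (is_derive_cst (x : R) y 1) (is_derive_id y 1)).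
have d3 := @is_derive1_comp R (fun u => Re (kp * cpow w u)) (fun t => c * (x + t)) y _ _
  (is_derive_cpow kp w h) d2.
by have [] := is_deriveM d1 d3.
Qed.

(* On each side of the singularity y = -x the integrand has the antiderivative
   given by H, so the two integrals over |x + y| > e are explicit. *)
Lemma capmean_psi kp x : nm kp = 1 -> `|x| <= 1 / 2 ->
  capmean (fun y => Re (kp * psi (x + y))) = Re (kp * (H x (1 + x) + H (- x) (1 - x))).
Proof.
move=> k1 hx; move: (hx); rewrite ler_norml => /andP[x1 x2].
pose f y := (1 - y ^+ 2) * Re (kp * psi (x + y)).
have mf : measurable_fun setT (fun y => Re (kp * psi (x + y))).
  by apply: (measurableT_comp (measurable_psi kp)); exact: measurable_funD.
have fi : mu.-integrable [set` `[-1, 1]%R] (EFin \o f).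
  by apply: (@cap_integrable _ _ 1) => // y; exact: Re_psi_le.
(* The 8 e is 2 e for the interval around the singularity, where the integrand is at most 1, plus 3
   e for each of the two boundary values of [H]. *)
suff main e : 0 < e < 1 / 2 -> `|capmean (fun y => Re (kp * psi (x + y))) -
    Re (kp * (H x (1 + x) + H (- x) (1 - x)))| <= 8 * e.
  apply/eqP; rewrite -subr_eq0 -normr_eq0 eq_le normr_ge0 andbT.
  apply/ler_addgt0Pr => e e0; rewrite add0r.
  have e8 : 0 < Num.min (e / 8) (1 / 3) < 1 / 2.
    by rewrite lt_min gt_min; apply/andP; split; [apply/andP; split; lra|apply/orP; right; lra].
  apply: (le_trans (main _ e8)); have : Num.min (e / 8) (1 / 3) <= e / 8 by rewrite ge_min lexx.
  lra.
move=> /andP[e0 e2].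
pose a1 := - x - e; pose a2 := - x + e.
(* As psi is even, v = -(x + t) turns the left side into the right side for -x. *)
have left_part : (\int[mu]_(t in `[(-1)%R, a1]) f t)%R =
    Re (kp * H (- x) (1 - x)) - Re (kp * H (- x) e).
  pose F t := - Re (kp * H (- x) (- (x + t))).
  have fE t : x + t < 0 -> f t = (1 - t ^+ 2) * Re (kp * cpow w (- 1 * (x + t))).
    by move=> h; rewrite /f -psiN psi_cpow ?oppr_gt0// mulN1r.
  transitivity (\int[mu]_(t in `[(-1)%R, a1]) ((1 - t ^+ 2) * Re (kp * cpow w (- 1 * (x + t)))))%R.
    apply: eq_Rintegral => t; rewrite inE /= in_itv /= /a1 => /andP[h1 h2].
    by rewrite fE//; lra.
  have hd (t : R) : -1 <= t <= a1 -> 0 < - 1 * (x + t) by rewrite /a1 => /andP[h1 h2]; lra.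
  transitivity (F a1 - F (-1)).
    apply: Rintegral_derive.
    - by rewrite /a1; lra.
    - move=> t /hd ht.
      have d1 : is_derive t 1 (fun t => - 1 * (x + t)) _ :=
        @is_derive1_comp R (fun u => - 1 * u) (fun t => x + t) _ _ _ (is_derive_linear _ _)
        (is_deriveD (is_derive_cst (x : R) t 1) (is_derive_id t 1)).
      have d2 := @is_derive1_comp R (fun u => Re (kp * H (- x) u)) (fun t => - 1 * (x + t)) t _ _
        (is_derive_H kp (- x) ht) d1.
      have -> : F = - ((fun u => Re (kp * H (- x) u)) \o (fun t => - 1 * (x + t))).
        by apply/funext => u; rewrite /F fctE /= mulN1r.
      apply: is_derive_eq (is_deriveN d2) _.
      by rewrite add0r mulr1 mulrN1 opprK; congr ((1 - _) * _); ring.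
    - by move=> t /hd ht; exact: derivable_Re_cpow_shift.
  rewrite /F /a1; have -> : - (x + (- x - e)) = e by ring.
  have -> : - (x + -1) = 1 - x by ring.
  by rewrite opprK addrC.
have right_part : (\int[mu]_(t in `[a2, 1%R]) f t)%R =
    Re (kp * H x (1 + x)) - Re (kp * H x e).
  pose F t := Re (kp * H x (x + t)).
  transitivity (\int[mu]_(t in `[a2, 1%R]) ((1 - t ^+ 2) * Re (kp * cpow w (1 * (x + t)))))%R.
    apply: eq_Rintegral => t; rewrite inE /= in_itv /= /a2 => /andP[h1 h2].
    by rewrite /f psi_cpow ?mul1r//; lra.
  have hd (t : R) : a2 <= t <= 1 -> 0 < 1 * (x + t) by rewrite /a2 => /andP[h1 h2]; lra.
  transitivity (F 1 - F a2).
    apply: Rintegral_derive.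
    - by rewrite /a2; lra.
    - move=> t /hd; rewrite mul1r => ht.
      have d1 : is_derive t 1 (fun t => x + t) _ :=
        is_deriveD (is_derive_cst (x : R) t 1) (is_derive_id t 1).
      have d2 := @is_derive1_comp R (fun u => Re (kp * H x u)) (fun t => x + t) t _ _
        (is_derive_H kp x ht) d1.
      apply: is_derive_eq d2 _.
      by rewrite add0r mulr1; congr ((1 - _) * _); ring.
    - by move=> t /hd ht; exact: derivable_Re_cpow_shift.
  rewrite /F /a2; have -> : x + (- x + e) = e by ring.
  by rewrite (addrC x 1).
have fi1 : mu.-integrable [set` `]a1, 1%R]] (EFin \o f).
  apply: integrableS fi => //; apply: subset_itvr; rewrite bnd_simp /a1; lra.
have fi2 : mu.-integrable [set` `]a1, a2]] (EFin \o f).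
  apply: integrableS fi1 => //; apply: subset_itvl; rewrite bnd_simp /a2; lra.
have fi3 : mu.-integrable [set` `]a2, 1%R]] (EFin \o f).
  apply: integrableS fi1 => //; apply: subset_itvr; rewrite bnd_simp /a1 /a2; lra.
have s1 : ((\int[mu]_(t in `[(-1), 1]) f t) - (\int[mu]_(t in `[(-1), a1]) f t) =
    (\int[mu]_(t in `]a1, 1]) f t))%R.
  by apply: Rintegral_itvB => //; rewrite bnd_simp /a1; lra.
have s2 : ((\int[mu]_(t in `]a1, 1]) f t) - (\int[mu]_(t in `]a1, a2]) f t) =
    (\int[mu]_(t in `]a2, 1]) f t))%R.
  by apply: Rintegral_itvB => //; rewrite bnd_simp /a1 /a2; lra.
have s3 := Rintegral_itv_obnd_cbnd fi3.
have m12 : mu [set` `]a1, a2]] = (2 * e)%:E.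
  rewrite lebesgue_measure_itv /= lte_fin ifT; last by rewrite /a1 /a2; lra.
  by rewrite -EFinB; congr EFin; rewrite /a1 /a2; ring.
have icst (r : R) : mu.-integrable [set` `]a1, a2]] (EFin \o cst r).
  apply: measurable_bounded_integrable => //.
    have h : (mu [set` `]a1, a2]] < +oo)%E by rewrite m12 ltry.
    exact: h.
  by exists `|r|; split => // M rM y _ /=; exact: ltW.
have intcst (r : R) : (\int[mu]_(t in `]a1, a2]) (cst r) t)%R = r * (2 * e).
  by rewrite Rintegral_cst//; congr (_ * _); rewrite -[RHS]/(fine (2 * e)%:E) -m12.
have fb t : -1 <= t <= 1 -> `|f t| <= 1.
  move=> /andP[t1 t2]; rewrite normrM mulr_ile1//; last exact: Re_psi_le.
  by rewrite ger0_norm; nra.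
have dom t : `]a1, a2]%classic t -> `|f t| <= 1.
  rewrite /= in_itv /= /a1 /a2 => /andP[t1 t2]; apply: fb; apply/andP; split; lra.
have mid : `|(\int[mu]_(t in `]a1, a2]) f t)%R| <= 2 * e.
  rewrite ler_norml; apply/andP; split.
    rewrite -mulN1r -intcst; apply: le_Rintegral => // t /dom; rewrite ler_norml.
    by move=> /andP[].
  rewrite -[leRHS]mul1r -intcst; apply: le_Rintegral => // t /dom; rewrite ler_norml.
  by move=> /andP[].
have H1 : `|Re (kp * H x e)| <= 3 * e.
  apply: (le_trans (norm_Re_le _)); rewrite nmM k1 mul1r nm_H//.
  by rewrite e0 /=; lra.
have H2 : `|Re (kp * H (- x) e)| <= 3 * e.
  apply: (le_trans (norm_Re_le _)); rewrite nmM k1 mul1r nm_H ?normrN//.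
  by rewrite e0 /=; lra.
have E : capmean (fun y => Re (kp * psi (x + y))) = (\int[mu]_(t in `[(-1), 1]) f t)%R by [].
rewrite E mulrDr ReD.
rewrite left_part in s1; rewrite s3 right_part in s2.
have aux (I J K p q p' q' r : R) : I - (p - p') = J -> J - K = q - q' ->
    `|K| <= 2 * r -> `|q'| <= 3 * r -> `|p'| <= 3 * r -> `|I - (q + p)| <= 8 * r.
  move=> h1 h2; rewrite !ler_norml => /andP[h3 h4] /andP[h5 h6] /andP[h7 h8].
  by apply/andP; split; lra.
exact: aux s1 s2 mid H1 H2.
Qed.

(** The Taylor coefficients of the value in [capmean_psi], read off from [H_top]; the factor 1 +
    (-1)^j comes from adding the contributions of x and -x. *)
Definition cap_coef j : R[i] := (1 + (-1) ^+ j) * (2 / ((1 + w) * (2%:R + w)) *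
  (gbin (2%:R + w) j - gbin (3%:R + w) j / (3%:R + w))).

(** By [gbinS] the difference equals gbin (2 + w) j times (2 + w - j) / (3 + w - j), and no factor n
    + w - j is zero since w is not real. *)
Lemma cap_coef_neq0 j : ~~ odd j -> cap_coef j != 0.
Proof.
move=> oj; have w1 := natDw_neq0 1; have w2 := natDw_neq0 2; have w3 := natDw_neq0 3.
have nat_re (n : nat) : Im (n%:R : R[i]) = 0 by rewrite -(rmorph_nat (real_complex R)).
have sj (n : nat) : n%:R + w - j%:R != 0.
  apply/eqP => /(congr1 (@complex.Im R)) /eqP; rewrite ImB ImD !nat_re /= add0r subr0.
  by apply/negP; exact: Im_w.
rewrite /cap_coef -signr_odd (negbTE oj) expr0 !mulf_neq0//; first by rewrite invr_eq0 mulf_neq0.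
have e3 : 3%:R + w = 2%:R + w + 1 by rewrite -[3%:R]/(2.+1%:R) -natr1; ring.
have g := gbinS (2%:R + w) j; rewrite -e3 in g.
have -> : gbin (3%:R + w) j = gbin (2%:R + w) j * (3%:R + w) / (3%:R + w - j%:R).
  by rewrite -g mulfK.
have -> : gbin (2%:R + w) j - gbin (2%:R + w) j * (3%:R + w) / (3%:R + w - j%:R) / (3%:R + w) =
   gbin (2%:R + w) j * ((2%:R + w - j%:R) / (3%:R + w - j%:R)).
  have := sj 3%N; rewrite e3 => s3; field.
  by rewrite s3 -e3 w3.
rewrite !mulf_neq0 ?invr_eq0//; apply: gbin_neq0.
by rewrite ImD nat_re add0r Im_w.
Qed.

Lemma cap_coef_expansion M : exists C : R, forall kp x, nm kp = 1 -> `|x| <= 1 / 2 ->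
  `|capmean (fun y => Re (kp * psi (x + y))) -
    Re (kp * \sum_(j < M) cap_coef j * (x ^+ j)%:C)| <= C * `|x| ^+ M.
Proof.
have [C2 h2] := cpow_taylor (2%:R + w) M; have [C3 h3] := cpow_taylor (3%:R + w) M.
pose c := 2 / ((1 + w) * (2%:R + w)); pose d := (3%:R + w)^-1.
exists (2 * (nm c * (C2 + nm d * C3))) => kp x k1 hx.
rewrite capmean_psi// -ReB -mulrBr; apply: (le_trans (norm_Re_le _)); rewrite nmM k1 mul1r.
pose r2 t := cpow (2%:R + w) (1 + t) - \sum_(j < M) gbin (2%:R + w) j * (t ^+ j)%:C.
pose r3 t := cpow (3%:R + w) (1 + t) - \sum_(j < M) gbin (3%:R + w) j * (t ^+ j)%:C.
have part t : `|t| = `|x| -> nm (c * (r2 t - r3 t * d)) <= nm c * (C2 + nm d * C3) * `|x| ^+ M.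
  move=> tx; rewrite nmM -mulrA ler_wpM2l ?nm_ge0// [leRHS]mulrDl.
  have tx2 : `|t| <= 1 / 2 by rewrite tx.
  apply: (le_trans (nmB _ _)); rewrite -tx; apply: lerD; first exact: h2.
  by rewrite nmM mulrC -mulrA ler_wpM2l ?nm_ge0//; exact: h3.
have -> : H x (1 + x) + H (- x) (1 - x) - \sum_(j < M) cap_coef j * (x ^+ j)%:C =
    c * (r2 x - r3 x * d) + c * (r2 (- x) - r3 (- x) * d).
  rewrite !H_top ?normrN// /r2 /r3.
  set S2 := \sum_(j < M) gbin (2%:R + w) j * (x ^+ j)%:C.
  set S3 := \sum_(j < M) gbin (3%:R + w) j * (x ^+ j)%:C.
  set T2 := \sum_(j < M) gbin (2%:R + w) j * ((- x) ^+ j)%:C.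
  set T3 := \sum_(j < M) gbin (3%:R + w) j * ((- x) ^+ j)%:C.
  have -> : \sum_(j < M) cap_coef j * (x ^+ j)%:C = c * (S2 - S3 * d) + c * (T2 - T3 * d).
    rewrite /S2 /S3 /T2 /T3 !mulr_suml -!sumrB !mulr_sumr -big_split /=.
    apply: eq_bigr => j _; rewrite [in X in _ = _ + X]exprNn !rmorphM !rmorphXn /= rmorphN1.
    by rewrite /cap_coef -/c -/d; ring.
  by rewrite -/c -/d; ring.
apply: (le_trans (nmD _ _)); rewrite -[2 * _ * _]mulrA mulr_natl.
by apply: lerD; apply: part; rewrite ?normrN.
Qed.

End cap_of_power.



End complex_power.

(** * Resonance excludes the Benford property *)

Section resonance.
Variable R : realType.

Lemma Rmean_of_cmean (kp : R[i]) (u : nat -> R[i]) : nm kp = 1 -> cmean u 0 ->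
  (fun N => (\sum_(n < N) Re (kp * u n)) / N%:R) @ \oo --> (0 : R).
Proof.
move=> k1 hu; apply/cvgrPdist_le => e e0; have [N0 h] := hu e e0.
exists N0.+1 => // N /= NN; rewrite sub0r normrN normrM normfV.
have N1 : 0 < (N%:R : R) by rewrite ltr0n (leq_trans _ NN).
rewrite (gtr0_norm N1) ler_pdivrMr// -Re_sum -mulr_sumr.
apply: (le_trans (norm_Re_le _)); rewrite nmM k1 mul1r.
by have := h N (ltnW NN); rewrite mul0r subr0.
Qed.

Lemma cmean_Re_le (kp : R[i]) (x : nat -> R) (v : nat -> R[i]) (l : R[i]) (D : R) : nm kp = 1 ->
  (fun N => (\sum_(n < N) x n) / N%:R) @ \oo --> (0 : R) -> cmean v l ->
  (forall n, `|x n - Re (kp * v n)| <= D) -> `|Re (kp * l)| <= D.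
Proof.
move=> k1 hx hv hD; apply/ler_addgt0Pr => e e0; have e2 : 0 < e / 2 by rewrite divr_gt0.
have [N0 h0] := hv _ e2; have /cvgrPdist_le /(_ _ e2)[N1 _ h1] := hx.
pose N := (maxn N0 N1).+1.
have n0 : (N0 <= N)%N by rewrite /N -addn1 (leq_trans (leq_maxl N0 N1))// leq_addr.
have n1 : (N1 <= N)%N by rewrite /N -addn1 (leq_trans (leq_maxr N0 N1))// leq_addr.
have NR : 0 < (N%:R : R) by rewrite ltr0n.
have {}h1 := h1 N n1; rewrite /= sub0r normrN normrM normfV (gtr0_norm NR) ler_pdivrMr// in h1.
have {}h0 := h0 N n0.
have h2 : `|\sum_(n < N) (x n - Re (kp * v n))| <= D * N%:R.
  apply: (le_trans (ler_norm_sum _ _ _)); apply: (@le_trans _ _ (\sum_(n < N) D)).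
    by apply: ler_sum => n _; exact: hD.
  by rewrite sumr_const card_ord -[_ *+ _]mulr_natr.
have h3 : `|Re (kp * (\sum_(n < N) v n - l * N%:R))| <= e / 2 * N%:R.
  by apply: (le_trans (norm_Re_le _)); rewrite nmM k1 mul1r.
rewrite -(ler_pM2r NR) -[X in _ * X](gtr0_norm NR) -normrM.
have lN : Re (kp * l) * N%:R = Re (kp * (l * N%:R)).
  by rewrite mulrA [in RHS]mulrC -(rmorph_nat (real_complex R)) ReZ mulrC.
rewrite lN; move: h1 h2 h3; rewrite sumrB mulrBr ReB mulr_sumr Re_sum.
set a := \sum_(n < N) x n; set c := \sum_(n < N) Re _; set g := Re _; set m := N%:R.
rewrite !ler_norml => /andP[p1 p2] /andP[p3 p4] /andP[p5 p6].
by apply/andP; split; lra.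
Qed.

(** Letting t tend to 0 kills the constant coefficient; then one divides by t. *)
Lemma small_poly_coef0 (c : nat -> R[i]) (m : nat) (T C : R) : 0 < T ->
  (forall t, 0 < t <= T -> nm (\sum_(j < m) c j * (t ^+ j)%:C) <= C * t ^+ m) ->
  forall j, (j < m)%N -> c j = 0.
Proof.
move=> T0; elim: m c => // m IH c h.
pose S t := \sum_(j < m) c j.+1 * (t ^+ j)%:C.
have e t : \sum_(j < m.+1) c j * (t ^+ j)%:C = c 0%N + t%:C * S t.
  rewrite big_ord_recl expr0 mulr1; congr (_ + _); rewrite /S mulr_sumr.
  by apply: eq_bigr => j _; rewrite lift0 exprS rmorphM /=; ring.
have c0 : c 0%N = 0.
  apply/eqP; rewrite -nm_eq0 eq_le nm_ge0 andbT; apply/ler_addgt0Pr => eps e0; rewrite add0r.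
  pose B := \sum_(j < m) nm (c j.+1) + `|C|.
  have B0 : 0 <= B by rewrite addr_ge0// sumr_ge0// => j _; exact: nm_ge0.
  pose t := Num.min (Num.min T 1) (eps / (B + 1)).
  have t0 : 0 < t by rewrite !lt_min T0 ltr01 divr_gt0// ltr_wpDl.
  have tT : t <= T by rewrite !ge_min lexx.
  have t1 : t <= 1 by rewrite !ge_min lexx orbT.
  have te : t * (B + 1) <= eps.
    by rewrite -ler_pdivlMr ?ltr_wpDl// !ge_min lexx !orbT.
  have := h t; rewrite t0 tT => /(_ isT); rewrite e => ht.
  have nS : nm (S t) <= \sum_(j < m) nm (c j.+1).
    apply: (le_trans (nm_sum _ _ _)); apply: ler_sum => j _.
    rewrite nmM nmR ger0_norm ?exprn_ge0 ?(ltW t0)// ler_piMr ?nm_ge0//.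
    by rewrite exprn_ile1// ltW.
  have hC : C * t ^+ m.+1 <= `|C| * t.
    apply: (le_trans (ler_wpM2r _ (ler_norm C))); first by rewrite exprn_ge0// ltW.
    by rewrite ler_wpM2l// -[leRHS]expr1 ler_wiXn2l// ltW.
  have : nm (c 0%N) <= nm (c 0%N + t%:C * S t) + nm (t%:C * S t).
    by rewrite -{1}[c 0%N](addrK (t%:C * S t)); exact: nmB.
  rewrite [X in _ + X]nmM nmR (gtr0_norm t0).
  have : t * nm (S t) <= t * (\sum_(j < m) nm (c j.+1)) by rewrite ler_wpM2l// ltW.
  move: te ht hC; rewrite /B.
  set U := \sum_(j < m) _; set V := nm (c 0%N); set W := nm (_ + _).
  by nra.
case=> [|j] // jm; apply: (IH (fun j => c j.+1)) => // t tT.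
have t0 : 0 < t by case/andP: tT.
have := h t tT; rewrite e c0 add0r nmM nmR (gtr0_norm t0) exprS mulrCA.
by rewrite ler_pM2l.
Qed.

Section core.
Variables (s : R) (s0 : s != 0) (us : seq R[i]) (u1 chi : R[i]).
Hypotheses (us1 : forall u, u \in us -> nm u = 1) (u11 : nm u1 = 1) (chi1 : nm chi = 1).

Let L n : R := Re (\sum_(u <- us) u ^+ n).

Lemma L_bound n : `|L n| <= (size us)%:R.
Proof.
apply: (le_trans (norm_Re_le _)); apply: (le_trans (nm_sum _ _ _)).
rewrite big_seq (eq_bigr (fun=> 1)); last by move=> u /us1 h; rewrite nmX h expr1n.
by rewrite -big_seq big_const_seq count_predT iter_addr addr0.
Qed.

(** For fixed t, [smoothing] in xi turns the hypothesis into mean zero of the cap averages at t L_n.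
    Their expansion shows that the polynomial in t with coefficients [cap_coef s j * e j] is of
    order t^(M + 1), so each coefficient vanishes. *)
Lemma resonant_moment0 (e : nat -> R[i]) :
  (forall (t : R) (xi : R[i]), cmean (fun n => chi ^+ n.+1 *
     psi s (t * L n.+1 + Re (xi * u1 ^+ n.+1))) 0) ->
  (forall j, cmean (fun n => chi ^+ n.+1 * (L n.+1 ^+ j)%:C) (e j)) ->
  forall M, ~~ odd M -> e M = 0.
Proof.
move=> hB he M oM.
have [C hC] := cap_coef_expansion s0 M.+1.
pose K : R := (size us)%:R + 1.
have K0 : 0 < K by rewrite ltr_wpDl.
have LK n : `|L n| <= K by apply: (le_trans (L_bound n)); rewrite lerDl.
(* For t up to this bound |t L_n| <= 1/2, where the expansion of the cap average holds. *)
have T0 : 0 < (2 * K)^-1 by rewrite invr_gt0 mulr_gt0.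
have C0 : 0 <= C.
  have := hC 1 (1/2) (nm1 _); rewrite ger0_norm; last lra.
  move=> /(_ (lexx _)) h; have := le_trans (normr_ge0 _) h.
  by rewrite pmulr_lge0// exprn_gt0//; lra.
have main (t : R) kp : 0 < t <= (2 * K)^-1 -> nm kp = 1 ->
    `|Re (kp * \sum_(j < M.+1) (cap_coef s j * e j) * (t ^+ j)%:C)| <= C * K ^+ M.+1 * t ^+ M.+1.
  move=> /andP[t0 tT] k1.
  have tL n : `|t * L n| <= t * K by rewrite normrM (gtr0_norm t0) ler_pM2l.
  have tK : t * K <= 1 / 2.
    apply: (le_trans (ler_wpM2r (ltW K0) tT)).
    by rewrite le_eqVlt; apply/orP; left; apply/eqP; field; rewrite gt_eqF.
  pose g n y := Re (kp * chi ^+ n.+1 * psi s (t * L n.+1 + y)).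
  have kc n : nm (kp * chi ^+ n.+1) = 1 by rewrite nmM nmX chi1 expr1n k1 mulr1.
  have sm := @smoothing R g (fun n => Re (u1 ^+ n.+1)) (fun n => Im (u1 ^+ n.+1)).
  have {}sm : (fun N => (\sum_(n < N) capmean (g n)) / N%:R) @ \oo --> (0 : R).
    apply: sm.
    - by move=> n; rewrite -nm2 nmX u11 !expr1n.
    - move=> n; apply: (measurableT_comp (measurable_psi s (kp * chi ^+ n.+1))).
      exact: measurable_funD.
    - by move=> n y; apply: Re_psi_le.
    move=> a c; have := Rmean_of_cmean k1 (hB t (a +i* c)).
    have -> // : (fun N => (\sum_(n < N) Re (kp * (chi ^+ n.+1 *
        psi s (t * L n.+1 + Re ((a +i* c) * u1 ^+ n.+1))))) / N%:R) =
      (fun N => (\sum_(n < N) g n (Re (u1 ^+ n.+1) * a - Im (u1 ^+ n.+1) * c)) / N%:R).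
    apply/funext => N; congr (_ / _); apply: eq_bigr => n _.
    have hr (z : R[i]) : Re ((a +i* c) * z) = Re z * a - Im z * c.
      by case: z => p q /=; ring.
    by rewrite /g hr mulrA.
  have hv : cmean (fun n => chi ^+ n.+1 * \sum_(j < M.+1) cap_coef s j * ((t * L n.+1) ^+ j)%:C)
      (\sum_(j < M.+1) (cap_coef s j * e j) * (t ^+ j)%:C).
    apply: cmean_eql; last apply: cmean_ext; last first.
    - apply: (cmean_sum (index_enum 'I_M.+1)) => j.
      exact: (cmeanZ (cap_coef s j * (t ^+ j)%:C) (he j)).
    - move=> n /=; rewrite mulr_sumr; apply: eq_bigr => j _.
      by rewrite exprMn rmorphM /=; ring.
    - by apply: eq_bigr => j _; ring.
  apply: (cmean_Re_le k1 sm hv) => n.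
  have h := hC _ (t * L n.+1) (kc n); rewrite /g mulrA.
  apply: (le_trans (h (le_trans (tL _) tK))).
  rewrite -mulrA ler_wpM2l// -exprMn [K * t]mulrC lerXn2r ?nnegrE//.
  by rewrite mulr_ge0// ltW.
have := @small_poly_coef0 (fun j => cap_coef s j * e j) M.+1 (2 * K)^-1 (2 * (C * K ^+ M.+1)) T0.
move=> /(_ _ M (ltnSn M))h.
have /eqP : cap_coef s M * e M = 0.
  apply: h => t tT; set S := \sum_(j < _) _.
  apply: (le_trans (nm_le_ReIm _)).
  have e1 : Re S = Re (1 * S) by rewrite mul1r.
  have e2 : `|Im S| = `|Re ((0 +i* 1) * S)|.
    by case: (S) => p q; rewrite /= mul0r mul1r sub0r normrN.
  rewrite e1 e2 -mulrA mulr_natl; apply: lerD; apply: main => //; first exact: nm1.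
  by rewrite /nm /= expr0n /= add0r expr1n sqrtr1.
by rewrite mulf_eq0 (negbTE (cap_coef_neq0 s0 oM)) => /eqP.
Qed.

End core.

End resonance.

(** * Moments of power sums *)

Section moments.
Variable R : realType.

(** All words of length k, with repetitions: the expansion of a k-th power of a sum. *)
Fixpoint products (V : seq R[i]) k : seq R[i] :=
  if k is k'.+1 then [seq v * p | v <- V, p <- products V k'] else [:: 1].

Lemma powersum_expn (V : seq R[i]) k n :
  (\sum_(v <- V) v ^+ n) ^+ k = \sum_(p <- products V k) p ^+ n.
Proof.
elim: k => [|k IH]; first by rewrite expr0 /= big_seq1 expr1n.
rewrite exprS IH /= big_allpairs_dep mulr_suml; apply: eq_bigr => v _.
by rewrite mulr_sumr; apply: eq_bigr => p _; rewrite exprMn.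
Qed.

Lemma prod_products (V ws : seq R[i]) : (forall v, v \in ws -> v \in V) ->
  \prod_(v <- ws) v \in products V (size ws).
Proof.
elim: ws => [|v ws IH] h; first by rewrite big_nil inE.
rewrite big_cons /=; apply: allpairs_f; first by apply: h; rewrite mem_head.
by apply: IH => u hu; apply: h; rewrite inE hu orbT.
Qed.

Lemma nm_products (V : seq R[i]) k p : (forall v, v \in V -> nm v = 1) ->
  p \in products V k -> nm p = 1.
Proof.
move=> hV; elim: k p => [|k IH] p /=; first by rewrite inE => /eqP ->; exact: nm1.
by move=> /allpairsP[[v q] /= [/hV hv /IH hq ->]]; rewrite nmM hv hq mulr1.
Qed.

Lemma cmean_powersum (V : seq R[i]) (chi : R[i]) k : nm chi = 1 ->
  (forall v, v \in V -> nm v = 1) ->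
  cmean (fun n => chi ^+ n.+1 * (\sum_(v <- V) v ^+ n.+1) ^+ k)
    (\sum_(p <- products V k) (chi * p == 1)%:R).
Proof.
move=> c1 hV.
suff h (P : seq R[i]) : (forall p, p \in P -> nm p = 1) ->
    cmean (fun n => \sum_(p <- P) (chi * p) ^+ n.+1) (\sum_(p <- P) (chi * p == 1)%:R).
  apply: cmean_ext (h _ _); last by move=> p; exact: nm_products.
  by move=> n; rewrite powersum_expn mulr_sumr; apply: eq_bigr => p _; rewrite exprMn.
elim: P => [|p P IH] hP.
  by rewrite big_nil; apply: cmean_ext (cmean_cst 0) => n; rewrite big_nil.
rewrite big_cons; apply: cmean_ext => [n|]; first by rewrite big_cons.
apply: cmeanD; last by apply: IH => q hq; apply: hP; rewrite inE hq orbT.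
have gp : nm (chi * p) = 1 by rewrite nmM c1 hP ?mem_head// mulr1.
apply: cmean_eql; last first.
  by apply: cmean_ext (cmeanZ (chi * p) (cmean_geo gp)) => n; rewrite exprS.
by case: eqVneq => [->|_]; rewrite ?mulr1 ?mulr0.
Qed.

Lemma powersum_conj (us : seq R[i]) n : (forall u, u \in us -> nm u = 1) ->
  (Re (\sum_(u <- us) u ^+ n))%:C = (\sum_(v <- us ++ [seq u^-1 | u <- us]) v ^+ n) / 2.
Proof.
move=> h; rewrite big_cat /= big_map.
have -> : \sum_(u <- us) u^-1 ^+ n = cj (\sum_(u <- us) u ^+ n).
  by rewrite cj_sum [LHS]big_seq [RHS]big_seq; apply: eq_bigr => u /h hu; rewrite cjX conj_unit.
by case: (\sum_(u <- us) _) => p q; apply/eqP; rewrite eq_complex; apply/andP; split; apply/eqP => /=; field.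
Qed.

Lemma cmean_moment (us : seq R[i]) (chi : R[i]) k : nm chi = 1 ->
  (forall u, u \in us -> nm u = 1) ->
  cmean (fun n => chi ^+ n.+1 * ((Re (\sum_(u <- us) u ^+ n.+1)) ^+ k)%:C)
   (2^-1 ^+ k * \sum_(p <- products (us ++ [seq u^-1 | u <- us]) k) (chi * p == 1)%:R).
Proof.
move=> c1 h; have hV v : v \in us ++ [seq u^-1 | u <- us] -> nm v = 1.
  rewrite mem_cat => /orP[/h//|/mapP[u /h hu ->]].
  by rewrite nmV hu invr1.
apply: cmean_ext (cmeanZ _ (cmean_powersum k c1 hV)) => n /=.
by rewrite rmorphXn /= powersum_conj// exprMn exprVn; ring.
Qed.

Lemma cmean_eventually0 (a : nat -> R[i]) (N0 : nat) : (forall n, nm (a n) <= 1) ->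
  (forall n, (N0 <= n)%N -> a n = 0) -> cmean a 0.
Proof.
move=> a1 a0; apply: cmean_near => eps e0; exists (fun=> 0); split.
  exact: cmean_cst.
exists (Num.bound (N0%:R / eps)) => N hN.
have : \sum_(n < N) nm (a n - 0) <= N0%:R.
  elim: N {hN} => [|N IH]; first by rewrite big_ord0 ler0n.
  have [NN|NN] := leqP N0 N.
    by rewrite big_ord_recr /= a0// subr0 nm0 addr0.
  apply: (@le_trans _ _ (\sum_(n < N.+1) 1)).
    by apply: ler_sum => n _; rewrite subr0.
  by rewrite sumr_const card_ord ler_nat.
move=> /le_trans; apply; rewrite mulrC -ler_pdivrMr//.
by apply: (le_trans (ltW (archi_boundP _))); rewrite ?ler_nat// divr_ge0// ltW.
Qed.

End moments.

Section benford_to_nonresonant.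
Variable R : realType.

Lemma letters_list (r : R) (Z : set R[i]) (ws : seq R[i]) :
  (forall v, v \in ws -> letter r Z v) ->
  exists2 zs : seq R[i], (forall z, z \in zs -> Z z) &
    forall v, v \in ws -> exists2 z, z \in zs & v = z / r%:C \/ v = (z / r%:C)^-1.
Proof.
elim: ws => [|v ws IH] h; first by exists [::].
have [|zs hz hw] := IH; first by move=> u hu; apply: h; rewrite inE hu orbT.
have [z Zz hv] := h v (mem_head _ _).
exists (z :: zs) => [u|u]; rewrite inE => /orP[/eqP ->//|]; first exact: hz.
  by exists z; rewrite ?mem_head.
by move=> /hw[z' hz' hu]; exists z' => //; rewrite inE hz' orbT.
Qed.

Lemma logb_circle_notin_span d (A : 'M[R]_d.+1) (b : nat) (r : R) (z0 : R[i]) : (1 < b)%N ->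
  (forall x y : 'cV[R]_d.+1,
     benford b (fun n => (x^T *m (A ^+ n) *m y) 0 0) \/
     terminating d.+1 (fun n => (x^T *m (A ^+ n) *m y) 0 0)) ->
  0 < r -> (spectrum A `&` circle r) z0 ->
  ~ spanH (spectrum A `&` circle r) (logb b r).
Proof.
move=> b1 hA r0 Zz0 hspan; set Z := spectrum A `&` circle r in Zz0 hspan.
have Zr z : Z z -> nm z = r.
  by move=> [_]; rewrite /circle /= normcE_nm => /complexI.
have [h h0 [ws hws eh]] := span_word r0 Zr hspan.
have [zs1 hz1 hw1] := letters_list hws.
(* The point [z0] is added because the term xi u_1^n has to be realized as well. *)
pose zs := z0 :: zs1.
have hz z : z \in zs -> Z z by rewrite inE => /orP[/eqP ->//|/hz1].
pose us := [seq z / r%:C | z <- zs].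
have us1 u : u \in us -> nm u = 1.
  by move=> /mapP[z /hz/Zr zr ->]; rewrite nmM nmV zr nmR gtr0_norm// divff// gt_eqF.
pose u1 := z0 / r%:C.
have u11 : nm u1 = 1 by apply/us1/mapP; exists z0 => //; exact: mem_head.
(* The factor 2 allows the word for [ee (h%:R * rho)] to be written twice, which makes the length
   even. *)
pose rho := logb b r; pose chi := ee ((2 * h)%:R * rho).
have lb0 : 0 < ln (b%:R : R) := lnb_gt0 R b1.
(* With this s, [psi s v] is [ee] of 2h log_b |v|, so chi^n psi(f n) is the character of frequency
   2h at log_b |r^n f(n)|. *)
pose s : R := (2 * h)%:R / ln b%:R.
have s0 : s != 0 by rewrite mulf_neq0 ?invr_eq0 ?gt_eqF// ltr0n muln_gt0.
have he := cmean_moment _ (nm_ee _) us1 (chi := chi).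
have rC : r%:C != 0 :> R[i] by rewrite -nm_eq0 nmR normr_eq0 gt_eqF.
have [y hy] := @realize _ _ A zs (fun z hz' => (hz z hz').1).
have hB (t : R) (xi : R[i]) : cmean (fun n => chi ^+ n.+1 *
    psi s (t * Re (\sum_(u <- us) u ^+ n.+1) + Re (xi * u1 ^+ n.+1))) 0.
  have [|x hx] := hy ((xi, z0) :: [seq (t%:C, z) | z <- zs]).
    move=> p; rewrite inE => /orP[/eqP ->|/mapP[z zz ->//]]; exact: mem_head.
  pose f n : R := t * Re (\sum_(u <- us) u ^+ n) + Re (xi * u1 ^+ n).
  have xE n : (x^T *m A ^+ n *m y) 0 0 = r ^+ n * f n.
    have eu : expsum ((xi, z0) :: [seq (t%:C, z) | z <- zs]) n =
        (r ^+ n)%:C * (t%:C * \sum_(u <- us) u ^+ n + xi * u1 ^+ n).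
      rewrite expsum_cons /expsum big_map /= -mulr_sumr /us big_map /u1 rmorphXn /=.
      have -> : \sum_(z <- zs) (z / r%:C) ^+ n = (\sum_(z <- zs) z ^+ n) / r%:C ^+ n.
        by rewrite mulr_suml; apply: eq_bigr => z _; rewrite exprMn exprVn.
      by rewrite exprMn exprVn; field; rewrite expf_neq0.
    by rewrite hx eu ReZ ReD ReZ.
  have rn n : 0 < r ^+ n by rewrite exprn_gt0.
  have a1 n : nm (chi ^+ n.+1 * psi s (f n.+1)) <= 1.
    by rewrite nmM nmX nm_ee expr1n mul1r nm_psi.
  have [hb|ht] := hA x y.
    apply: (benford_weyl b1 hb (_ : 0 < 2 * h)%N a1); first by rewrite muln_gt0.
    move=> n; rewrite xE => xn0; have fn0 : f n.+1 != 0 by apply: contra xn0 => /eqP ->; rewrite mulr0.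
    rewrite /psi (negbTE fn0) /chi -eeMn -eeD; congr ee.
    rewrite normrM (gtr0_norm (rn _)) /logb lnM ?posrE ?normr_gt0// lnXn// /s /rho /logb.
    by rewrite -[ln r *+ _]mulr_natl; field; rewrite gt_eqF.
  apply: (cmean_eventually0 (N0 := d.+1) a1) => n nd.
  have := ht n.+1 (leqW nd); rewrite xE => /eqP.
  rewrite mulf_eq0 gt_eqF//= => /eqP fn0.
  by rewrite fn0 /psi eqxx mulr0.
have := resonant_moment0 s0 us1 u11 (nm_ee _) hB he.
pose V := us ++ [seq u^-1 | u <- us].
(* The word twice, with its letters inverted, so that its product is 1 / chi. *)
pose ws2 := [seq v^-1 | v <- ws ++ ws].
have hw2 v : v \in ws2 -> v \in V.
  move=> /mapP[u]; rewrite mem_cat orbb => /hw1[z zz hu] ->.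
  have zus : z / r%:C \in us by apply/mapP; exists z => //; rewrite inE zz orbT.
  rewrite mem_cat; case: hu => ->; last by rewrite invrK zus.
  by apply/orP; right; apply/mapP; exists (z / r%:C).
have mem := prod_products hw2.
have chi2 : chi * \prod_(v <- ws2) v = 1.
  rewrite /ws2 big_map prodfV big_cat /= -eh /chi natrM -mulrA eeMn expr2.
  by rewrite divff// mulf_neq0// ee_neq0.
move=> /(_ (size ws2)); rewrite /ws2 size_map size_cat addnn odd_double => /(_ isT)/eqP.
rewrite mulf_eq0 expf_eq0 invr_eq0 pnatr_eq0 andbF /= => /eqP.
have -> : (size ws).*2 = size ws2 by rewrite /ws2 size_map size_cat addnn.
(* A vanishing sum of zeros and ones, in which the word [ws2] would count 1. *)
rewrite -natr_sum => /eqP; rewrite pnatr_eq0 sum_nat_seq_eq0 => /allP/(_ _ mem).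
by rewrite chi2 eqxx.
Qed.

Lemma circle_Delta_rational d (A : 'M[R]_d.+1) (b : nat) (r : R) (z0 : R[i]) : (1 < b)%N ->
  (forall x y : 'cV[R]_d.+1,
     benford b (fun n => (x^T *m (A ^+ n) *m y) 0 0) \/
     terminating d.+1 (fun n => (x^T *m (A ^+ n) *m y) 0 0)) ->
  0 < r -> (spectrum A `&` circle r) z0 ->
  Delta (spectrum A `&` circle r) `&` range (ratr : rat -> R) = [set 1].
Proof.
move=> b1 hA r0 Zz0; set Z := spectrum A `&` circle r in Zz0 *.
have Zr z : Z z -> nm z = r.
  by move=> [_]; rewrite /circle /= normcE_nm => /complexI.
apply/seteqP; split=> [_ [[z [w [Zz Zw ->]]] [q _ eq]]|_ ->]; last first.
  by split; [exact: Delta1 Zz0|exists 1 => //; exact: rmorph1].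
have [->|zw] := eqVneq z w; first by rewrite /= subrr mul0r addr0.
(* q - 1 is the difference of the arguments in full turns; its denominator is an exponent at which
   the powers of z and w agree. *)
exfalso; pose k := `|denq (q - 1)|%N.
have k0 : (0 < k)%N by rewrite absz_gt0 denq_neq0.
have kE : (k%:R : R) = (denq (q - 1))%:~R by rewrite -[k%:R]/((k : int)%:~R) absz_denq.
have dn0 : (denq (q - 1))%:~R != 0 :> R by rewrite intr_eq0 denq_neq0.
have e : z ^+ k = w ^+ k.
  have rC : r%:C != 0 :> R[i] by rewrite -nm_eq0 nmR normr_eq0 gt_eqF.
  suff : (z / r%:C) ^+ k = (w / r%:C) ^+ k.
    by rewrite !exprMn => /mulIf; apply; rewrite expf_neq0// invr_eq0.
  rewrite (Z_polar r0 Zr Zz) (Z_polar r0 Zr Zw) -!eeMn.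
  have -> : k%:R * (arg z / (2 * pi)) = k%:R * (arg w / (2 * pi)) + (numq (q - 1))%:~R.
    have : k%:R * ((arg z - arg w) / (2 * pi)) = (numq (q - 1))%:~R :> R.
      have -> : (arg z - arg w) / (2 * pi) = ratr (q - 1).
        have -> : ratr (q - 1) = ratr q - 1 :> R by rewrite rmorphB rmorph1.
        by rewrite eq [RHS]addrC addKr.
      by rewrite kE /ratr mulrC divfK.
    by move=> <-; rewrite mulrBl; ring.
  by rewrite eeD ee_int mulr1.
have [x [y]] := root_of_unity_resonance b1 Zz.1 Zw.1 (Z_neq0 r0 Zr Zz) zw k0 e.
by apply; exact: hA.
Qed.

End benford_to_nonresonant.

Theorem theorem3p4 (R : realType) (d : nat) (hd : (0 < d)%N) (A : 'M[R]_d)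
    (b : nat) (hb : (1 < b)%N) :
  (forall x y : 'cV[R]_d,
     benford b (fun n => (x^T *m (A ^+ n) *m y) 0 0) \/
     terminating d (fun n => (x^T *m (A ^+ n) *m y) 0 0))
  <-> nonresonant b (spectrum A).
Proof.
case: d hd A => // d _ A; split=> [hA r r0|hN x y]; last exact: nonresonant_benford.
have [->|/set0P[z0 Zz0]] := eqVneq (spectrum A `&` circle r) set0; [by left|right].
split; first exact: (circle_Delta_rational hb hA r0 Zz0).
exact: (logb_circle_notin_span hb hA r0 Zz0).
Qed.
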